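(* Let $q_E\colon E\to M$ be a smooth vector bundle. (i) A linear splitting $\Sigma\colon (TM\oplus E^* )\times_M E\to TE\oplus T^*E$ defines a Dorfman connection $\Delta^\Sigma\colon \Gamma(TM\oplus E^* )\times\Gamma(E\oplus T^*M)\to\Gamma(E\oplus T^*M)$ by $$\Sigma\big((X,\varepsilon)(m), e(m)\big)=\big( T_me\,X(m),\ \mathbf d_{e(m)}\ell_\varepsilon\big)-\big(\Delta^\Sigma_{(X,\varepsilon)}(e,0)\big)^\uparrow(e(m)),\qquad m\in M,\qquad (\ast)$$ and $\Delta^\Sigma_{(X,\varepsilon)}(0,\theta)=(0,\pounds_X\theta)$, for all $e\in\Gamma(E)$, $(X,\varepsilon)\in\Gamma(TM\oplus E^* )$ and $\theta\in\Omega^1(M)$. (ii) Conversely, each Dorfman connection $\Delta\colon \Gamma(TM\oplus E^* )\times\Gamma(E\oplus T^*M)\to\Gamma(E\oplus T^*M)$ defines a linear splitting $\Sigma^\Delta\colon (TM\oplus E^* )\times_M E\to TE\oplus T^*E$ by formula $(\ast)$ (with $\Sigma=\Sigma^\Delta$ and $\Delta^\Sigma=\Delta$). (iii) The maps $\Delta\mapsto\Sigma^\Delta$ and $\Sigma\mapsto\Delta^\Sigma$ are inverse to each other.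
   Context: Everything is smooth. $TM\oplus E^*$ is anchored by $\mathrm{pr}_{TM}$ and paired with $E\oplus T^*M$ by $\langle (X,\varepsilon),(e,\theta)\rangle=\langle\varepsilon,e\rangle+\langle\theta,X\rangle$. A Dorfman connection here is an $\mathbb R$-bilinear map $\Delta\colon \Gamma(TM\oplus E^* )\times\Gamma(E\oplus T^*M)\to\Gamma(E\oplus T^*M)$ such that for all $f\in C^\infty(M)$, $\nu=(X,\varepsilon)\in\Gamma(TM\oplus E^* )$, $\tau\in\Gamma(E\oplus T^*M)$: (a) $\Delta_{f\nu}\tau=f\Delta_\nu\tau+\langle\nu,\tau\rangle(0,\mathbf df)$; (b) $\Delta_\nu(f\tau)=f\Delta_\nu\tau+X(f)\tau$; (c) $\Delta_\nu(0,\mathbf df)=(0,\mathbf d(X(f)))$. For $\varepsilon\in\Gamma(E^* )$, $\ell_\varepsilon\in C^\infty(E)$ is the fibrewise linear function $e_m\mapsto\langle\varepsilon(m),e_m\rangle$. For $e\in\Gamma(E)$, $T_me\colon T_mM\to T_{e(m)}E$ is the derivative of $e\colon M\to E$. For $(e,\theta)\in\Gamma(E\oplus T^*M)$ the vertical (core) section $(e,\theta)^\uparrow$ of $TE\oplus T^*E\to E$ is $(e,\theta)^\uparrow(e'_m)=\big(\tfrac{d}{dt}|_{t=0}(e'_m+te(m)),\ (T_{e'_m}q_E)^t\theta(m)\big)$, $e'_m\in E_m$. The direct sum over $E$, $TE\oplus T^*E$, is a double vector bundle with sides $E$ and $TM\oplus E^*$ and core $E\oplus T^*M$. Its projection to $E$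 is $\pi_E$; its projection to $TM\oplus E^*$ is $\Phi_E=(Tq_E,r_E)$, where $\langle r_E(\theta_{e_m}),e'_m\rangle=\langle\theta_{e_m},\tfrac{d}{dt}|_{t=0}(e_m+te'_m)\rangle$ for $\theta_{e_m}\in T^*_{e_m}E$. The vector bundle structure over $TM\oplus E^*$ is the sum of that of $TE\to TM$ (tangent maps of the operations of $E\to M$) and that of $T^*E\to E^*$ (if $r_E(\theta_{e_m})=r_E(\omega_{e'_m})$ then $\theta_{e_m}+\omega_{e'_m}\in T^*_{e_m+e'_m}E$ is given by $\langle\theta_{e_m}+\omega_{e'_m},v+_{TM}w\rangle=\langle\theta_{e_m},v\rangle+\langle\omega_{e'_m},w\rangle$ for $v\in T_{e_m}E$, $w\in T_{e'_m}E$ with $Tq_E v=Tq_E w$). A linear splitting is an injective morphism of double vector bundles $\Sigma\colon(TM\oplus E^* )\times_ME\to TE\oplus T^*E$ over the identities on $E$ and $TM\oplus E^*$: a smooth map with $\Phi_E(\Sigma(\nu_m,e_m))=\nu_m$, $\pi_E(\Sigma(\nu_m,e_m))=e_m$, which is linear in $\nu_m$ for fixed $e_m$ (for the structure over $E$) and linear in $e_m$ for fixed $\nu_m$ (for the structure over $TM\oplus E^*$). *)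

(* Defs.v *)
From HB Require Import structures.
From mathcomp Require Import all_boot all_order all_algebra.
From mathcomp Require Import all_classical all_reals all_analysis.

Set Implicit Arguments.
Unset Strict Implicit.
Unset Printing Implicit Defensive.

Import Order.TTheory GRing.Theory Num.Theory numFieldNormedType.Exports.
Local Open Scope classical_set_scope.
Local Open Scope ring_scope.

(* Smoothness on a subset U, which is always an open set in what follows. *)
Fixpoint Ck_on (R : realType) (V W : normedModType R) (k : nat) (U : set V)
    (f : V -> W) : Prop :=
  match k with
  | 0 => forall x, U x -> {for x, continuous f}
  | k'.+1 => (forall x, U x -> differentiable f x) /\
             (forall v, Ck_on k' U (fun x => 'D_v f x))
  end.

Definition smooth_on (R : realType) (V W : normedModType R) (U : set V)
    (f : V -> W) : Prop := forall k, Ck_on k U f.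

(* A set with an atlas, as bare data; the axioms are in [is_manifold].  The
   chart [chart i] is only meaningful on [cdom i], and [chart_inv i] only on the
   image of [cdom i], where it is the inverse of [chart i].  The topology is the
   one induced by the atlas ([is_open]).  Keeping data and axioms apart lets
   tangent bundles and total spaces be defined by their charts alone. *)
Record atlas_space (R : realType) := AtlasSpace {
  pt :> Type;
  mdim : nat;
  cidx : Type;
  cdom : cidx -> set pt;
  chart : cidx -> pt -> 'rV[R]_mdim;
  chart_inv : cidx -> 'rV[R]_mdim -> pt;
  chart_at : pt -> cidx
}.

Definition is_open (R : realType) (X : atlas_space R) (W : set X) : Prop :=
  forall i : cidx X, open (chart i @` (cdom i `&` W)).

Record is_manifold (R : realType) (X : atlas_space R) : Prop := IsManifold {
  chart_at_dom : forall p : X, cdom (chart_at p) p;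
  chartK : forall (i : cidx X) (p : X), cdom i p -> chart_inv i (chart i p) = p;
  image_open : forall i j : cidx X, open (chart i @` (cdom i `&` cdom j));
  transition_smooth : forall i j : cidx X,
    smooth_on (chart i @` (cdom i `&` cdom j)) (chart j \o chart_inv i);
  manifold_hausdorff : forall p q : X, p <> q ->
    exists U V : set X,
      [/\ is_open U, is_open V, U p, V q & U `&` V = set0];
  manifold_second_countable : exists B : nat -> set X,
    (forall k, is_open (B k)) /\
    (forall (U : set X) p, is_open U -> U p -> exists k, B k p /\ B k `<=` U)
}.

Definition smooth_map (R : realType) (X Y : atlas_space R) (f : X -> Y) : Prop :=
  (forall W : set Y, is_open W -> is_open (f @^-1` W)) /\
  (forall (i : cidx X) (j : cidx Y),
     smooth_on (chart i @` (cdom i `&` f @^-1` cdom j))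
               (chart j \o f \o chart_inv i)).

Definition smooth_fun (R : realType) (X : atlas_space R) (f : X -> R) : Prop :=
  forall i : cidx X, smooth_on (chart i @` cdom i) (f \o chart_inv i).

(* A vector bundle as a family of fibres with a family of local
   trivializations, again as bare data with the axioms in [is_vbundle].
   [trivI i b] is the inverse of [triv i b] for b in [tdom i]. *)
Record vbundle (R : realType) (B : atlas_space R) := VBundle {
  fib : B -> vectType R;
  rank : nat;
  tidx : Type;
  tdom : tidx -> set B;
  triv : tidx -> forall b, fib b -> 'rV[R]_rank;
  trivI : tidx -> forall b, 'rV[R]_rank -> fib b;
  triv_at : B -> tidx
}.

Record is_vbundle (R : realType) (B : atlas_space R) (E : vbundle B) : Prop :=
  IsVBundle {
  triv_at_dom : forall b, tdom (triv_at E b) b;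
  tdom_open : forall i : tidx E, is_open (tdom i);
  triv_linear : forall (i : tidx E) b, tdom i b ->
    forall (a : R) (u v : fib E b),
      triv i (a *: u + v) = a *: triv i u + triv i v;
  trivK : forall (i : tidx E) b, tdom i b ->
    cancel (@triv R B E i b) (trivI i b);
  trivIK : forall (i : tidx E) b, tdom i b ->
    cancel (trivI i b) (@triv R B E i b);
  triv_smooth : forall (i j : tidx E) (c : cidx B) (w : 'rV[R]_(rank E)),
    smooth_on (chart c @` (cdom c `&` (tdom i `&` tdom j)))
              (fun x => triv j (trivI i (chart_inv c x) w))
}.

Definition tot (R : realType) (B : atlas_space R) (E : vbundle B) : atlas_space R :=
  @AtlasSpace R {b : B & fib E b} (mdim B + rank E) (cidx B * tidx E)%type
    (fun ci z => cdom ci.1 (projT1 z) /\ tdom ci.2 (projT1 z))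
    (fun ci z => row_mx (chart ci.1 (projT1 z)) (triv ci.2 (projT2 z)))
    (fun ci x => existT _ (chart_inv ci.1 (lsubmx x))
                          (trivI ci.2 (chart_inv ci.1 (lsubmx x)) (rsubmx x)))
    (fun z => (chart_at (projT1 z), triv_at E (projT1 z))).

Definition tot_pt (R : realType) (B : atlas_space R) (E : vbundle B) (b : B)
    (e : fib E b) : tot E := existT _ b e.

Definition bproj (R : realType) (B : atlas_space R) (E : vbundle B) (z : tot E) : B :=
  projT1 z.

Definition dual_bundle (R : realType) (B : atlas_space R) (E : vbundle B) : vbundle B :=
  @VBundle R B (fun b => 'Hom(fib E b, R^o) : vectType R) (rank E) (tidx E)
    (@tdom R B E)
    (fun i b eps => \row_l (eps (trivI i b (delta_mx 0 l)) : R))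
    (fun i b x => linfun (fun e : fib E b => (triv i e *m x^T) 0 0 : R^o))
    (triv_at E).

Definition whitney (R : realType) (B : atlas_space R) (E F : vbundle B) : vbundle B :=
  @VBundle R B (fun b => (fib E b * fib F b)%type : vectType R)
    (rank E + rank F) (tidx E * tidx F)%type
    (fun ij b => tdom ij.1 b /\ tdom ij.2 b)
    (fun ij b u => row_mx (triv ij.1 u.1) (triv ij.2 u.2))
    (fun ij b x => (trivI ij.1 b (lsubmx x), trivI ij.2 b (rsubmx x)))
    (fun b => (triv_at E b, triv_at F b)).

(* A tangent vector at p, i.e. a class of pairs (chart around p, vector of R^n)
   modulo the derivatives of the transition functions, is represented by its
   coordinates in the chart [chart_at p]. *)
Definition tspace (R : realType) (X : atlas_space R) (p : X) : vectType R :=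
  'rV[R]_(mdim X) : vectType R.

Definition tbundle (R : realType) (X : atlas_space R) : vbundle X :=
  @VBundle R X (@tspace R X) (mdim X) (cidx X) (@cdom R X)
    (fun i p (v : 'rV[R]_(mdim X)) =>
       'd (chart i \o chart_inv (chart_at p)) (chart (chart_at p) p) v)
    (fun i p (x : 'rV[R]_(mdim X)) =>
       'd (chart (chart_at p) \o chart_inv i) (chart i p) x)
    (@chart_at R X).

Definition cotbundle (R : realType) (X : atlas_space R) : vbundle X :=
  dual_bundle (tbundle X).

Definition tmap (R : realType) (X Y : atlas_space R) (f : X -> Y) (p : X) :
    'Hom(tspace p, tspace (f p)) :=
  linfun ('d (chart (chart_at (f p)) \o f \o chart_inv (chart_at p))
             (chart (chart_at p) p)).

Definition ddiff (R : realType) (X : atlas_space R) (f : X -> R) (p : X) :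
    'Hom(tspace p, R^o) :=
  linfun ('d (f \o chart_inv (chart_at p)) (chart (chart_at p) p)
          : 'rV[R]_(mdim X) -> R^o).

(* The velocity at t = 0 of a curve c with c 0 = p. *)
Definition velocity (R : realType) (X : atlas_space R) (p : X) (c : R -> X) :
    tspace p :=
  derive1 (chart (chart_at p) \o c) 0.

(* The Lie derivative of a 1-form.  In the coordinates of the chart at m,
   (L_X theta)_j = X^k d_k theta_j + theta_k d_j X^k. *)
Definition lie_form (R : realType) (M : atlas_space R)
    (X : forall m : M, tspace m) (theta : forall m : M, 'Hom(tspace m, R^o))
    (m : M) : 'Hom(tspace m, R^o) :=
  let i := chart_at m in
  linfun (fun v : 'rV[R]_(mdim M) =>
    ('d (fun x : 'rV[R]_(mdim M) =>
           (theta (chart_inv i x) (@trivI R M (tbundle M) i (chart_inv i x) v) : R))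
        (chart i m) (X m)
     + theta m
        ('d (fun x : 'rV[R]_(mdim M) =>
               @triv R M (tbundle M) i (chart_inv i x) (X (chart_inv i x)))
            (chart i m) v)) : R^o).

Record section (R : realType) (B : atlas_space R) (E : vbundle B) := MkSection {
  sec :> forall b : B, fib E b;
  sec_smooth : smooth_map (fun b => tot_pt (sec b))
}.

(* TM (+) E^*, E (+) T^*M, and TE (+) T^*E as a vector bundle over E. *)
Definition anchorB (R : realType) (M : atlas_space R) (E : vbundle M) : vbundle M :=
  whitney (tbundle M) (dual_bundle E).

Definition coreB (R : realType) (M : atlas_space R) (E : vbundle M) : vbundle M :=
  whitney E (cotbundle M).

Definition bigB (R : realType) (M : atlas_space R) (E : vbundle M) :
    vbundle (tot E) :=
  whitney (tbundle (tot E)) (cotbundle (tot E)).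

Definition pairing (R : realType) (M : atlas_space R) (E : vbundle M) (m : M)
    (nu : (tspace m * 'Hom(fib E m, R^o))%type)
    (tau : (fib E m * 'Hom(tspace m, R^o))%type) : R :=
  nu.2 tau.1 + tau.2 nu.1.

Definition ell (R : realType) (M : atlas_space R) (E : vbundle M)
    (eps : forall m : M, 'Hom(fib E m, R^o)) (z : tot E) : R :=
  eps (projT1 z) (projT2 z).

Definition vlift (R : realType) (M : atlas_space R) (E : vbundle M) (m : M)
    (e u : fib E m) : tspace (tot_pt e) :=
  velocity (tot_pt e) (fun t : R => tot_pt (e + t *: u)).

(* The core section (e, theta)^\uparrow evaluated at e'. *)
Definition core_lift (R : realType) (M : atlas_space R) (E : vbundle M) (m : M)
    (tau : (fib E m * 'Hom(tspace m, R^o))%type) (e' : fib E m) :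
    fib (bigB E) (tot_pt e') :=
  (vlift e' tau.1, (tau.2 \o tmap (@bproj R M E) (tot_pt e'))%VF).

Definition r_map (R : realType) (M : atlas_space R) (E : vbundle M) (m : M)
    (e : fib E m) (theta : 'Hom(tspace (tot_pt e), R^o)) :
    'Hom(fib E m, R^o) :=
  linfun (fun u : fib E m => theta (vlift e u)).
Arguments r_map {R M E m} e theta.

Definition Phi (R : realType) (M : atlas_space R) (E : vbundle M) (m : M)
    (e : fib E m)
    (x : (tspace (tot_pt e) * 'Hom(tspace (tot_pt e), R^o))%type) :
    fib (anchorB E) m :=
  (tmap (@bproj R M E) (tot_pt e) x.1, r_map e x.2).
Arguments Phi {R M E m} e x.

Definition fst_tot (R : realType) (M : atlas_space R) (E : vbundle M)
    (z : tot (whitney E E)) : tot E := tot_pt (projT2 z).1.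

Definition snd_tot (R : realType) (M : atlas_space R) (E : vbundle M)
    (z : tot (whitney E E)) : tot E := tot_pt (projT2 z).2.

Definition add_tot (R : realType) (M : atlas_space R) (E : vbundle M)
    (z : tot (whitney E E)) : tot E := tot_pt ((projT2 z).1 + (projT2 z).2).

Definition scale_tot (R : realType) (M : atlas_space R) (E : vbundle M) (a : R)
    (z : tot E) : tot E := tot_pt (a *: projT2 z).

(* u = v +_{TM} w: the tangent map of the addition E x_M E -> E, where a
   tangent vector z of E x_M E is identified with the pair (v, w) of its
   images under the tangent maps of the two projections. *)
Definition tadd (R : realType) (M : atlas_space R) (E : vbundle M) (m : M)
    (e e' : fib E m) (v : tspace (tot_pt e)) (w : tspace (tot_pt e'))
    (u : tspace (tot_pt (e + e'))) : Prop :=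
  exists z : tspace (@tot_pt R M (whitney E E) m (e, e')),
    [/\ tmap (@fst_tot R M E) _ z = v, tmap (@snd_tot R M E) _ z = w
      & tmap (@add_tot R M E) _ z = u].
Arguments tadd {R M E m} e e' v w u.

Definition tscale (R : realType) (M : atlas_space R) (E : vbundle M) (m : M) (a : R)
    (e : fib E m) (v : tspace (tot_pt e)) : tspace (tot_pt (a *: e)) :=
  tmap (@scale_tot R M E a) (tot_pt e) v.
Arguments tscale {R M E m} a e v.

(* chi = theta + omega for the vector bundle structure T^*E -> E^*. *)
Definition cotadd (R : realType) (M : atlas_space R) (E : vbundle M) (m : M)
    (e e' : fib E m) (theta : 'Hom(tspace (tot_pt e), R^o))
    (omega : 'Hom(tspace (tot_pt e'), R^o))
    (chi : 'Hom(tspace (tot_pt (e + e')), R^o)) : Prop :=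
  r_map e theta = r_map e' omega /\
  forall v w u, tadd e e' v w u -> chi u = theta v + omega w.
Arguments cotadd {R M E m} e e' theta omega chi.

(* chi = a . theta for the vector bundle structure T^*E -> E^*.  The fibre of T^*E over a point of E^* is
   preserved by scalar multiplication; for a = 0 the second condition alone
   would not determine chi on vertical vectors. *)
Definition cotscale (R : realType) (M : atlas_space R) (E : vbundle M) (m : M)
    (a : R) (e : fib E m) (theta : 'Hom(tspace (tot_pt e), R^o))
    (chi : 'Hom(tspace (tot_pt (a *: e)), R^o)) : Prop :=
  r_map (a *: e) chi = r_map e theta /\ forall v, chi (tscale a e v) = a *: theta v.
Arguments cotscale {R M E m} a e theta chi.

(* Maps (TM (+) E^* ) x_M E -> TE (+) T^*E over the identity of E: the
   condition pi_E (Sigma (nu, e)) = e is built into the type. *)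
Definition presplitting (R : realType) (M : atlas_space R) (E : vbundle M) :
    Type :=
  forall (m : M) (nu : fib (anchorB E) m) (e : fib E m),
    fib (bigB E) (tot_pt e).

Record linear_splitting (R : realType) (M : atlas_space R) (E : vbundle M) :=
  LinearSplitting {
  splitting_map :> presplitting E;
  splitting_smooth :
    smooth_map (fun z : tot (whitney (anchorB E) E) =>
                  tot_pt (splitting_map (projT2 z).1 (projT2 z).2));
  splitting_Phi : forall m (nu : fib (anchorB E) m) (e : fib E m),
    Phi e (splitting_map nu e) = nu;
  splitting_linear_E : forall m (a : R) (nu nu' : fib (anchorB E) m)
      (e : fib E m),
    splitting_map (a *: nu + nu') e =
      a *: splitting_map nu e + splitting_map nu' e;
  splitting_addTM : forall m (nu : fib (anchorB E) m) (e e' : fib E m),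
    tadd e e' (splitting_map nu e).1 (splitting_map nu e').1
      (splitting_map nu (e + e')).1 /\
    cotadd e e' (splitting_map nu e).2 (splitting_map nu e').2
      (splitting_map nu (e + e')).2;
  splitting_scaleTM : forall m (a : R) (nu : fib (anchorB E) m) (e : fib E m),
    (splitting_map nu (a *: e)).1 = tscale a e (splitting_map nu e).1 /\
    cotscale a e (splitting_map nu e).2 (splitting_map nu (a *: e)).2
}.

Definition preconnection (R : realType) (M : atlas_space R) (E : vbundle M) :
    Type :=
  section (anchorB E) -> section (coreB E) -> section (coreB E).

(* Operations on sections are pointwise; below, a section nu' such that
   nu' m = f m *: nu m for all m is the section f nu, and so on. *)
Definition connection_bilinear (R : realType) (M : atlas_space R) (E : vbundle M)
    (Delta : preconnection E) : Prop :=
  (forall (a : R) (nu1 nu2 nu : section (anchorB E)) (tau : section (coreB E)),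
     (forall m, nu m = a *: nu1 m + nu2 m) ->
     forall m, Delta nu tau m = a *: Delta nu1 tau m + Delta nu2 tau m) /\
  (forall (a : R) (nu : section (anchorB E)) (tau1 tau2 tau : section (coreB E)),
     (forall m, tau m = a *: tau1 m + tau2 m) ->
     forall m, Delta nu tau m = a *: Delta nu tau1 m + Delta nu tau2 m).

Record dorfman (R : realType) (M : atlas_space R) (E : vbundle M) := Dorfman {
  dorfman_map :> preconnection E;
  dorfman_bilinear : connection_bilinear dorfman_map;
  dorfman_left : forall (f : M -> R) (nu nu' : section (anchorB E))
      (tau : section (coreB E)),
    smooth_fun f -> (forall m, nu' m = f m *: nu m) ->
    forall m, dorfman_map nu' tau m =
      f m *: dorfman_map nu tau m + pairing (nu m) (tau m) *: (0, ddiff f m);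
  dorfman_right : forall (f : M -> R) (nu : section (anchorB E))
      (tau tau' : section (coreB E)),
    smooth_fun f -> (forall m, tau' m = f m *: tau m) ->
    forall m, dorfman_map nu tau' m =
      f m *: dorfman_map nu tau m + (ddiff f m (nu m).1 : R) *: tau m;
  dorfman_exact : forall (f : M -> R) (nu : section (anchorB E))
      (tau : section (coreB E)),
    smooth_fun f -> (forall m, tau m = (0, ddiff f m)) ->
    forall m, dorfman_map nu tau m =
      (0, ddiff (fun p => ddiff f p (nu p).1) m)
}.

(* Sigma((X, eps)(m), e(m))
     = (T_m e X(m), d_{e(m)} ell_eps) - (Delta_{(X, eps)} (e, 0))^\uparrow(e(m)) *)
Definition splitting_formula (R : realType) (M : atlas_space R) (E : vbundle M)
    (Sigma : presplitting E) (Delta : preconnection E) : Prop :=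
  forall (nu : section (anchorB E)) (e : section E) (tau : section (coreB E)),
    (forall m, tau m = (e m, 0)) ->
    forall m, Sigma m (nu m) (e m) =
      (tmap (fun p => tot_pt (e p)) m (nu m).1,
       ddiff (ell (fun p => (nu p).2)) (tot_pt (e m)))
      - core_lift (Delta nu tau m) (e m).

Definition lie_formula (R : realType) (M : atlas_space R) (E : vbundle M)
    (Delta : preconnection E) : Prop :=
  forall (nu : section (anchorB E)) (theta : section (cotbundle M))
      (tau : section (coreB E)),
    (forall m, tau m = (0, theta m)) ->
    forall m, Delta nu tau m = (0, lie_form (fun p => (nu p).1) theta m).

(* Main.v *)
Require Import Defs.
From HB Require Import structures.
From mathcomp Require Import all_boot all_order all_algebra.
From mathcomp Require Import all_classical all_reals all_analysis.
From mathcomp Require Import ring.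

(** Fix a chart [c] of [M] and a trivialization [t] of [E]. Over a point [e] of
    [E], a tangent vector has a base part and a vertical part, a covector has a
    horizontal part and a fibre part. The projection [Phi] to [TM (+) E^*] reads
    off the base part and the fibre part, so an element [x] of [TE (+) T^*E] is
    determined by [Phi e x] and the two remaining vectors [vert x] and [horz x]
    ([big_ext]); a core lift [core_lift (u, theta) e] has projection 0, vertical
    part [u] and horizontal part [theta]. In these terms both linear structures
    of the double vector bundle become visible ([splitting_add_coord],
    [splitting_scale_coord]): a smooth section of [Phi] is a linear splitting exactly
    when [vert] and [horz] of its value are bilinear in [nu] and [e].

    For sections [nu = (X, eps)] and [e], the element [base nu e], that is
    [(Te X, d ell_eps)], projects to [nu] as well. Its vertical part is the
    derivative of the coordinates of [e] along [X], and its horizontal part is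
    the transposed derivative of the coordinates of [eps], applied to [e]
    ([vert_base], [horz_base]). Neither is tensorial: replacing [e] by [f e] adds
    [X(f) e] to the first, and replacing [eps] by [f eps] adds [eps(e) df] to the
    second. These are the defects that the Leibniz axioms prescribe for a Dorfman
    connection.

    From [Sigma] to [Delta]: [base nu e - Sigma nu e] has projection 0, hence is
    the core lift of a unique element, which is the value of the connection on
    [(e, 0)]; on a 1-form the connection is the Lie derivative. Bilinearity of
    [Sigma] leaves the defects of [base] and of the Lie derivative, which
    together are the Leibniz axioms ([delta_left], [delta_right]); the axiom on
    exact forms is [L_X df = d(X(f))] ([lie_form_exact]). Smoothness of the result
    is read off in one chart, which requires the coordinate formula for the Lie
    derivative to hold in all charts ([lie_form_coord]); this and the exactness
    formula both rest on the symmetry of second derivatives ([derive_comm]).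

    From [Delta] to [Sigma]: in [base nu e - core_lift (Delta nu (e, 0)) e] the
    defects cancel, so its components are linear over the smooth functions in
    [nu] and [e] ([rhs_left], [rhs_right]) and depend on the values at one point
    only ([tensorial], by cutoff functions, which use the Hausdorff property).
    As every element is the value of a global section, this defines [Sigma], and
    [Sigma] is smooth since near a point it is bilinear with coefficients its
    values on frames extended to global sections ([sigma_smooth]).

    The two constructions are inverse to each other because each side is
    determined by the other through the formulas: [Sigma] since global sections
    pass through all elements ([splitting_formula_unique]), [Delta] since
    [(e, theta)] is the sum of [(e, 0)] and [(0, theta)] ([connection_unique]).
    The latter needs that an arbitrary Dorfman connection [Delta] is the Lie
    derivative on 1-forms ([dorfman_lie_formula]). Indeed its difference with the
    connection induced by [Sigma] is tensorial in the second argument, vanishes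
    on exact forms, and every covector is the value of an exact form. *)

Set Implicit Arguments.
Unset Strict Implicit.
Unset Printing Implicit Defensive.

Import Order.TTheory GRing.Theory Num.Theory numFieldNormedType.Exports.
Local Open Scope classical_set_scope.
Local Open Scope ring_scope.

(** * Calculus on normed spaces *)

Section Calculus.
Context {R : realType}.
Implicit Types V W Z : normedModType R.

(** Differentiability is local: the remainder in the definition only involves
    values near [x]. *)
Lemma near_eq_differentiable V W (f g : V -> W) x :
  {near x, f =1 g} -> differentiable f x -> differentiable g x.
Proof.
move=> fg df; have [dc /eqaddoP de] := (diff_locallyP x f).1 df.
have gE : g \o shift x = cst (g x) + 'd f x +o_ 0 id.
  apply/eqaddoP => e e0; have {de} := de _ e0.
  have : \forall h \near 0, f (h + x) = g (h + x).
    by move: fg; rewrite (near_shift 0) subr0.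
  have fgx := nbhs_singleton fg.
  move=> fgh; apply: filterS2 fgh => h /= fgh.
  by rewrite /= !fctE /= -fgx fgh.
apply/diff_locallyP; rewrite (diff_unique dc gE); split => //.
Qed.

Lemma near_eq_diff V W (f g : V -> W) x v : differentiable f x ->
  {near x, f =1 g} -> 'd f x v = 'd g x v.
Proof.
move=> df fg; have dg := near_eq_differentiable fg df.
by rewrite -!deriveE//; exact: near_eq_derive.
Qed.

Lemma diff_linear V W (f : V -> W) x (a : R) u v :
  'd f x (a *: u + v) = a *: 'd f x u + 'd f x v.
Proof. exact: linearP. Qed.

Lemma diff_comp_apply V W Z (f : V -> W) (g : W -> Z) x v :
  differentiable f x -> differentiable g (f x) ->
  'd (g \o f) x v = 'd g (f x) ('d f x v).
Proof. by move=> df dg; rewrite diff_comp. Qed.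

Lemma diff_comp_at V W Z (f : V -> W) (g : W -> Z) x y v : f x = y ->
  differentiable f x -> differentiable g y ->
  'd (g \o f) x v = 'd g y ('d f x v).
Proof. by move=> <-; exact: diff_comp_apply. Qed.

(** Continuous linear maps are bundled with their continuity, as a proposition
    on plain functions, so that coordinate functions need no packing. *)
Definition clin V W (f : V -> W) := linear f /\ continuous f.

Lemma clin_diff V W (f : V -> W) x : clin f ->
  differentiable f x /\ forall v, 'd f x v = f v.
Proof.
move=> [fl fc].
pose fM := GRing.isLinear.Build _ _ _ _ f fl.
pose fL : {linear V -> W} := HB.pack f fM.
split; first exact: (@linear_differentiable _ _ _ fL x).
by move=> v; rewrite (@diff_lin _ _ _ fL x fc).
Qed.

(** Finite dimensionality, in the form of a basis with continuous coordinates: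
    it is what makes directional derivatives control the differential. *)
Definition fin_dim V := exists (k : nat) (b : 'I_k -> V) (c : 'I_k -> V -> R),
  (forall l, clin (c l)) /\ forall v, v = \sum_l c l v *: b l.

Lemma clin_coord n (l : 'I_n) : clin (fun v : 'rV[R]_n => v 0 l : R).
Proof.
split; first by move=> a u v; rewrite !mxE.
by move=> x; exact: coord_continuous.
Qed.

Lemma fin_dim_rV n : fin_dim ('rV[R]_n).
Proof.
exists n, (fun l => delta_mx 0 l), (fun l (v : 'rV[R]_n) => v 0 l); split.
  exact: clin_coord.
by move=> v; rewrite {1}(row_sum_delta v).
Qed.

Lemma fin_dim_R : fin_dim R.
Proof.
exists 1%N, (fun=> 1), (fun _ v => v); split.
  by move=> _; split=> //; exact: (fun x => @cvg_id _ _).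
by move=> v; rewrite big_ord1 [_ *: _]mulr1.
Qed.

Lemma continuous_sum (T : topologicalType) W k (F : 'I_k -> T -> W) :
  (forall l, continuous (F l)) -> continuous (fun x => \sum_l F l x).
Proof.
move=> Fc x; elim: (index_enum _) => [|l r IH].
  by under eq_fun do rewrite big_nil; exact: cvg_cst.
under eq_fun do rewrite big_cons.
by apply: cvgD => //; exact: Fc.
Qed.

Lemma clin_fin_dim V W (f : V -> W) : fin_dim V -> linear f -> clin f.
Proof.
move=> [k [b [c [cl ce]]]] fl; split => //.
pose fM := GRing.isLinear.Build _ _ _ _ f fl.
pose fL : {linear V -> W} := HB.pack f fM.
have fE v : f v = \sum_l c l v *: f (b l).
  rewrite {1}(ce v) -[f _]/(fL _) linear_sum; apply: eq_bigr => l _.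
  by rewrite linearZ.
have -> : f = (fun v => \sum_l c l v *: f (b l)) by apply/funext.
apply: continuous_sum => l x.
by apply: cvgZr_tmp; exact: (cl l).2.
Qed.

Lemma clin_rV n W (f : 'rV[R]_n -> W) : linear f -> clin f.
Proof. exact: clin_fin_dim (fin_dim_rV n). Qed.

Lemma scale_is_bilinear W :
  bilinear_for (GRing.Scale.Law.clone _ _ *:%R _) (GRing.Scale.Law.clone _ _ *:%R _)
    (@GRing.scale R W : R -> W -> W).
Proof.
split=> [u'|u] a x y /=; first by rewrite scalerDl scalerA.
by rewrite scalerDr !scalerA mulrC.
Qed.

Lemma diff_scale V W (f : V -> R) (g : V -> W) x v :
  differentiable f x -> differentiable g x ->
  differentiable (fun y => f y *: g y) x /\
  'd (fun y => f y *: g y) x v = 'd f x v *: g x + f x *: 'd g x v.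
Proof.
move=> df dg.
pose bM := bilinear_isBilinear.Build R R W W _ _ (@GRing.scale R W : R -> W -> W)
  (@scale_is_bilinear W).
pose b : {bilinear R -> W -> W} := HB.pack (@GRing.scale R W : R -> W -> W) bM.
have bc : continuous (fun p : R * W => b p.1 p.2) by exact: scale_continuous.
have dp := differentiable_pair df dg.
have db := @differentiable_bilin _ _ _ _ b (f x, g x) bc.
have E : (fun y => f y *: g y) = (fun p : R * W => b p.1 p.2) \o (fun y => (f y, g y)).
  by [].
rewrite E; split; first exact: differentiable_comp.
by rewrite diff_comp_apply// (diff_bilin _ bc) diff_pair//= addrC.
Qed.

Lemma diff_linl V W Z (f : V -> W) (g : W -> Z) x v : clin g ->
  differentiable f x ->
  differentiable (fun y => g (f y)) x /\ 'd (fun y => g (f y)) x v = g ('d f x v).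
Proof.
move=> gl df; have [dg gE] := clin_diff (f x) gl.
rewrite -[fun y => g (f y)]/(g \o f).
by split; [exact: differentiable_comp | rewrite diff_comp_apply// gE].
Qed.

(** ** Smoothness on open sets *)

Lemma Ck_onS V W k (U U' : set V) (f : V -> W) :
  U' `<=` U -> Ck_on k U f -> Ck_on k U' f.
Proof.
elim: k f => [|k IH] f sU /=; first by move=> cf x /sU /cf.
by move=> [df Df]; split=> [x /sU /df//|v]; exact: IH.
Qed.

Lemma Ck_on_local V W k (U : set V) (f : V -> W) :
  (forall x, U x -> exists U', U' x /\ Ck_on k U' f) -> Ck_on k U f.
Proof.
elim: k f => [|k IH] f /= Uf; first by move=> x /Uf [U' [U'x]]; apply.
split=> [x /Uf [U' [U'x [df _]]]|v]; first exact: df.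
by apply: IH => x /Uf [U' [U'x [_ Df]]]; exists U'.
Qed.

Lemma Ck_on_eq V W k (U : set V) (f g : V -> W) : open U ->
  (forall x, U x -> f x = g x) -> Ck_on k U f -> Ck_on k U g.
Proof.
move=> oU; elim: k f g => [|k IH] f g fg /=.
  move=> cf x Ux; have nfg : {near x, f =1 g}.
    by have := open_nbhs_nbhs (conj oU Ux); apply: filterS => y /fg.
  have := cf x Ux; rewrite /prop_for /continuous_at (fg x Ux).
  by apply: cvg_trans; apply: near_eq_cvg.
move=> [df Df].
have nfg x : U x -> {near x, f =1 g}.
  by move=> Ux; have := open_nbhs_nbhs (conj oU Ux); apply: filterS => y /fg.
split=> [x Ux|v]; first exact: near_eq_differentiable (nfg x Ux) (df x Ux).
apply: IH (Df v) => x Ux; exact: near_eq_derive (nfg x Ux).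
Qed.

Lemma Ck_onP V W k (U : set V) (f : V -> W) : Ck_on k.+1 U f -> Ck_on k U f.
Proof.
elim: k f => [|k IH] f /= [df Df].
  by move=> x /df; exact: differentiable_continuous.
by split=> // v; apply: IH.
Qed.

Lemma Ck_on_cst V W k (U : set V) (w : W) : Ck_on k U (fun=> w).
Proof.
elim: k w => [|k IH] w /=; first by move=> x _; exact: cvg_cst.
split=> [x _|v]; first exact: differentiable_cst.
by have -> : (fun x : V => 'D_v (fun=> w) x) = (fun=> 0);
  [apply/funext => x; exact: derive_cst | exact: IH].
Qed.

Lemma Ck_on_clin V W Z k (U : set V) (f : V -> W) (g : W -> Z) : open U ->
  clin g -> Ck_on k U f -> Ck_on k U (fun x => g (f x)).
Proof.
move=> oU gl; elim: k f => [|k IH] f /=.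
  by move=> cf x Ux; apply: continuous_comp; [exact: cf | exact: gl.2].
move=> [df Df]; split=> [x Ux|v]; first by have [] := diff_linl 0 gl (df x Ux).
apply: (Ck_on_eq oU _ (IH _ (Df v))) => x Ux.
have [dgf E] := diff_linl v gl (df x Ux).
by rewrite (deriveE v dgf) E (deriveE v (df x Ux)).
Qed.

Lemma Ck_on_id V k (U : set V) : Ck_on k U id.
Proof.
case: k => [|k] /=; first by move=> x _; exact: cvg_id.
split=> [x _|v]; first exact: ex_diff.
by have -> : (fun x : V => 'D_v id x) = (fun=> v);
  [apply/funext => x; exact: derive_id | exact: Ck_on_cst].
Qed.

Lemma Ck_onD V W k (U : set V) (f g : V -> W) : open U ->
  Ck_on k U f -> Ck_on k U g -> Ck_on k U (fun x => f x + g x).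
Proof.
move=> oU; elim: k f g => [|k IH] f g /=.
  by move=> cf cg x Ux; apply: cvgD; [exact: cf | exact: cg].
move=> [df Df] [dg Dg]; split=> [x Ux|v].
  by apply: differentiableD; [exact: df | exact: dg].
apply: (Ck_on_eq oU _ (IH _ _ (Df v) (Dg v))) => x Ux.
by rewrite -[fun y => f y + g y]/(f + g) deriveD//; apply: diff_derivable;
  [exact: df | exact: dg].
Qed.

Lemma Ck_on_scale V W k (U : set V) (f : V -> R) (g : V -> W) : open U ->
  Ck_on k U f -> Ck_on k U g -> Ck_on k U (fun x => f x *: g x).
Proof.
move=> oU; elim: k f g => [|k IH] f g.
  by move=> cf cg x Ux; apply: cvgZ; [exact: cf | exact: cg].
move=> Cf Cg; have [df Df] := Cf; have [dg Dg] := Cg; split=> [x Ux|v].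
  by have [] := diff_scale 0 (df x Ux) (dg x Ux).
have C := Ck_onD oU (IH _ _ (Df v) (Ck_onP Cg)) (IH _ _ (Ck_onP Cf) (Dg v)).
apply: (Ck_on_eq oU _ C) => x Ux.
have [dfg E] := diff_scale v (df x Ux) (dg x Ux).
by rewrite (deriveE v dfg) E (deriveE v (df x Ux)) (deriveE v (dg x Ux)).
Qed.

Lemma Ck_on_sum V W k (U : set V) n (F : 'I_n -> V -> W) : open U ->
  (forall l, Ck_on k U (F l)) -> Ck_on k U (fun x => \sum_l F l x).
Proof.
move=> oU CF; elim: (index_enum _) => [|l r IH].
  by under eq_fun do rewrite big_nil; exact: Ck_on_cst.
under eq_fun do rewrite big_cons.
exact: Ck_onD.
Qed.

Lemma diff_fin_dim V W (f : V -> W) k (b : 'I_k -> V) (c : 'I_k -> V -> R) x v :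
  (forall v, v = \sum_l c l v *: b l) -> 'd f x v = \sum_l c l v *: 'd f x (b l).
Proof.
move=> ce; rewrite {1}(ce v) linear_sum; apply: eq_bigr => l _.
by rewrite linearZ.
Qed.

(** The derivative of a composite in a fixed direction is the differential of [g]
    in a moving direction; in a basis it is a sum of products of functions to
    which the induction applies. *)
Lemma Ck_on_comp V W Z k (U : set V) (U' : set W) (f : V -> W) (g : W -> Z) :
  fin_dim W -> open U -> open U' -> (forall x, U x -> U' (f x)) ->
  Ck_on k U f -> Ck_on k U' g -> Ck_on k U (g \o f).
Proof.
move=> [n [b [c [cl ce]]]] oU oU' fU; elim: k f fU g => [|k IH] f fU g.
  move=> cf cg x Ux; apply: continuous_comp; first exact: cf.
  by apply: cg; exact: fU.
move=> Cf Cg; have [df Df] := Cf; have [dg Dg] := Cg; split=> [x Ux|v].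
  by apply: differentiable_comp; [exact: df | exact/dg/fU].
have C : Ck_on k U (fun x => \sum_l c l ('D_v f x) *: 'D_(b l) g (f x)).
  apply: Ck_on_sum => // l; apply: Ck_on_scale => //.
    exact: (Ck_on_clin oU (cl l) (Df v)).
  exact: (IH f fU _ (Ck_onP Cf) (Dg (b l))).
apply: (Ck_on_eq oU _ C) => x Ux.
have dfx := df x Ux; have dgx := dg _ (fU _ Ux).
rewrite (deriveE v (differentiable_comp dfx dgx)) (deriveE v dfx).
rewrite (diff_comp_apply v dfx dgx) (diff_fin_dim _ _ _ ce); apply: eq_bigr => l _.
by rewrite deriveE.
Qed.

Lemma smooth_onS V W (U U' : set V) (f : V -> W) :
  U' `<=` U -> smooth_on U f -> smooth_on U' f.
Proof. by move=> sU sf k; exact: Ck_onS sU (sf k). Qed.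

Lemma smooth_on_local V W (U : set V) (f : V -> W) :
  (forall x, U x -> exists U', U' x /\ smooth_on U' f) -> smooth_on U f.
Proof.
move=> H k; apply: Ck_on_local => x /H [U' [U'x sf]].
by exists U'; split => //; exact: sf.
Qed.

Lemma smooth_on_eq V W (U : set V) (f g : V -> W) : open U ->
  (forall x, U x -> f x = g x) -> smooth_on U f -> smooth_on U g.
Proof. by move=> oU fg sf k; exact: Ck_on_eq oU fg (sf k). Qed.

Lemma smooth_on_cst V W (U : set V) (w : W) : smooth_on U (fun=> w).
Proof. by move=> k; exact: Ck_on_cst. Qed.

Lemma smooth_on_id V (U : set V) : smooth_on U id.
Proof. by move=> k; exact: Ck_on_id. Qed.

Lemma smooth_on_clin V W Z (U : set V) (f : V -> W) (g : W -> Z) : open U ->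
  clin g -> smooth_on U f -> smooth_on U (fun x => g (f x)).
Proof. by move=> oU gl sf k; exact: Ck_on_clin. Qed.

Lemma smooth_onD V W (U : set V) (f g : V -> W) : open U ->
  smooth_on U f -> smooth_on U g -> smooth_on U (fun x => f x + g x).
Proof. by move=> oU sf sg k; exact: Ck_onD. Qed.

Lemma smooth_on_scale V W (U : set V) (f : V -> R) (g : V -> W) : open U ->
  smooth_on U f -> smooth_on U g -> smooth_on U (fun x => f x *: g x).
Proof. by move=> oU sf sg k; exact: Ck_on_scale. Qed.

Lemma smooth_on_sum V W (U : set V) n (F : 'I_n -> V -> W) : open U ->
  (forall l, smooth_on U (F l)) -> smooth_on U (fun x => \sum_l F l x).
Proof. by move=> oU sF k; apply: Ck_on_sum => // l; exact: sF. Qed.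

Lemma smooth_on_comp V W Z (U : set V) (U' : set W) (f : V -> W) (g : W -> Z) :
  fin_dim W -> open U -> open U' -> (forall x, U x -> U' (f x)) ->
  smooth_on U f -> smooth_on U' g -> smooth_on U (g \o f).
Proof. by move=> W0 oU oU' fU sf sg k; exact: (Ck_on_comp W0 oU oU' fU). Qed.

Lemma smooth_on_differentiable V W (U : set V) (f : V -> W) x :
  smooth_on U f -> U x -> differentiable f x.
Proof. by move=> sf Ux; have [df _] := sf 1%N; exact: df. Qed.

Lemma smooth_on_continuous V W (U : set V) (f : V -> W) x :
  smooth_on U f -> U x -> {for x, continuous f}.
Proof. by move=> sf Ux; exact: (sf 0%N). Qed.

Lemma smooth_on_derive V W (U : set V) (f : V -> W) v :
  smooth_on U f -> smooth_on U ('D_v f).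
Proof. by move=> sf k; have [_ Df] := sf k.+1; exact: Df. Qed.

(** Smoothness only mentions derivatives in constant directions; a moving
    direction is expanded in a basis. *)
Lemma smooth_on_diff V W (U : set V) (f : V -> W) (g : V -> V) :
  fin_dim V -> open U -> smooth_on U f -> smooth_on U g ->
  smooth_on U (fun x => 'd f x (g x)).
Proof.
move=> [n [b [c [cl ce]]]] oU sf sg.
have C : smooth_on U (fun x => \sum_l c l (g x) *: 'D_(b l) f x).
  apply: smooth_on_sum => // l; apply: smooth_on_scale => //.
    exact: smooth_on_clin.
  exact: smooth_on_derive.
apply: (smooth_on_eq oU _ C) => x Ux.
rewrite /= (diff_fin_dim _ _ _ ce); apply: eq_bigr => l _.
by rewrite (deriveE _ (smooth_on_differentiable sf Ux)).
Qed.

(** ** Row vectors by blocks *)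

Lemma clin_lsubmx m n : clin (fun y : 'rV[R]_(m + n) => lsubmx y).
Proof. by apply: clin_rV => a u v; exact: linearP. Qed.

Lemma clin_rsubmx m n : clin (fun y : 'rV[R]_(m + n) => rsubmx y).
Proof. by apply: clin_rV => a u v; exact: linearP. Qed.

Lemma clin_row_mxl m n : clin (fun u : 'rV[R]_m => row_mx u (0 : 'rV[R]_n)).
Proof.
by apply: clin_rV => a u v; rewrite scale_row_mx add_row_mx scaler0 addr0.
Qed.

Lemma clin_row_mxr m n : clin (fun u : 'rV[R]_n => row_mx (0 : 'rV[R]_m) u).
Proof.
by apply: clin_rV => a u v; rewrite scale_row_mx add_row_mx scaler0 addr0.
Qed.

Lemma row_mx_split m n (u : 'rV[R]_m) (v : 'rV[R]_n) :
  row_mx u v = row_mx u 0 + row_mx 0 v.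
Proof. by rewrite add_row_mx addr0 add0r. Qed.

End Calculus.

(** ** Symmetry of second derivatives *)

Section Schwarz.
Context {R : realType} {V : normedModType R}.

Lemma derive_line (g : V -> R) (x v : V) (s : R) : differentiable g (x + s *: v) ->
  is_derive s 1 (fun t : R => g (x + t *: v) : R) ('D_v g (x + s *: v)).
Proof.
move=> dg.
pose l := fun t : R => x + t *: v.
have dl : differentiable l s.
  by apply: differentiableD; [exact: differentiable_cst | exact: ex_diff].
have dgl : differentiable (g \o l) s by exact: differentiable_comp.
have E : 'd l s 1 = v.
  have -> : l = cst x + ( *:%R^~ v) by [].
  have d2 : differentiable ( *:%R^~ v : R -> V) s by exact: ex_diff.
  rewrite (diffD (differentiable_cst x s) d2) /= diff_cst add0r.
  by rewrite diff_val scale1r.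
apply: DeriveDef; first exact: diff_derivable.
by rewrite (deriveE (1 : R) dgl) (diff_comp_apply (1 : R) dl dg) E (deriveE v dg).
Qed.

Lemma mvt_line (g : V -> R) (x v : V) (h : R) : 0 < h ->
  (forall s, 0 <= s <= h -> differentiable g (x + s *: v)) ->
  exists2 s, 0 <= s <= h & g (x + h *: v) - g x = h * 'D_v g (x + s *: v).
Proof.
move=> h0 dg.
have [||s] := @MVT R (fun t => g (x + t *: v)) (fun s => 'D_v g (x + s *: v)) 0 h h0.
- move=> s; rewrite in_itv /= => /andP[s0 sh].
  by apply: derive_line; apply: dg; rewrite !ltW.
- apply: derivable_within_continuous => s; rewrite in_itv /= => sh.
  by have [] := derive_line (dg _ sh).
rewrite in_itv /= => /andP[s0 sh] E; exists s; first by rewrite !ltW.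
by move: E; rewrite scale0r addr0 subr0 mulrC.
Qed.

(** The mean value theorem, applied to [f (y + h w) - f y] along [v] and then to
    ['D_v f] along [w]. *)
Lemma second_difference (f : V -> R) (U : set V) (x v w : V) (h : R) :
  smooth_on U f -> 0 < h ->
  (forall s t : R, 0 <= s <= h -> 0 <= t <= h -> U (x + s *: v + t *: w)) ->
  exists s t : R, [/\ 0 <= s <= h, 0 <= t <= h &
    f (x + h *: v + h *: w) - f (x + h *: v) - (f (x + h *: w) - f x) =
      h * (h * 'D_w ('D_v f) (x + s *: v + t *: w))].
Proof.
move=> sf h0 hU.
have hh : 0 <= h <= h by rewrite lexx ltW.
have h00 : 0 <= (0 : R) <= h by rewrite lexx ltW.
pose phi y := f (y + h *: w) - f y.
have dshift y : differentiable (fun z : V => z + h *: w) y.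
  by apply: differentiableD; [exact: ex_diff | exact: differentiable_cst].
have d1 s : 0 <= s <= h -> differentiable f (x + s *: v).
  move=> hs; apply: smooth_on_differentiable sf _.
  by have := hU s 0 hs h00; rewrite scale0r addr0.
have d2 s : 0 <= s <= h -> differentiable f (x + s *: v + h *: w).
  by move=> hs; apply: smooth_on_differentiable sf _; exact: hU.
have d3 s : 0 <= s <= h -> differentiable (fun y => f (y + h *: w)) (x + s *: v).
  by move=> hs; apply: (@differentiable_comp _ _ _ _ (fun y => y + h *: w) f);
    [exact: dshift | exact: d2].
have [s hs E1] := @mvt_line phi x v h h0
  (fun s hs => differentiableB (d3 s hs) (d1 s hs)).
have Ephi : 'D_v phi (x + s *: v) = 'D_v f (x + s *: v + h *: w) - 'D_v f (x + s *: v).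
  rewrite /phi (deriveB (diff_derivable (d3 s hs)) (diff_derivable (d1 s hs))).
  congr (_ - _); rewrite (deriveE v (d3 s hs)) (deriveE v (d2 s hs)).
  rewrite -[fun y => f (y + h *: w)]/(f \o (fun y => y + h *: w)).
  rewrite (diff_comp_apply v (dshift _) (d2 s hs)); congr ('d _ _ _).
  have idd : differentiable (fun z : V => z) (x + s *: v) by exact: ex_diff.
  have -> : (fun y => y + h *: w) = id + cst (h *: w) by [].
  by rewrite (diffD idd (differentiable_cst _ _)) /= diff_cst addr0 diff_val.
have [t ht E2] := @mvt_line ('D_v f) (x + s *: v) w h h0
  (fun t ht => smooth_on_differentiable (smooth_on_derive v sf) (hU s t hs ht)).
exists s, t; split=> //.
by rewrite -E2 -Ephi -E1 /phi.
Qed.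

Lemma box_in_nbhs (x v w : V) (N : set V) : nbhs x N ->
  exists2 h : R, 0 < h & forall s t, 0 <= s <= h -> 0 <= t <= h ->
    N (x + s *: v + t *: w).
Proof.
move=> /nbhs_ballP [e /= e0 eN].
have k0 : 0 < `|v| + `|w| + 1 by rewrite ltr_wpDl.
exists (e / (`|v| + `|w| + 1)); first by rewrite divr_gt0.
move=> s t /andP[s0 sh] /andP[t0 th]; apply: eN.
rewrite -ball_normE /= -addrA opprD addrA subrr sub0r normrN.
apply: le_lt_trans (ler_normD _ _) _; rewrite !normrZ !ger0_norm//.
apply: (@le_lt_trans _ _ (e / (`|v| + `|w| + 1) * (`|v| + `|w|))).
  by rewrite mulrDr lerD// ler_wpM2r.
by rewrite -mulrA gtr_pMr// mulrC ltr_pdivrMr// mul1r ltrDl.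
Qed.

(** The form in which intermediate points of unknown position, such as those of
    the mean value theorem, are removed by continuity. *)
Lemma eq_of_close_values (a b : V -> R) (x : V) :
  {for x, continuous a} -> {for x, continuous b} ->
  (forall N, nbhs x N -> exists p q, [/\ N p, N q & a p = b q]) -> a x = b x.
Proof.
move=> ca cb H; apply/eqP; rewrite -subr_eq0 -normr_eq0; apply/negP => /negP ne.
pose e := `|a x - b x| / 2.
have e0 : 0 < e by rewrite divr_gt0// lt_neqAle eq_sym ne /=.
have na : \forall y \near x, `|a x - a y| < e by move/cvgrPdist_lt : ca; apply.
have nb : \forall y \near x, `|b x - b y| < e by move/cvgrPdist_lt : cb; apply.
have [p [q [[pa _] [_ qb] E]]] := H _ (filterI na nb).
have : `|a x - b x| < e + e.
  rewrite -(subrKA (b q)) -{1}E.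
  by apply: le_lt_trans (ler_normD _ _) _; rewrite [X in _ + X]distrC ltrD.
by rewrite /e -splitr ltxx.
Qed.

(** Both iterated derivatives are values, at points as close to [x] as desired,
    of the same symmetric second difference quotient. *)
Lemma derive_comm (f : V -> R) (U : set V) (x v w : V) : open U ->
  smooth_on U f -> U x -> 'D_w ('D_v f) x = 'D_v ('D_w f) x.
Proof.
move=> oU sf Ux.
apply: (@eq_of_close_values ('D_w ('D_v f)) ('D_v ('D_w f))).
- exact: smooth_on_continuous (smooth_on_derive w (smooth_on_derive v sf)) Ux.
- exact: smooth_on_continuous (smooth_on_derive v (smooth_on_derive w sf)) Ux.
move=> N nN; have nU : nbhs x U by exact: open_nbhs_nbhs.
have [h h0 hN] := box_in_nbhs v w (filterI nU nN).
have [s [t [hs ht E1]]] := second_difference sf h0 (fun s t hs ht => (hN s t hs ht).1).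
have hU' s' t' : 0 <= s' <= h -> 0 <= t' <= h -> U (x + s' *: w + t' *: v).
  by move=> hs' ht'; rewrite addrAC; exact: (hN t' s' ht' hs').1.
have [s' [t' [hs' ht' E2]]] := second_difference sf h0 hU'.
exists (x + s *: v + t *: w), (x + s' *: w + t' *: v); split.
- exact: (hN s t hs ht).2.
- by rewrite addrAC; exact: (hN t' s' ht' hs').2.
apply: (mulfI (lt0r_neq0 h0)); apply: (mulfI (lt0r_neq0 h0)).
apply: etrans (esym E1) (etrans _ E2).
rewrite [x + h *: w + _]addrAC; move: (f _) (f _) (f _) (f _) => p q r z; ring.
Qed.

End Schwarz.

(** ** Bump functions *)

Section Bump.
Context {R : realType}.

(** The family of [t ^- n * exp (- 1 / t)] is closed under differentiation up to
    linear combinations, so all its members are smooth by one induction. *)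
Definition flat (n : nat) (t : R) : R :=
  if 0 < t then t^-1 ^+ n * expR (- t^-1) else 0.

Lemma flat_ge0 n t : 0 <= flat n t.
Proof.
rewrite /flat; case: ltP => // t0.
by rewrite mulr_ge0// ?expR_ge0// exprn_ge0// invr_ge0 ltW.
Qed.

(** The quadratic bound gives the derivative 0 at 0, by comparing the
    exponential with one term of its series. *)
Lemma flat_le n t : flat n t <= (n.+2)`!%:R * t ^+ 2.
Proof.
rewrite /flat; case: ltP => t0; last by rewrite mulr_ge0// sqr_ge0.
rewrite expRN -ler_pdivlMr ?invr_gt0 ?expR_gt0// invrK.
have ti0 : 0 <= t^-1 by rewrite invr_ge0 ltW.
have H : t^-1 ^+ n.+2 <= (n.+2)`!%:R * expR t^-1.
  rewrite -ler_pdivrMl ?ltr0n ?fact_gt0// mulrC.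
  by apply: le_trans (expR_ge1Dxn n.+1 ti0); rewrite lerDr.
have -> : t^-1 ^+ n = t^-1 ^+ n.+2 * t ^+ 2.
  by rewrite -addn2 exprD -mulrA -exprMn mulVf ?gt_eqF// expr1n mulr1.
by rewrite [leRHS]mulrAC ler_wpM2r// sqr_ge0.
Qed.

Lemma is_derive_flat (n : nat) (t : R) :
  is_derive t (1 : R) (flat n) (flat n.+2 t - n%:R * flat n.+1 t).
Proof.
have [t0|t0|->] := ltrgtP t 0.
- have -> : flat n.+2 t - n%:R * flat n.+1 t = 0.
    by rewrite /flat !ltNge (ltW t0) /= mulr0 subr0.
  apply: (@near_eq_is_derive _ _ _ (cst 0)).
  have : \forall s \near t, s < 0 by exact: lt_nbhsl.
  by apply: filterS => s s0; rewrite /flat ltNge ltW.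
- have tn : t != 0 by rewrite gt_eqF.
  have Di : is_derive t (1 : R) (fun s : R => s^-1) (- t ^- 2).
    apply: is_derive_eq (@is_deriveV R id t 1 1 tn (is_derive_id t (1 : R))) _.
    by rewrite [_ *: _]mulr1.
  have De : is_derive t (1 : R) (fun s => expR (- s^-1)) (expR (- t^-1) * t ^- 2).
    have := @is_derive1_comp R expR (fun s => - s^-1) t _ _ _ (is_deriveN Di).
    by rewrite opprK; apply.
  have D := is_deriveM (is_deriveX n Di) De.
  apply: (@near_eq_is_derive _ _ _ ((fun s : R => s^-1) ^+ n * (fun s => expR (- s^-1)))).
    have : \forall s \near t, 0 < s by exact: lt_nbhsr.
    apply: filterS => s s0; rewrite /flat s0 /= !fctE; congr (_ * _).
  apply: is_derive_eq D _.
  rewrite /flat t0 !fctE /= /GRing.scale /= exprVn.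
  case: n => [|n] /=; first by rewrite !mul0r; field.
  by rewrite !exprVn !exprS expr0 -!natr1; field; rewrite tn expf_neq0.
- have -> : flat n.+2 0 - n%:R * flat n.+1 0 = 0 by rewrite /flat ltxx mulr0 subr0.
  have f0 : flat n 0 = 0 by rewrite /flat ltxx.
  have H : (fun h : R => h^-1 *: ((flat n \o shift 0) (h *: 1) - flat n 0)) @ 0^' --> (0 : R).
    apply/cvgrPdist_le => e e0 /=; near=> h.
    have hn0 : h != 0 by near: h; exact: nbhs_dnbhs_neq.
    rewrite f0 sub0r normrN subr0 /= addr0 [h *: 1]mulr1 normrZ normfV.
    rewrite ler_pdivrMl ?normr_gt0// (ger0_norm (flat_ge0 _ _)).
    apply: le_trans (flat_le _ _) _.
    rewrite -real_normK ?num_real// expr2 mulrCA ler_wpM2l//.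
    rewrite -ler_pdivlMl ?ltr0n ?fact_gt0//.
    by near: h; apply: dnbhs0_le; rewrite mulr_gt0// invr_gt0 ltr0n fact_gt0.
  by apply: DeriveDef; [apply/cvg_ex; exists 0 | exact/cvg_lim].
Unshelve. all: by end_near. Qed.

Lemma smooth_flat n : smooth_on setT (flat n).
Proof.
move=> k; elim: k n => [|k IH] n /=.
  move=> t _; apply: differentiable_continuous; apply/derivable1_diffP.
  by have [] := is_derive_flat n t.
have df t : differentiable (flat n) t.
  by apply/derivable1_diffP; have [] := is_derive_flat n t.
split=> [t _ //|v].
apply: (@Ck_on_eq _ _ _ _ _ (fun t => v *: (flat n.+2 t + (- n%:R) *: flat n.+1 t))).
- exact: openT.
- move=> t _ /=; rewrite (deriveE _ (df t)) -[v in RHS]mulr1 -[v * 1]/(v *: 1) linearZ.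
  rewrite -(deriveE _ (df t)); have [_ ->] := is_derive_flat n t.
  by rewrite [- _ *: _]mulNr.
apply: Ck_on_scale; [exact: openT | exact: Ck_on_cst|].
apply: Ck_onD; [exact: openT | exact: IH|].
by apply: Ck_on_scale; [exact: openT | exact: Ck_on_cst | exact: IH].
Qed.

Lemma flat_incr (s t : R) : s <= t -> flat 0 s <= flat 0 t.
Proof.
rewrite /flat !expr0 !mul1r; case: (ltP 0 s) => s0 st.
  by rewrite (lt_le_trans s0 st) ler_expR lerN2 lef_pV2// posrE ?(lt_le_trans s0 st).
by case: ltP => // _; exact: expR_ge0.
Qed.

(** A step from 1 to 0: applying [flat 0] to [flat 0 1 - flat 0 t] makes the
    value constant for nonpositive [t] and zero as soon as [t >= 1]. *)
Lemma smooth_step : exists h : R -> R, [/\ smooth_on setT h,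
  forall t, t <= 0 -> h t = 1 & forall t, 1 <= t -> h t = 0].
Proof.
have f10 : 0 < flat 0 1 by rewrite /flat ltr01 expr0 mul1r expR_gt0.
have ff10 : 0 < flat 0 (flat 0 1).
  by rewrite {1}/flat f10 expr0 mul1r expR_gt0.
exists (fun t => (flat 0 (flat 0 1))^-1 *: flat 0 (flat 0 1 + (-1) *: flat 0 t)); split.
- apply: smooth_on_scale; [exact: openT | exact: smooth_on_cst|].
  apply: (@smooth_on_comp _ _ _ _ _ setT (fun t => flat 0 1 + (-1) *: flat 0 t) (flat 0)) => //.
  + exact: fin_dim_R.
  + exact: openT.
  + exact: openT.
  + apply: smooth_onD; [exact: openT | exact: smooth_on_cst|].
    apply: smooth_on_scale; [exact: openT | exact: smooth_on_cst|].
    exact: smooth_flat.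
  + exact: smooth_flat.
- move=> t t0; have -> : flat 0 t = 0 by rewrite /flat ltNge t0.
  by rewrite scaler0 addr0 [_ *: _]mulVf// gt_eqF.
- move=> t t1; rewrite scaleN1r.
  have -> : flat 0 (flat 0 1 - flat 0 t) = 0.
    by rewrite {1}/flat ltNge subr_le0 flat_incr.
  by rewrite scaler0.
Qed.

(** The step is applied to the squared distance, rescaled to be negative at [a]
    and at least 1 outside the ball; the Euclidean square [q] is used because it is
    a polynomial, and it dominates the square of the sup norm. *)
Lemma bump_rV n (a : 'rV[R]_n) (r : R) : 0 < r ->
  exists chi : 'rV[R]_n -> R, [/\ smooth_on setT chi,
    \forall x \near a, chi x = 1 & forall x, r <= `|x - a| -> chi x = 0].
Proof.
move=> r0; have [h [hs h1 h0]] := smooth_step.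
pose q (x : 'rV[R]_n) : R := \sum_(i < n) (x 0 i - a 0 i) *: (x 0 i - a 0 i).
pose p x : R := 2 / r ^+ 2 *: q x + (-1).
have oT := @openT ('rV[R]_n).
have ps : smooth_on setT p.
  apply: smooth_onD => //; last exact: smooth_on_cst.
  apply: smooth_on_scale => //; first exact: smooth_on_cst.
  have si i : smooth_on setT (fun x : 'rV[R]_n => x 0 i - a 0 i).
    apply: smooth_onD => //; last exact: smooth_on_cst.
    exact: (smooth_on_clin oT (clin_coord i) (smooth_on_id _)).
  by apply: smooth_on_sum => // i; apply: smooth_on_scale.
exists (h \o p); split.
- apply: smooth_on_comp ps hs => //; [exact: fin_dim_R | exact: openT].
- have pa : p a = -1.
    rewrite /p /q big1 ?scaler0 ?add0r// => i _.
    by rewrite subrr scaler0.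
  have : \forall x \near a, p x < 0.
    have cp : {for a, continuous p} by exact: smooth_on_continuous ps _.
    have nb : nbhs (p a) [set y : R | y < 0] by apply: lt_nbhsl; rewrite pa ltrN10.
    exact: (cp _ nb).
  by apply: filterS => x px; apply: h1; exact: ltW.
- move=> x rx; apply: h0; rewrite /p lerBrDr -[1 + 1]/(2 : R).
  suff rq : r ^+ 2 <= q x.
    rewrite -[_ *: _]mulrA ler_peMr//.
    by rewrite ler_pdivlMl ?exprn_gt0// mulr1.
  rewrite leNgt; apply/negP => qr; move: rx; rewrite leNgt => /negP; apply.
  rewrite /Num.Def.normr /= mx_normrE; apply: bigmax_lt => //= -[i j] _ /=.
  rewrite ord1 !mxE -(@ltr_pXn2r _ 2 isT) ?nnegrE ?normr_ge0 ?(ltW r0)//.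
  rewrite real_normK ?num_real//; apply: le_lt_trans _ qr.
  rewrite /q (bigD1 j)//= expr2 lerDl; apply: sumr_ge0 => k _.
  by rewrite -[_ *: _]expr2 sqr_ge0.
Qed.

End Bump.

(** * Smooth maps between spaces with charts *)

Section Atlas.
Context {R : realType}.
Implicit Types X Y : atlas_space R.
Implicit Types V W : normedModType R.

(** The axioms of [is_manifold] that only involve charts. They pass from a
    manifold to the total space of a bundle by computations in charts. *)
Record is_atlas X : Prop := IsAtlas {
  atlas_at : forall p : X, cdom (chart_at p) p;
  atlasK : forall (i : cidx X) (p : X), cdom i p -> chart_inv i (chart i p) = p;
  atlas_open : forall i j : cidx X, open (chart i @` (cdom i `&` cdom j));
  atlas_trans : forall i j : cidx X,
    smooth_on (chart i @` (cdom i `&` cdom j)) (chart j \o chart_inv i)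
}.

Arguments atlas_at {X} _ p.
Arguments atlas_open {X} _ i j.
Arguments atlas_trans {X} _ i j.

Lemma manifold_atlas X : is_manifold X -> is_atlas X.
Proof. by case=> *; split. Qed.

Section OneSpace.
Context {X : atlas_space R} (hX : is_atlas X).
Implicit Types N : set X.

Lemma is_openT : is_open (@setT X).
Proof.
by move=> i; have := atlas_open hX i i; rewrite setIid setIT.
Qed.

Lemma is_open_cdom (c : cidx X) : is_open (cdom c).
Proof. by move=> i; exact: atlas_open. Qed.

Lemma is_openI N N' : is_open N -> is_open N' -> is_open (N `&` N').
Proof.
move=> oN oN' c.
have -> : chart c @` (cdom c `&` (N `&` N')) =
    chart c @` (cdom c `&` N) `&` chart c @` (cdom c `&` N').
  apply/seteqP; split=> [_ [p [cp [Np N'p]] <-]|_ [[p [cp Np] <-] [q [cq N'q] E]]].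
    by split; exists p.
  exists p => //; split=> //; split=> //.
  by rewrite -(atlasK hX cp) -E (atlasK hX cq).
exact: openI.
Qed.

Lemma is_openP N :
  (forall p, N p -> exists N', [/\ is_open N', N' p & N' `<=` N]) -> is_open N.
Proof.
move=> H c; rewrite openE => _ [p [cp Np] <-].
have [N' [oN' N'p sN]] := H p Np.
have : nbhs (chart c p) (chart c @` (cdom c `&` N')).
  by apply: open_nbhs_nbhs; split; [exact: oN' | exists p].
apply: filterS => _ [q [cq N'q] <-]; exists q => //; split=> //; exact: sN.
Qed.

Definition smoothM V N (f : X -> V) :=
  forall c : cidx X, smooth_on (chart c @` (cdom c `&` N)) (f \o chart_inv c).

Lemma smoothM_S V N N' (f : X -> V) : N' `<=` N -> smoothM N f -> smoothM N' f.
Proof.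
move=> sN sf c; apply: smooth_onS (sf c) => _ [p [cp N'p] <-].
by exists p => //; split=> //; exact: sN.
Qed.

Lemma smoothM_local V N (f : X -> V) :
  (forall p, N p -> exists N', N' p /\ smoothM N' f) -> smoothM N f.
Proof.
move=> H c; apply: smooth_on_local => _ [p [cp Np] <-].
have [N' [N'p sf]] := H p Np; exists (chart c @` (cdom c `&` N')).
by split; [exists p | exact: sf].
Qed.

Lemma smoothM_eq V N (f g : X -> V) : is_open N ->
  (forall p, N p -> f p = g p) -> smoothM N f -> smoothM N g.
Proof.
move=> oN fg sf c; apply: (smooth_on_eq (oN c) _ (sf c)) => _ [p [cp Np] <-] /=.
by rewrite (atlasK hX cp) fg.
Qed.

Lemma smoothM_comp V W N (f : X -> V) (U : set V) (g : V -> W) : fin_dim V ->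
  is_open N -> open U -> (forall p, N p -> U (f p)) ->
  smoothM N f -> smooth_on U g -> smoothM N (g \o f).
Proof.
move=> V0 oN oU fU sf sg c.
apply: (smooth_on_comp V0 (oN c) oU _ (sf c) sg) => _ [p [cp Np] <-] /=.
by rewrite (atlasK hX cp); exact: fU.
Qed.

Lemma smoothM_chart c : smoothM (cdom c) (chart c).
Proof. by move=> d; exact: atlas_trans. Qed.

(** Any other chart is reached by composing with a transition map. *)
Lemma smoothM_from_chart V N (f : X -> V) c : is_open N -> N `<=` cdom c ->
  smooth_on (chart c @` (cdom c `&` N)) (f \o chart_inv c) -> smoothM N f.
Proof.
move=> oN sN sf.
apply: (@smoothM_eq _ _ ((f \o chart_inv c) \o chart c)) => //.
  by move=> p Np /=; rewrite (atlasK hX)//; exact: sN.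
apply: (smoothM_comp (fin_dim_rV _) oN (oN c) _ _ sf).
  by move=> p Np; exists p => //; split=> //; exact: sN.
exact: smoothM_S sN (smoothM_chart c).
Qed.

Lemma smoothM_cst V N (v : V) : smoothM N (fun=> v).
Proof. by move=> c; exact: smooth_on_cst. Qed.

Lemma smoothM_D V N (f g : X -> V) : is_open N ->
  smoothM N f -> smoothM N g -> smoothM N (fun p => f p + g p).
Proof. by move=> oN sf sg c; exact: (smooth_onD (oN c) (sf c) (sg c)). Qed.

Lemma smoothM_scale V N (f : X -> R) (g : X -> V) : is_open N ->
  smoothM N f -> smoothM N g -> smoothM N (fun p => f p *: g p).
Proof. by move=> oN sf sg c; exact: (smooth_on_scale (oN c) (sf c) (sg c)). Qed.

Lemma smoothM_N V N (f : X -> V) : is_open N -> smoothM N f -> smoothM N (fun p => - f p).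
Proof.
move=> oN sf; have -> : (fun p => - f p) = (fun p => (-1) *: f p).
  by apply/funext => p; rewrite scaleN1r.
by apply: (smoothM_scale oN _ sf); exact: smoothM_cst.
Qed.

Lemma smoothM_sum V N n (F : 'I_n -> X -> V) : is_open N ->
  (forall l, smoothM N (F l)) -> smoothM N (fun p => \sum_l F l p).
Proof.
by move=> oN sF c; apply: (smooth_on_sum (oN c) (fun l => sF l c)).
Qed.

Lemma smoothM_clin V W N (f : X -> V) (g : V -> W) : is_open N ->
  clin g -> smoothM N f -> smoothM N (fun p => g (f p)).
Proof. by move=> oN gl sf c; exact: (smooth_on_clin (oN c) gl (sf c)). Qed.

Lemma smoothM_coord N n (f : X -> 'rV[R]_n) l : is_open N ->
  smoothM N f -> smoothM N (fun p => f p 0 l : R).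
Proof. by move=> oN; exact: smoothM_clin (clin_coord l). Qed.

Lemma smoothM_row_mx N m n (f : X -> 'rV[R]_m) (g : X -> 'rV[R]_n) : is_open N ->
  smoothM N f -> smoothM N g -> smoothM N (fun p => row_mx (f p) (g p)).
Proof.
move=> oN sf sg.
have -> : (fun p => row_mx (f p) (g p)) =
    (fun p => row_mx (f p) 0 + row_mx 0 (g p)).
  by apply/funext => p; rewrite row_mx_split.
exact: (smoothM_D oN (smoothM_clin oN (clin_row_mxl m n) sf)
  (smoothM_clin oN (clin_row_mxr m n) sg)).
Qed.

Lemma smoothM_rows N n (f : X -> 'rV[R]_n) : is_open N ->
  (forall l, smoothM N (fun p => f p 0 l : R)) -> smoothM N f.
Proof.
move=> oN sf; have -> : f = (fun p => \sum_l f p 0 l *: delta_mx 0 l).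
  by apply/funext => p; rewrite {1}(row_sum_delta (f p)).
apply: smoothM_sum => // l; apply: smoothM_scale => //; exact: smoothM_cst.
Qed.

Lemma smoothM_preim_open V N (f : X -> V) (U : set V) : is_open N ->
  smoothM N f -> open U -> is_open (N `&` f @^-1` U).
Proof.
move=> oN sf oU c; rewrite openE => _ [p [cp [Np Up]] <-].
have im : (chart c @` (cdom c `&` N)) (chart c p) by exists p.
have cf := smooth_on_continuous (sf c) im.
have Up' : U ((f \o chart_inv c) (chart c p)) by rewrite /= (atlasK hX cp).
have n1 : nbhs (chart c p) (chart c @` (cdom c `&` N)).
  by apply: open_nbhs_nbhs; split; [exact: oN|].
have n2 := cf _ (open_nbhs_nbhs (conj oU Up')).
apply: filterS (filterI n1 n2) => _ [[q [cq Nq] <-]] /=.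
by rewrite (atlasK hX cq) => Uq; exists q.
Qed.

Lemma smooth_funP (f : X -> R) : smooth_fun f <-> smoothM setT f.
Proof. by rewrite /smooth_fun /smoothM; under [X in _ <-> X]eq_forall do rewrite setIT. Qed.

Lemma chart_nbhs N c p : is_open N -> cdom c p -> N p ->
  nbhs (chart c p) (chart c @` (cdom c `&` N)).
Proof. by move=> oN cp Np; apply: open_nbhs_nbhs; split; [exact: oN | exists p]. Qed.

Lemma smoothM_differentiable V N (f : X -> V) c p : smoothM N f -> N p -> cdom c p ->
  differentiable (f \o chart_inv c) (chart c p).
Proof. by move=> sf Np cp; apply: smooth_on_differentiable (sf c) _; exists p. Qed.

Lemma smoothM_diff V N (f : X -> V) c (v : X -> 'rV[R]_(mdim X)) :
  is_open N -> N `<=` cdom c -> smoothM N f -> smoothM N v ->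
  smoothM N (fun p => 'd (f \o chart_inv c) (chart c p) (v p)).
Proof.
move=> oN sN sf sv; apply: (smoothM_from_chart oN sN).
have := smooth_on_diff (fin_dim_rV _) (oN c) (sf c) (sv c).
apply: smooth_on_eq => [|_ [p [cp Np] <-] /=]; first exact: oN.
by rewrite (atlasK hX cp).
Qed.

End OneSpace.

Section Maps.
Context {X Y : atlas_space R} (hX : is_atlas X) (hY : is_atlas Y).

(** In a neighbourhood where [f] has values in one chart, its expressions in the
    other charts are obtained by composing with transition maps. *)
Lemma smoothM_change_chart (f : X -> Y) N j k : is_open N ->
  N `<=` f @^-1` cdom j -> smoothM N (chart j \o f) ->
  is_open (N `&` f @^-1` cdom k) /\ smoothM (N `&` f @^-1` cdom k) (chart k \o f).
Proof.
move=> oN sN sf.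
have E : N `&` f @^-1` cdom k =
    N `&` (chart j \o f) @^-1` (chart j @` (cdom j `&` cdom k)).
  apply/seteqP; split=> p [Np] /= H; split=> //=.
    by exists (f p) => //; split=> //; exact: sN.
  have [q [jq kq] E] := H.
  by rewrite -(atlasK hY (sN _ Np)) -E (atlasK hY jq).
have oN' : is_open (N `&` f @^-1` cdom k).
  rewrite E; apply: smoothM_preim_open => //; exact: atlas_open.
split=> //.
have sf' : smoothM (N `&` f @^-1` cdom k) (chart j \o f).
  by apply: smoothM_S sf => p [].
have := smoothM_comp hX (fin_dim_rV _) oN' (atlas_open hY j k) _ sf' (atlas_trans hY j k).
move=> /(_ _) H; apply: (smoothM_eq hX oN' _ (H _)).
  by move=> p [Np _] /=; rewrite (atlasK hY (sN _ Np)).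
by move=> p [Np kp] /=; exists (f p) => //; split=> //; exact: sN.
Qed.

(** The definition of [smooth_map] asks for continuity and for all pairs of
    charts. Near each point, one chart of the target is enough. *)
Lemma smooth_map_intro (f : X -> Y) :
  (forall p, exists j N, [/\ is_open N, N p, N `<=` f @^-1` cdom j &
     smoothM N (chart j \o f)]) -> smooth_map f.
Proof.
move=> H; split.
  move=> W oW; apply: is_openP => // p Wp.
  have [j [N [oN Np sN sf]]] := H p.
  exists (N `&` (chart j \o f) @^-1` (chart j @` (cdom j `&` W))); split.
  - by apply: smoothM_preim_open => //; exact: oW.
  - by split=> //=; exists (f p) => //; split=> //; exact: sN.
  - move=> q [Nq [y [jy Wy] /= E]]; rewrite /preimage /=.
    by rewrite -(atlasK hY (sN _ Nq)) -E (atlasK hY jy).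
move=> i j; rewrite -/(_ \o chart_inv i).
suff : smoothM (f @^-1` cdom j) (chart j \o f) by move/(_ i).
apply: smoothM_local => p jp; have [k [N [oN Np sN sf]]] := H p.
have [_ sf'] := smoothM_change_chart j oN sN sf.
by exists (N `&` f @^-1` cdom j); split.
Qed.

Lemma smooth_map_elim (f : X -> Y) (j : cidx Y) : smooth_map f ->
  is_open (f @^-1` cdom j) /\ smoothM (f @^-1` cdom j) (chart j \o f).
Proof.
move=> [fo fs]; split; first by apply: fo; exact: is_open_cdom.
by move=> i; exact: fs.
Qed.

(** Stated for a preimage because the open sets that occur on total spaces are
    preimages under the projection. *)
Lemma smoothM_pullback V (f : X -> Y) N (g : Y -> V) : is_open N -> smooth_map f ->
  smoothM N g -> is_open (f @^-1` N) /\ smoothM (f @^-1` N) (g \o f).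
Proof.
move=> oN sf sg; have oP := sf.1 _ oN; split=> //.
apply: smoothM_local => p Np.
set j := chart_at (f p).
have [oj sj] := smooth_map_elim j sf.
have oN' := is_openI hX oP oj.
exists (f @^-1` N `&` f @^-1` cdom j); split; first by split=> //; exact: atlas_at.
have sj' : smoothM (f @^-1` N `&` f @^-1` cdom j) (chart j \o f).
  by apply: smoothM_S sj => q [].
apply: (smoothM_eq hX oN' _ (smoothM_comp hX (fin_dim_rV _) oN' (oN j) _ sj' (sg j))).
  by move=> q [_ jq] /=; rewrite (atlasK hY jq).
by move=> q [Nq jq] /=; exists (f q).
Qed.

End Maps.
End Atlas.

Arguments atlas_at {R X} _ p.
Arguments atlas_open {R X} _ i j.
Arguments atlas_trans {R X} _ i j.
Arguments is_open_cdom {R X} hX c.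
Arguments smoothM_chart {R X} hX c.

(** * Vector bundles and their sections *)

Arguments tdom_open {R B E} _ i.
Arguments triv_at_dom {R B E} _ b.

Section Bundles.
Context {R : realType}.

Section OneBundle.
Context {B : atlas_space R} {F : vbundle B} (hB : is_atlas B) (hF : is_vbundle F).
Implicit Types (N : set B) (t : tidx F).

Lemma trivP t b a (u v : fib F b) : tdom t b ->
  triv t (a *: u + v) = a *: triv t u + triv t v.
Proof. by move=> tb; exact: triv_linear. Qed.

Lemma triv0 t b : tdom t b -> triv t (0 : fib F b) = 0.
Proof.
move=> tb; have := trivP (-1) (0 : fib F b) 0 tb.
by rewrite scaleN1r oppr0 addr0 scaleN1r addNr.
Qed.

Lemma trivD t b (u v : fib F b) : tdom t b -> triv t (u + v) = triv t u + triv t v.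
Proof. by move=> tb; have := trivP 1 u v tb; rewrite !scale1r. Qed.

Lemma trivZ t b a (u : fib F b) : tdom t b -> triv t (a *: u) = a *: triv t u.
Proof. by move=> tb; have := trivP a u 0 tb; rewrite triv0// !addr0. Qed.

Lemma triv_inj t b : tdom t b -> injective (@triv R B F t b).
Proof. by move=> tb; exact: can_inj (trivK hF tb). Qed.

Lemma triv_sum t b n (f : 'I_n -> fib F b) : tdom t b ->
  triv t (\sum_l f l) = \sum_l triv t (f l).
Proof.
move=> tb; elim: (index_enum _) => [|l r IH]; first by rewrite !big_nil triv0.
by rewrite !big_cons trivD// IH.
Qed.

Lemma is_open_dom c t : is_open (cdom c `&` tdom t).
Proof. by apply: (is_openI hB); [exact: is_open_cdom | exact: tdom_open]. Qed.

Lemma is_openI_tdom N t : is_open N -> is_open (N `&` tdom t).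
Proof. by move=> oN; apply: (is_openI hB) => //; exact: tdom_open. Qed.

Arguments is_open_dom : clear implicits.
Arguments is_openI_tdom {N} t _.

Lemma frame_expand t b (v : fib F b) : tdom t b ->
  v = \sum_l triv t v 0 l *: trivI t b (delta_mx 0 l).
Proof.
move=> tb; apply: (triv_inj tb); rewrite triv_sum//.
under eq_bigr do rewrite trivZ// (trivIK hF tb).
by rewrite {1}(row_sum_delta (triv t v)).
Qed.

Lemma triv_change t t' b (v : fib F b) : tdom t b -> tdom t' b ->
  triv t' v = \sum_l triv t v 0 l *: triv t' (trivI t b (delta_mx 0 l)).
Proof.
move=> tb t'b; rewrite {1}(frame_expand v tb) triv_sum//.
by apply: eq_bigr => l _; rewrite trivZ.
Qed.

Lemma smoothM_transition t t' (w : 'rV[R]_(rank F)) :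
  smoothM (tdom t `&` tdom t') (fun b => triv t' (trivI t b w)).
Proof. by move=> c; exact: triv_smooth. Qed.

(** Sections are kept as plain dependent functions, so that local frames and
    other sections over an open set [N] are covered as well. *)
Definition smoothS N (s : forall b, fib F b) :=
  forall t, smoothM (N `&` tdom t) (fun b => triv t (s b)).

(** The section lives over a map [p], not only over the base: the change of
    trivialization is linear in [s] with coefficients pulled back along [p]. *)
Lemma smoothM_change_triv (Z : atlas_space R) (hZ : is_atlas Z) (p : Z -> B) t t'
    (O : set Z) (s : forall z, fib F (p z)) : is_open O ->
  (forall N (g : B -> 'rV[R]_(rank F)), is_open N -> smoothM N g ->
     smoothM (O `&` p @^-1` N) (g \o p)) ->
  O `<=` p @^-1` (tdom t `&` tdom t') ->
  smoothM O (fun z => triv t (s z)) -> smoothM O (fun z => triv t' (s z)).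
Proof.
move=> oO sp sO st.
have := @smoothM_sum _ _ _ O _ (fun l z => triv t (s z) 0 l *:
  triv t' (trivI t (p z) (delta_mx 0 l))) oO.
move=> /(_ _) H; apply: (smoothM_eq hZ oO _ (H _)).
  by move=> z /sO [tz t'z]; rewrite -triv_change.
move=> l; apply: smoothM_scale => //; first exact: (smoothM_coord l oO st).
have oT : is_open (tdom t `&` tdom t') by apply: is_openI => //; exact: tdom_open.
have := sp _ _ oT (smoothM_transition t t' (delta_mx 0 l)).
apply: smoothM_S => z Oz; split=> //; exact: sO.
Qed.

Lemma smoothS_triv N t s : is_open N -> N `<=` tdom t ->
  smoothM N (fun b => triv t (s b)) -> smoothS N s.
Proof.
move=> oN sN st t'.
have oN' := is_openI_tdom t' oN.
apply: (@smoothM_change_triv B hB idfun t t') => //.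
- by move=> N' g _ sg; apply: smoothM_S sg => b [].
- by move=> b [/sN tb t'b].
- by apply: smoothM_S st => b [].
Qed.

Lemma smoothS_S N N' s : N' `<=` N -> smoothS N s -> smoothS N' s.
Proof. by move=> sN ss t; apply: smoothM_S (ss t) => b [/sN]. Qed.

Lemma smoothS_local N s :
  (forall b, N b -> exists N', N' b /\ smoothS N' s) -> smoothS N s.
Proof.
move=> H t; apply: smoothM_local => b [Nb tb].
have [N' [N'b ss]] := H b Nb.
by exists (N' `&` tdom t); split.
Qed.

Lemma smoothS_eq N s s' : is_open N -> (forall b, N b -> s b = s' b) ->
  smoothS N s -> smoothS N s'.
Proof.
move=> oN E ss t; by apply: (smoothM_eq hB (is_openI_tdom t oN) _ (ss t)) => b [Nb tb]; rewrite E.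
Qed.

Lemma smoothS_D N s s' : is_open N -> smoothS N s -> smoothS N s' ->
  smoothS N (fun b => s b + s' b).
Proof.
move=> oN ss ss' t.
have oN' := is_openI_tdom t oN.
apply: (smoothM_eq hB oN' _ (smoothM_D oN' (ss t) (ss' t))).
by move=> b [Nb tb]; rewrite trivD.
Qed.

Lemma smoothS_Z N (f : B -> R) s : is_open N -> smoothM N f -> smoothS N s ->
  smoothS N (fun b => f b *: s b).
Proof.
move=> oN sf ss t.
have oN' := is_openI_tdom t oN.
have sf' : smoothM (N `&` tdom t) f by apply: smoothM_S sf => b [].
apply: (smoothM_eq hB oN' _ (smoothM_scale oN' sf' (ss t))).
by move=> b [Nb tb]; rewrite trivZ.
Qed.

Lemma smoothS_0 N : is_open N -> smoothS N (fun b => 0).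
Proof.
move=> oN t.
have oN' := is_openI_tdom t oN.
apply: (smoothM_eq hB oN' _ (smoothM_cst _ 0)).
by move=> b [Nb tb]; rewrite triv0.
Qed.

Lemma smoothS_frame t (w : 'rV[R]_(rank F)) : smoothS (tdom t) (fun b => trivI t b w).
Proof. by move=> t'; exact: smoothM_transition. Qed.

(** ** The total space *)

(** A transition map has the form [(x, w) |-> (k x, g x w)] with [k] a transition
    map of the base and [g x] linear in [w], with entries smooth in [x]. *)
Lemma tot_atlas : is_atlas (tot F).
Proof.
have img N c t : @chart R (tot F) (c, t) @` (@cdom _ (tot F) (c, t) `&` @bproj R B F @^-1` N) =
    [set y | (chart c @` (cdom c `&` (tdom t `&` N))) (lsubmx y)].
  apply/seteqP; split=> [_ [z [[cz tz] Nz] <-]|y [b [cb [tb Nb]] E]] /=.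
    by rewrite row_mxKl; exists (projT1 z).
  exists (existT _ b (trivI t b (rsubmx y))) => //=.
  by rewrite E (trivIK hF tb) hsubmxK.
have oimg N c t : is_open N ->
    open (@chart R (tot F) (c, t) @` (@cdom _ (tot F) (c, t) `&` @bproj R B F @^-1` N)).
  move=> oN; rewrite img; apply: (@open_comp _ _ lsubmx) => [y _|].
    exact: (clin_lsubmx _ _).2.
  by apply: is_openI => //; exact: tdom_open.
split.
- by move=> z; split; [exact: (atlas_at hB) | exact: (triv_at_dom hF)].
- move=> [c t] [b v] [/= cb tb] /=.
  by rewrite row_mxKl row_mxKr (atlasK hB cb) (trivK hF tb).
- by move=> [c t] [d s]; exact: (oimg _ c t (is_open_dom d s)).
move=> [c t] [d s].
set U := chart _ @` _; have oU : open U := oimg _ c t (is_open_dom d s).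
have imgU : U = _ := img (cdom d `&` tdom s) c t.
have UE y : U y -> exists2 b, [/\ cdom c b, tdom t b, cdom d b & tdom s b] &
    lsubmx y = chart c b.
  by rewrite imgU => -[b [cb [tb [db sb]]] E]; exists b.
have Ul : forall y, U y -> (chart c @` (cdom c `&` (tdom t `&` (cdom d `&` tdom s)))) (lsubmx y).
  by move=> y /UE [b [cb tb db sb] ->]; exists b.
have oW : open (chart c @` (cdom c `&` (tdom t `&` (cdom d `&` tdom s)))).
  by apply: (is_openI hB); [exact: tdom_open | exact: is_open_dom].
have sl : smooth_on U (fun y : 'rV[R]_(mdim B + rank F) => lsubmx y).
  exact: (smooth_on_clin oU (clin_lsubmx _ _) (smooth_on_id U)).
have sr l : smooth_on U (fun y : 'rV[R]_(mdim B + rank F) => (rsubmx y) 0 l : R).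
  apply: (smooth_on_clin (g := fun y : 'rV[R]_(mdim B + rank F) => rsubmx y 0 l) oU
    _ (smooth_on_id U)).
  by apply: clin_rV => a u v; rewrite !mxE.
have sc : smooth_on U (fun y => chart d (chart_inv c (lsubmx y))).
  apply: (smooth_on_comp (fin_dim_rV _) oU oW Ul sl (g := chart d \o chart_inv c)).
  by apply: smooth_onS (atlas_trans hB c d) => _ [b [cb [_ [db _]]] <-]; exists b.
have st : smooth_on U (fun y => triv s (trivI t (chart_inv c (lsubmx y)) (rsubmx y))).
  have := @smooth_on_sum R _ _ U _ (fun l (y : 'rV[R]_(mdim B + rank F)) => (rsubmx y) 0 l *:
    triv s (trivI t (chart_inv c (lsubmx y)) (delta_mx 0 l))) oU.
  move=> /(_ _) H; apply: (smooth_on_eq oU _ (H _)).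
    move=> y /UE [b [cb tb db sb] E]; rewrite /= E (atlasK hB cb).
    rewrite (triv_change _ tb sb); apply: eq_bigr => l _.
    by rewrite (trivIK hF tb).
  move=> l; apply: smooth_on_scale => //.
  apply: (smooth_on_comp (fin_dim_rV _) oU oW Ul sl
    (g := fun x => triv s (trivI t (chart_inv c x) (delta_mx 0 l)))).
  have := triv_smooth hF t s c (delta_mx 0 l).
  by apply: smooth_onS => _ [b [cb [tb [_ sb]]] <-]; exists b.
apply: (smooth_on_eq (f := fun y => row_mx (chart d (chart_inv c (lsubmx y)))
  (triv s (trivI t (chart_inv c (lsubmx y)) (rsubmx y)))) oU) => [//|].
have -> : (fun y => row_mx (chart d (chart_inv c (lsubmx y)))
    (triv s (trivI t (chart_inv c (lsubmx y)) (rsubmx y)))) =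
  (fun y => row_mx (chart d (chart_inv c (lsubmx y))) 0 +
    row_mx 0 (triv s (trivI t (chart_inv c (lsubmx y)) (rsubmx y)))).
  by apply/funext => y; rewrite row_mx_split.
exact: (smooth_onD oU (smooth_on_clin oU (clin_row_mxl _ _) sc)
  (smooth_on_clin oU (clin_row_mxr _ _) st)).
Qed.

Lemma smooth_to_tot (X : atlas_space R) (hX : is_atlas X) (f : X -> tot F) :
  (forall p, exists c t (N : set X), [/\ is_open N, N p,
     N `<=` (@bproj R B F \o f) @^-1` (cdom c `&` tdom t),
     smoothM N (fun q => chart c (projT1 (f q))) &
     smoothM N (fun q => triv t (projT2 (f q)))]) -> smooth_map f.
Proof.
move=> H; apply: (smooth_map_intro hX tot_atlas) => p.
have [c [t [N [oN Np sN sc st]]]] := H p.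
exists (c, t), N; split=> //; exact: smoothM_row_mx.
Qed.

Lemma smooth_from_tot (X : atlas_space R) (hX : is_atlas X) (f : X -> tot F) c t :
  smooth_map f -> let N := (@bproj R B F \o f) @^-1` (cdom c `&` tdom t) in
  [/\ is_open N, smoothM N (fun q => chart c (projT1 (f q))) &
     smoothM N (fun q => triv t (projT2 (f q)))].
Proof.
move=> sf N; have [oN sN] := @smooth_map_elim R X _ tot_atlas f (c, t) sf.
split=> //.
- apply: (smoothM_eq hX oN _ (smoothM_clin oN (clin_lsubmx _ _) sN)) => q _.
  by rewrite /= row_mxKl.
- apply: (smoothM_eq hX oN _ (smoothM_clin oN (clin_rsubmx _ _) sN)) => q _.
  by rewrite /= row_mxKr.
Qed.

Lemma smoothS_smooth_map s : smoothS setT s <-> smooth_map (fun b => tot_pt (s b)).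
Proof.
split=> [ss|sm t].
- apply: (smooth_to_tot hB) => b.
  have oN := is_open_dom (chart_at b) (triv_at F b).
  exists (chart_at b), (triv_at F b), (cdom (chart_at b) `&` tdom (triv_at F b)); split=> //.
  + by split; [exact: atlas_at | exact: triv_at_dom].
  + by apply: smoothM_S (smoothM_chart hB (chart_at b)) => q [].
  + by apply: smoothM_S (ss (triv_at F b)) => q [].
- apply: smoothM_local => b [_ tb].
  exists (cdom (chart_at b) `&` tdom t); split; first by split=> //; exact: atlas_at.
  by have [] := smooth_from_tot hB (chart_at b) t sm.
Qed.

Lemma section_smoothS (s : section F) N : smoothS N s.
Proof. by have /smoothS_smooth_map := sec_smooth s; apply: smoothS_S. Qed.

Definition mk_section s (ss : smoothS setT s) : section F :=
  MkSection ((smoothS_smooth_map s).1 ss).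

Lemma section_eq (s s' : section F) : (forall b, s b = s' b) -> s = s'.
Proof.
case: s s' => [s hs] [s' hs'] /= E.
have Es : s = s' by apply: functional_extensionality_dep.
by subst s'; congr MkSection; exact: Prop_irrelevance.
Qed.

Lemma bproj_smooth : smooth_map (@bproj R B F).
Proof.
apply: (smooth_map_intro tot_atlas hB) => z.
have oN : is_open (@cdom _ (tot F) (chart_at z)) by exact: (is_open_cdom tot_atlas).
exists (chart_at (projT1 z)), (@cdom _ (tot F) (chart_at z)); split=> //.
- exact: (atlas_at tot_atlas).
- by move=> y [].
apply: (smoothM_eq tot_atlas oN _ (smoothM_clin oN (clin_lsubmx _ _) (smoothM_chart tot_atlas (chart_at z)))) => q _.
  by rewrite /= row_mxKl.
Qed.

End OneBundle.
End Bundles.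

Arguments is_open_dom {R B F} hB hF c t.
Arguments is_openI_tdom {R B F} hB hF {N} t _.
Arguments smoothM_transition {R B F} hF t t' w.
Arguments smoothS_frame {R B F} hF t w.

(** * Tangent, dual and direct sum bundles *)

Section Tangent.
Context {R : realType}.

Section Coord.
Context {X : atlas_space R} (hX : is_atlas X).
Implicit Types N : set X.

Lemma near_chart (V : Type) N c p (f g : 'rV[R]_(mdim X) -> V) : is_open N ->
  N p -> cdom c p -> (forall q, N q -> cdom c q -> f (chart c q) = g (chart c q)) ->
  {near chart c p, f =1 g}.
Proof.
move=> oN Np cp E; have := chart_nbhs oN cp Np.
by apply: filterS => _ [q [cq Nq] <-]; exact: E.
Qed.

Lemma diff_change (V : normedModType R) N (f : X -> V) p (c d : cidx X) v :
  is_open N -> N p -> smoothM N f -> cdom c p -> cdom d p ->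
  'd (f \o chart_inv c) (chart c p) v =
  'd (f \o chart_inv d) (chart d p) ('d (chart d \o chart_inv c) (chart c p) v).
Proof.
move=> oN Np sf cp dp.
have dcd : differentiable (chart d \o chart_inv c) (chart c p).
  exact: (smoothM_differentiable (smoothM_chart hX d) dp cp).
have df : differentiable (f \o chart_inv d) (chart d p).
  exact: smoothM_differentiable sf Np dp.
have cdp : (chart d \o chart_inv c) (chart c p) = chart d p by rewrite /= (atlasK hX cp).
apply: etrans (diff_comp_at v cdp dcd df).
apply: near_eq_diff; first exact: smoothM_differentiable sf Np cp.
apply: (near_chart (N := N `&` cdom d)) => //.
  by apply: is_openI => //; exact: is_open_cdom.
by move=> q [_ dq] cq /=; rewrite (atlasK hX cq) (atlasK hX dq).
Qed.

Lemma diff_chart_id p (c : cidx X) v : cdom c p ->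
  'd (chart c \o chart_inv c) (chart c p) v = v.
Proof.
move=> cp.
have dd := smoothM_differentiable (smoothM_chart hX c) cp cp.
rewrite (near_eq_diff (g := id) v dd) ?diff_val//.
apply: (near_chart (N := cdom c)) => //; first exact: is_open_cdom.
by move=> q _ cq /=; rewrite (atlasK hX cq).
Qed.

(** The chain rule makes the derivatives of the transition maps a cocycle. *)
Lemma tbundle_vbundle : is_vbundle (tbundle X).
Proof.
have K (c d : cidx X) (p : X) v : cdom c p -> cdom d p ->
    'd (chart d \o chart_inv c) (chart c p) ('d (chart c \o chart_inv d) (chart d p) v) = v.
  move=> cp dp; rewrite -(diff_change _ (is_open_cdom hX d))//; first exact: diff_chart_id.
  exact: smoothM_chart.
split.
- exact: (atlas_at hX).
- exact: is_open_cdom.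
- by move=> c p cp a u v; exact: linearP.
- by move=> c p cp v; apply: K => //; exact: atlas_at.
- by move=> c p cp v; apply: K => //; exact: atlas_at.
move=> i j c w.
have oN : is_open (cdom i `&` cdom j) by apply: (is_openI hX); exact: is_open_cdom.
have sj : smoothM (cdom i `&` cdom j) (chart j).
  by apply: smoothM_S (smoothM_chart hX j) => q [].
have := smoothM_diff hX oN (@subIsetl _ _ _) sj (smoothM_cst _ w).
have -> : (fun x => @triv R X (tbundle X) j (chart_inv c x)
    (@trivI R X (tbundle X) i (chart_inv c x) w)) =
  (fun p => @triv R X (tbundle X) j p (@trivI R X (tbundle X) i p w)) \o chart_inv c by [].
move=> sd; have {}sd := smoothM_eq hX oN _ sd; apply: sd => p [ip jp].
exact: (diff_change _ (is_open_cdom hX j) jp (smoothM_chart hX j) ip (atlas_at hX p)).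
Qed.

(** [ddiff] is defined in the preferred chart at [p]; this is its expression in
    an arbitrary one. *)
Lemma ddiff_coord N (f : X -> R) p (c : cidx X) (v : tspace p) :
  is_open N -> N p -> smoothM N f -> cdom c p ->
  ddiff f p v = 'd (f \o chart_inv c) (chart c p) (@triv R X (tbundle X) c p v).
Proof.
move=> oN Np sf cp; rewrite /ddiff lfunE.
exact: (diff_change _ oN Np sf (atlas_at hX p) cp).
Qed.

End Coord.

Lemma tmap_coord (X Y : atlas_space R) (hX : is_atlas X) (hY : is_atlas Y)
    (f : X -> Y) (N : set X) p (c : cidx X) (d : cidx Y) (v : tspace p) :
  is_open N -> N p -> N `<=` f @^-1` cdom d -> smoothM N (chart d \o f) -> cdom c p ->
  @triv R Y (tbundle Y) d (f p) (tmap f p v) =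
  'd (chart d \o f \o chart_inv c) (chart c p) (@triv R X (tbundle X) c p v).
Proof.
move=> oN Np sN sf cp; rewrite /tmap lfunE.
set e := chart_at (f p); have ep : cdom e (f p) by exact: atlas_at.
have [oN' sf'] := smoothM_change_chart hX hY e oN sN sf.
set N' := _ `&` _ in oN' sf'; have N'p : N' p by [].
set c0 := chart_at p; have c0p : cdom c0 p by exact: atlas_at.
have d1 := smoothM_differentiable sf' N'p c0p.
have dp : cdom d (f p) by exact: sN.
have d2 : differentiable (chart d \o chart_inv e) (chart e (f p)).
  exact: (smoothM_differentiable (smoothM_chart hY d) dp ep).
have c0fp : (chart e \o f \o chart_inv c0) (chart c0 p) = chart e (f p).
  by rewrite /= (atlasK hX c0p).
apply: etrans (esym (diff_comp_at v c0fp d1 d2)) _.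
apply: etrans _ (diff_change hX _ oN Np sf c0p cp).
apply/esym/near_eq_diff; first exact: smoothM_differentiable sf Np c0p.
apply: (near_chart (N := N')) => // q [Nq eq] c0q /=.
by rewrite (atlasK hX c0q) (atlasK hY eq).
Qed.

End Tangent.

Section Dot.
Context {R : realType} {n : nat}.
Implicit Types u v w : 'rV[R]_n.

(** Duality between a bundle and its dual becomes [dot] in coordinates. *)
Definition dot u v : R := (u *m v^T) 0 0.

Lemma dotE u v : dot u v = \sum_l u 0 l * v 0 l.
Proof. by rewrite /dot mxE; apply: eq_bigr => l _; rewrite mxE. Qed.

Lemma dotC u v : dot u v = dot v u.
Proof. by rewrite !dotE; apply: eq_bigr => l _; rewrite mulrC. Qed.

Lemma dotPl a u v w : dot (a *: u + v) w = a * dot u w + dot v w.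
Proof. by rewrite /dot mulmxDl -scalemxAl !mxE. Qed.

Lemma dotPr a u v w : dot w (a *: u + v) = a * dot w u + dot w v.
Proof. by rewrite !(dotC w) dotPl. Qed.

Lemma dotDl u v w : dot (u + v) w = dot u w + dot v w.
Proof. by rewrite -[u in LHS]scale1r dotPl mul1r. Qed.

Lemma dotDr u v w : dot w (u + v) = dot w u + dot w v.
Proof. by rewrite !(dotC w) dotDl. Qed.

Lemma dot0l w : dot 0 w = 0.
Proof. by rewrite /dot mul0mx mxE. Qed.

Lemma dot0r w : dot w 0 = 0.
Proof. by rewrite dotC dot0l. Qed.

Lemma dotZl a u w : dot (a *: u) w = a * dot u w.
Proof. by have := dotPl a u 0 w; rewrite addr0 dot0l addr0. Qed.

Lemma dotZr a u w : dot w (a *: u) = a * dot w u.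
Proof. by rewrite !(dotC w) dotZl. Qed.

Lemma dot_delta l w : dot (delta_mx 0 l) w = w 0 l.
Proof.
rewrite dotE (bigD1 l)//= mxE !eqxx mul1r big1 ?addr0// => k kl.
by rewrite mxE (negPf kl) andbF mul0r.
Qed.

Lemma dot_ext u v : (forall w, dot w u = dot w v) -> u = v.
Proof. by move=> E; apply/rowP => l; rewrite -!dot_delta E. Qed.

Lemma clin_dot u : clin (dot u).
Proof. by apply: clin_rV => a v w; exact: dotPr. Qed.

Lemma smoothM_dot (X : atlas_space R) (N : set X) (f g : X -> 'rV[R]_n) :
  is_open N -> smoothM N f -> smoothM N g -> smoothM N (fun p => dot (f p) (g p)).
Proof.
move=> oN sf sg; have -> : (fun p => dot (f p) (g p)) =
    (fun p => \sum_l f p 0 l *: (g p 0 l : R)).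
  by apply/funext => p; rewrite dotE.
apply: smoothM_sum => // l; apply: smoothM_scale => //; exact: smoothM_coord.
Qed.

Lemma diff_dot (V : normedModType R) (f g : V -> 'rV[R]_n) (x h : V) :
  differentiable f x -> differentiable g x ->
  differentiable (fun y => dot (f y) (g y)) x /\
  'd (fun y => dot (f y) (g y)) x h = dot ('d f x h) (g x) + dot (f x) ('d g x h).
Proof.
move=> df dg.
have E : (fun y => dot (f y) (g y)) = \sum_(l < n) (fun y => f y 0 l *: (g y 0 l : R)).
  by apply/funext => y; rewrite dotE fct_sumE.
have dl l := diff_linl h (clin_coord l) df.
have dr l := diff_linl h (clin_coord l) dg.
have ds l := diff_scale h (dl l).1 (dr l).1.
rewrite E; have D : differentiable (\sum_(l < n) (fun y => f y 0 l *: (g y 0 l : R))) x.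
  by apply: differentiable_sum => l; exact: (ds l).1.
split=> //; rewrite -(deriveE h D) derive_sum; last first.
  by move=> l; apply: diff_derivable; exact: (ds l).1.
rewrite !dotE -big_split; apply: eq_bigr => l _ /=.
by rewrite (deriveE h (ds l).1) (ds l).2 (dl l).2 (dr l).2.
Qed.

End Dot.

Section Dual.
Context {R : realType} {B : atlas_space R} {F : vbundle B}.
Context (hB : is_atlas B) (hF : is_vbundle F).

Lemma dual_trivE (t : tidx F) b (eps : fib (dual_bundle F) b) l :
  (@triv R B (dual_bundle F) t b eps) 0 l = eps (trivI t b (delta_mx 0 l)).
Proof. by rewrite mxE. Qed.

Lemma dual_apply (t : tidx F) b (eps : fib (dual_bundle F) b) (e : fib F b) :
  tdom t b -> (eps e : R) = dot (triv t e) (@triv R B (dual_bundle F) t b eps).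
Proof.
move=> tb; rewrite {1}(frame_expand hF e tb) linear_sum dotE; apply: eq_bigr => l _.
by rewrite linearZ dual_trivE.
Qed.

Lemma dual_trivI_apply (t : tidx F) b (x : 'rV[R]_(rank F)) (e : fib F b) : tdom t b ->
  (@trivI R B (dual_bundle F) t b x : 'Hom(fib F b, R^o)) e = dot (triv t e) x.
Proof.
move=> tb; rewrite /=.
have fl : linear (fun e : fib F b => (triv t e *m x^T) 0 0 : R^o).
  by move=> a u v; rewrite (trivP hF)// -[LHS]/(dot _ _) dotPl.
pose fM := GRing.isLinear.Build _ _ _ _ _ fl.
pose fL : {linear fib F b -> R^o} := HB.pack (fun e : fib F b => (triv t e *m x^T) 0 0 : R^o) fM.
exact: (lfunE fL).
Qed.

Lemma dual_vbundle : is_vbundle (dual_bundle F).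
Proof.
split.
- exact: (triv_at_dom hF).
- exact: (tdom_open hF).
- move=> t b tb a u v; apply/rowP => l; rewrite !mxE.
  by rewrite add_lfunE scale_lfunE.
- move=> t b tb eps; apply/lfunP => e.
  by rewrite dual_trivI_apply// -dual_apply.
- move=> t b tb x; apply/rowP => l.
  by rewrite dual_trivE dual_trivI_apply// (trivIK hF tb) dot_delta.
move=> /= i j c w.
have oN : is_open (@tdom _ _ F i `&` @tdom _ _ F j).
  by apply: (is_openI hB); exact: (tdom_open hF).
have sd : smoothM (@tdom _ _ F i `&` @tdom _ _ F j)
    (fun b => \row_l dot (@triv _ _ F i b (trivI j b (delta_mx 0 l))) w).
  apply: smoothM_rows => // l.
  have -> : (fun b => (\row_l dot (@triv _ _ F i b (trivI j b (delta_mx 0 l))) w) 0 l : R) =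
    (fun b => dot (@triv _ _ F i b (trivI j b (delta_mx 0 l))) w).
    by apply/funext => b; rewrite mxE.
  apply: smoothM_dot => //; last exact: smoothM_cst.
  by apply: smoothM_S (smoothM_transition hF j i (delta_mx 0 l)) => b [].
apply: (smoothM_eq (g := fun b => @triv _ _ (dual_bundle F) j b
  (@trivI _ _ (dual_bundle F) i b w)) hB oN _ sd) => b [ib jb].
by apply/rowP => l; rewrite dual_trivE dual_trivI_apply// mxE.
Qed.

End Dual.

Section Whitney.
Context {R : realType} {B : atlas_space R} {F G : vbundle B}.
Context (hB : is_atlas B) (hF : is_vbundle F) (hG : is_vbundle G).

Lemma whitney_vbundle : is_vbundle (whitney F G).
Proof.
split.
- by move=> b; split; [exact: (triv_at_dom hF) | exact: (triv_at_dom hG)].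
- by move=> [s t]; apply: (is_openI hB); [exact: (tdom_open hF) | exact: (tdom_open hG)].
- move=> [s t] b [/= sb tb] a [u u'] [v v'] /=.
  by rewrite (trivP hF)// (trivP hG)// scale_row_mx add_row_mx.
- by move=> [s t] b [/= sb tb] [u u'] /=; rewrite row_mxKl row_mxKr !trivK.
- by move=> [s t] b [/= sb tb] x /=; rewrite !trivIK// hsubmxK.
move=> [s t] [s' t'] c w.
have oN : is_open (@tdom _ _ (whitney F G) (s, t) `&` @tdom _ _ (whitney F G) (s', t')).
  by apply: (is_openI hB); apply: (is_openI hB);
    (exact: (tdom_open hF) || exact: (tdom_open hG)).
apply: (smoothM_row_mx (f := fun b => triv s' (trivI s b (lsubmx w)))
  (g := fun b => triv t' (trivI t b (rsubmx w))) oN).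
- by apply: smoothM_S (smoothM_transition hF s s' (lsubmx w)) => b [[]] ? ? [].
- by apply: smoothM_S (smoothM_transition hG t t' (rsubmx w)) => b [[]] ? ? [].
Qed.

Lemma smoothS_whitney N (s : forall b, fib F b) (s' : forall b, fib G b) : is_open N ->
  smoothS N s -> smoothS N s' -> @smoothS R B (whitney F G) N (fun b => (s b, s' b)).
Proof.
move=> oN ss ss' [t t'].
have oN' : is_open (N `&` @tdom _ _ (whitney F G) (t, t')).
  by apply: (is_openI hB) => //; apply: (is_openI hB);
    [exact: (tdom_open hF) | exact: (tdom_open hG)].
apply: (smoothM_row_mx oN').
- by apply: smoothM_S (ss t) => b [Nb []].
- by apply: smoothM_S (ss' t') => b [Nb []].
Qed.

Lemma smoothS_fst N (s : forall b, fib (whitney F G) b) : is_open N ->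
  smoothS N s -> smoothS N (fun b => (s b).1).
Proof.
move=> oN ss t; apply: smoothM_local => b [Nb tb].
exists (N `&` tdom t `&` tdom (triv_at G b)); split.
  by split=> //; exact: (triv_at_dom hG).
have oN' := is_openI_tdom hB hG (triv_at G b) (is_openI_tdom hB hF t oN).
have sN : smoothM (N `&` tdom t `&` tdom (triv_at G b))
    (fun b' => @triv _ _ (whitney F G) (t, triv_at G b) b' (s b')).
  by apply: smoothM_S (ss (t, triv_at G b)) => q [[]].
apply: (smoothM_eq hB oN' _ (smoothM_clin oN' (clin_lsubmx _ _) sN)) => q _.
  by rewrite /= row_mxKl.
Qed.

Lemma smoothS_snd N (s : forall b, fib (whitney F G) b) : is_open N ->
  smoothS N s -> smoothS N (fun b => (s b).2).
Proof.
move=> oN ss t; apply: smoothM_local => b [Nb tb].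
exists (N `&` tdom t `&` tdom (triv_at F b)); split.
  by split=> //; exact: (triv_at_dom hF).
have oN' := is_openI_tdom hB hF (triv_at F b) (is_openI_tdom hB hG t oN).
have sN : smoothM (N `&` tdom t `&` tdom (triv_at F b))
    (fun b' => @triv _ _ (whitney F G) (triv_at F b, t) b' (s b')).
  by apply: smoothM_S (ss (triv_at F b, t)) => q [[]].
apply: (smoothM_eq hB oN' _ (smoothM_clin oN' (clin_rsubmx _ _) sN)) => q _.
  by rewrite /= row_mxKr.
Qed.

End Whitney.

(** * Cutoff functions and global sections *)

Section Cutoff.
Context {R : realType} {M : atlas_space R} (hM : is_manifold M).
Let hA : is_atlas M := manifold_atlas hM.

Lemma is_open_finite (T : eqType) (r : seq T) (U : T -> set M) :
  (forall y, y \in r -> is_open (U y)) ->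
  is_open [set q | forall y, y \in r -> U y q].
Proof.
elim: r => [|y r IH] oU.
  have -> : [set q | forall y, y \in [::] -> U y q] = setT by apply/seteqP; split.
  exact: is_openT.
have -> : [set q | forall z, z \in y :: r -> U z q] =
    U y `&` [set q | forall z, z \in r -> U z q].
  apply/seteqP; split=> q /=.
    by move=> H; split=> [|z zr]; apply: H; rewrite inE ?eqxx// zr orbT.
  by move=> [Uy H] z; rewrite inE => /predU1P[->//|]; exact: H.
apply: (is_openI hA); first by apply: oU; rewrite inE eqxx.
by apply: IH => z zr; apply: oU; rewrite inE zr orbT.
Qed.

(** A point [q] outside has disjoint neighbourhoods with each point of [K];
    finitely many of those cover [K]. *)
Lemma compact_in_chart_closed (c : cidx M) (K : set 'rV[R]_(mdim M)) :
  compact K -> K `<=` chart c @` cdom c ->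
  is_open [set q | ~ (cdom c q /\ K (chart c q))].
Proof.
move=> cK sK; apply: is_openP => q nC.
pose P (y : 'rV[R]_(mdim M)) (UV : set M * set M) := K y ->
    [/\ is_open UV.1, is_open UV.2, UV.1 q,
        (forall p, cdom c p -> chart c p = y -> UV.2 p) & UV.1 `&` UV.2 = set0].
have [UV hUV] : {UV & forall y, P y (UV y)}.
  apply: boolp.choice => y; have [Ky|nK] := pselect (K y); last first.
    by exists (setT, setT).
  have [p cp py] := sK y Ky.
  have pq : q <> p by move=> qp; apply: nC; rewrite qp py.
  have [U [V [oU oV Uq Vp UV0]]] := manifold_hausdorff hM pq.
  exists (U, V) => _; split=> // p' cp' p'y.
  by have -> : p' = p by rewrite -(atlasK hA cp) py -p'y (atlasK hA cp').
pose f y := chart c @` (cdom c `&` (UV y).2).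
have fo y : K y -> open (f y) by move=> /hUV [_ oV _ _ _]; exact: oV.
have Kf : K `<=` cover K f.
  move=> y Ky; exists y => //; have [p cp py] := sK y Ky.
  by exists p => //; split=> //; have [_ _ _ + _] := hUV y Ky; apply.
move: cK; rewrite compact_cover => /(_ _ K f fo Kf) [D sD Df].
exists [set q' | forall y, y \in finmap.enum_fset D -> (UV y).1 q']; split.
- apply: is_open_finite => y yD.
  by have /sD := yD; rewrite inE => /hUV [].
- by move=> y yD; have /sD := yD; rewrite inE => /hUV [].
- move=> q' Uq' [cq' /Df [y /= yD [q2 [cq2 Vq2] E]]].
  have q'2 : q2 = q' by rewrite -(atlasK hA cq2) E (atlasK hA cq').
  have /sD := yD; rewrite inE => /hUV [_ _ _ _ UV0].
  have : ((UV y).1 `&` (UV y).2) q' by split; [exact: Uq' | rewrite -q'2].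
  by rewrite UV0.
Qed.

(** The cutoff is recorded by two open sets: it is constant 1 on [N] and 0 on
    [Z], and [Z] covers the complement of the prescribed neighbourhood [W]. *)
Lemma cutoff (W : set M) p : is_open W -> W p ->
  exists (chi : M -> R) (N Z : set M),
    [/\ smoothM setT chi, is_open N /\ N p, N `<=` W,
        (forall q, N q -> chi q = 1) &
        [/\ is_open Z, (forall q, W q \/ Z q) & forall q, Z q -> chi q = 0]].
Proof.
move=> oW Wp; set c := chart_at p; set a := chart c p.
have cp : cdom c p by exact: (atlas_at hA).
have nO : nbhs a (chart c @` (cdom c `&` W)) by exact: chart_nbhs.
have /nbhs_closedballP[r rO] := nO.
have [chi0 [chis chi1 chi00]] := bump_rV a (gt0 r).
pose K := closed_ball a r%:num.
have KE : K = [set x | `|a - x| <= r%:num] by rewrite /K closed_ballE.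
have cK : compact K.
  apply: bounded_closed_compact; last exact: closed_ball_closed.
  exists (`|a| + r%:num); split; first exact: num_real.
  move=> m hm x; rewrite KE /= => xa; apply: ltW; apply: le_lt_trans _ hm.
  rewrite -[x](subKr a); apply: le_trans (ler_normB _ _) _.
  by rewrite lerD2l.
have sK : K `<=` chart c @` cdom c.
  by move=> y /rO [q [cq _] <-]; exists q.
pose Z := [set q | ~ (cdom c q /\ K (chart c q))].
have oZ : is_open Z by exact: compact_in_chart_closed.
pose chi q : R := if pselect (cdom c q) then chi0 (chart c q) else 0.
have chiE q : cdom c q -> chi q = chi0 (chart c q) by rewrite /chi; case: pselect.
have chiZ q : Z q -> chi q = 0.
  rewrite /chi; case: pselect => // cq nC; apply: chi00.
  rewrite leNgt; apply/negP => lt; apply: nC; split=> //.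
  by rewrite KE /= distrC ltW.
have oc := is_open_cdom hA c.
have schi0 : smoothM (cdom c) (chi0 \o chart c).
  by apply: (smoothM_comp hA (fin_dim_rV _) oc openT _ (smoothM_chart hA c) chis).
have schi : smoothM setT chi.
  apply: smoothM_local => q _; have [cq|ncq] := pselect (cdom c q).
    exists (cdom c); split=> //; apply: (smoothM_eq hA oc _ schi0) => q' cq'.
    by rewrite chiE.
  exists Z; split; first by move=> [].
  apply: (smoothM_eq hA oZ _ (smoothM_cst _ 0)) => q' Zq'.
  by rewrite chiZ.
pose U1 := interior [set x | chi0 x = 1].
exists chi, ((cdom c `&` W) `&` chart c @^-1` U1), Z; split=> //.
- split.
    apply: (smoothM_preim_open hA _ _ (open_interior _)).
      exact: (is_openI hA).
    by apply: smoothM_S (smoothM_chart hA c) => q [].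
  by split.
- by move=> q [[]].
- by move=> q [[cq _] /interior_subset H]; rewrite chiE.
- split=> // q; have [cq|ncq] := pselect (cdom c q); last by right; case.
  have [Kq|nK] := pselect (K (chart c q)); last by right; case.
  left; have [q' [cq' Wq'] E] := rO _ Kq.
  by rewrite -(atlasK hA cq) -E (atlasK hA cq').
Qed.

Section Sections.
Context {F : vbundle M} (hF : is_vbundle F).

Lemma extend_fun (W : set M) p (f : M -> R) : is_open W -> W p -> smoothM W f ->
  exists (g : M -> R) (N : set M),
    [/\ smoothM setT g, is_open N, N p & forall q, N q -> g q = f q].
Proof.
move=> oW Wp sf; have [chi [N [Z [sc [oN Np] NW chi1 [oZ WZ chiZ]]]]] := cutoff oW Wp.
exists (fun q => chi q *: f q), N; split=> //; last first.
  by move=> q Nq; rewrite chi1// scale1r.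
apply: smoothM_local => q _; have [Wq|Zq] := WZ q.
  exists W; split=> //; apply: smoothM_scale => //.
  exact: smoothM_S sc.
exists Z; split=> //; apply: (smoothM_eq hA oZ _ (smoothM_cst _ 0)) => q' Zq'.
by rewrite chiZ// scale0r.
Qed.

Lemma extend_section (W : set M) p (s : forall q, fib F q) : is_open W -> W p ->
  smoothS W s ->
  exists (s' : section F) (N : set M),
    [/\ is_open N, N p & forall q, N q -> s' q = s q].
Proof.
move=> oW Wp ss; have [chi [N [Z [sc [oN Np] NW chi1 [oZ WZ chiZ]]]]] := cutoff oW Wp.
have sx : smoothS setT (fun q => chi q *: s q).
  apply: smoothS_local => q _; have [Wq|Zq] := WZ q.
    exists W; split=> //; apply: (smoothS_Z hA hF) => //.
    exact: smoothM_S sc.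
  exists Z; split=> //; apply: (smoothS_eq hA hF oZ _ (smoothS_0 hA hF oZ)) => q' Zq'.
  by rewrite chiZ// scale0r.
exists (mk_section hA hF sx), N; split=> // q Nq /=.
by rewrite chi1// scale1r.
Qed.

Lemma section_through p (v : fib F p) : exists s : section F, s p = v.
Proof.
have tp := triv_at_dom hF p.
have [s' [N [_ Np E]]] := extend_section (tdom_open hF (triv_at F p)) tp
  (smoothS_frame hF (triv_at F p) (triv (triv_at F p) v)).
by exists s'; rewrite E// (trivK hF tp).
Qed.

(** The extended sections agree with the frame on one common neighbourhood, a
    finite intersection. *)
Lemma extend_frame p t : tdom t p ->
  exists (e : 'I_(rank F) -> section F) (N : set M),
    [/\ is_open N, N p & forall l q, N q -> e l q = trivI t q (delta_mx 0 l)].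
Proof.
move=> tp.
have H l : exists eN : section F * set M, [/\ is_open eN.2, eN.2 p &
    forall q, eN.2 q -> eN.1 q = trivI t q (delta_mx 0 l)].
  have [s [N ?]] := extend_section (tdom_open hF t) tp (smoothS_frame hF t (delta_mx 0 l)).
  by exists (s, N).
have [eN heN] := boolp.choice H.
exists (fun l => (eN l).1), [set q | forall l, l \in enum 'I_(rank F) -> (eN l).2 q]; split.
- by apply: is_open_finite => l _; have [] := heN l.
- by move=> l _; have [] := heN l.
- by move=> l q Nq; have [_ _] := heN l; apply; apply: Nq; rewrite mem_enum.
Qed.

(** Sections are not given a module structure; combinations are expressed
    pointwise, as in the definition of a bilinear connection. *)
Definition linear_on_sections (Z : lmodType R) (T : section F -> Z) :=
  forall a (s1 s2 s : section F), (forall m, s m = a *: s1 m + s2 m) ->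
    T s = a *: T s1 + T s2.

(** The zero section is [-1] times itself plus itself. *)
Lemma linear_sections0 (Z : lmodType R) (T : section F -> Z) (s : section F) :
  linear_on_sections T -> (forall m, s m = 0) -> T s = 0.
Proof.
move=> Tl s0; have := Tl (-1) s s s; rewrite !scaleN1r addNr; apply.
by move=> m; rewrite s0 scaler0 addr0.
Qed.

Lemma linear_sections_sum (Z : lmodType R) (T : section F -> Z) (I : Type)
    (r : seq I) (G : I -> section F) (s : section F) : linear_on_sections T ->
  (forall m, s m = \sum_(l <- r) G l m) -> T s = \sum_(l <- r) T (G l).
Proof.
move=> Tl; elim: r s => [|l r IH] s sE.
  by rewrite big_nil; apply: linear_sections0 => // m; rewrite sE big_nil.
have ss : smoothS setT (fun m => \sum_(l <- r) G l m).
  elim: r {IH sE} => [|k r IH].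
    apply: (smoothS_eq hA hF _ _ (smoothS_0 hA hF _)); try exact: is_openT.
    by move=> m _; rewrite big_nil.
  have := smoothS_D hA hF (is_openT hA) (section_smoothS hA hF (G k) setT) IH.
  apply: smoothS_eq => //; first exact: is_openT.
  by move=> m _; rewrite big_cons.
rewrite big_cons -(IH (mk_section hA hF ss))//.
rewrite (Tl 1 (G l) (mk_section hA hF ss))// ?scale1r// => m.
by rewrite sE big_cons scale1r.
Qed.

(** A [C^oo]-linear operation is tensorial: with a cutoff [chi] near [p], the
    section [chi ^+ 2 *: s] is a combination of global sections with global
    coefficients, and these vanish at [p] when [s] does. *)
Lemma tensorial (Z : lmodType R) (T : section F -> Z) p :
  (forall (f : M -> R) (s1 s2 s : section F), smoothM setT f ->
     (forall m, s m = f m *: s1 m + s2 m) -> T s = f p *: T s1 + T s2) ->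
  forall s s' : section F, s p = s' p -> T s = T s'.
Proof.
move=> Tc; have Tl : linear_on_sections T.
  by move=> a s1 s2 s sE; exact: Tc (smoothM_cst setT a) sE.
have Tf (f : M -> R) (s s' : section F) : smoothM setT f ->
    (forall m, s' m = f m *: s m) -> T s' = f p *: T s.
  move=> sf sE; pose z := mk_section hA hF (smoothS_0 hA hF (is_openT hA)).
  rewrite (Tc f s z s' sf) => [|m]; last by rewrite sE /= addr0.
  by rewrite (linear_sections0 (s := z) Tl)// addr0.
have T0 (s : section F) : s p = 0 -> T s = 0.
  move=> sp0; set t := triv_at F p; have tp : tdom t p by exact: (triv_at_dom hF).
  have oW := tdom_open hF t.
  have [chi [N [Zs [sc [oN Np] NW chi1 [oZ WZ chiZ]]]]] := cutoff oW tp.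
  have sW : smoothM (tdom t) chi by exact: smoothM_S sc.
  have sse l : smoothS setT (fun q => chi q *: trivI t q (delta_mx 0 l) : fib F q).
    apply: smoothS_local => q _; have [Wq|Zq] := WZ q.
      by exists (tdom t); split=> //; apply: (smoothS_Z hA hF) => //; exact: smoothS_frame.
    exists Zs; split=> //; apply: (smoothS_eq hA hF oZ _ (smoothS_0 hA hF oZ)) => q' Zq'.
    by rewrite chiZ// scale0r.
  have ssg l : smoothM setT (fun q => chi q *: (triv t (s q) 0 l : R)).
    apply: smoothM_local => q _; have [Wq|Zq] := WZ q.
      exists (tdom t); split=> //; apply: smoothM_scale => //; apply: smoothM_coord => //.
      have := section_smoothS hA hF s (tdom t) t; by rewrite setIid.
    exists Zs; split=> //; apply: (smoothM_eq hA oZ _ (smoothM_cst _ 0)) => q' Zq'.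
    by rewrite chiZ// scale0r.
  have oT := is_openT hA.
  pose e l := mk_section hA hF (sse l).
  pose G l := mk_section hA hF (smoothS_Z hA hF oT (ssg l) (sse l)).
  have sc2 : smoothM setT (fun q => chi q *: chi q) by apply: smoothM_scale.
  (* [S] is [chi ^+ 2 *: s], the sum of the [G l]; one factor [chi] is needed for
     the coefficients and one for the frame to be global *)
  pose S := mk_section hA hF (smoothS_Z hA hF oT sc2 (section_smoothS hA hF s setT)).
  have -> : T s = T S.
    by rewrite (Tf _ s S sc2)//= chi1// [1 *: 1]mulr1 scale1r.
  rewrite (linear_sections_sum (r := enum 'I_(rank F)) (G := G) Tl).
    rewrite big1// => l _.
    by rewrite (Tf _ (e l) (G l) (ssg l))// sp0 triv0// mxE scaler0 scale0r.
  move=> m; rewrite /G /S /=; have [Wm|Zm] := WZ m.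
    rewrite {1}(frame_expand hF (s m) Wm) scaler_sumr big_enum; apply: eq_bigr => l _.
    by rewrite !scalerA; congr (_ *: _); rewrite /GRing.scale /= mulrAC.
  rewrite chiZ// !scale0r big1// => l _.
  by rewrite !scale0r.
move=> s s' E.
have ss : smoothS setT (fun q => (-1) *: s' q + s q).
  apply: (smoothS_D hA hF (is_openT hA)); last exact: section_smoothS.
  by apply: (smoothS_Z (f := fun=> -1) hA hF (is_openT hA));
    [exact: smoothM_cst | exact: section_smoothS].
have := T0 (mk_section hA hF ss); rewrite (Tl (-1) s' s)//= E scaleN1r addNr => /(_ erefl).
by rewrite scaleN1r addrC => /subr0_eq.
Qed.

End Sections.
End Cutoff.

(** * The double vector bundle in coordinates *)

Section RowCalculus.
Context {R : realType}.

Lemma dot_row m n (u u' : 'rV[R]_m) (v v' : 'rV[R]_n) :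
  dot (row_mx u v) (row_mx u' v') = dot u u' + dot v v'.
Proof. by rewrite /dot tr_row_mx mul_row_col mxE. Qed.

Lemma dot_split m n (u u' : 'rV[R]_(m + n)) :
  dot u u' = dot (lsubmx u) (lsubmx u') + dot (rsubmx u) (rsubmx u').
Proof. by rewrite -dot_row !hsubmxK. Qed.

Lemma diffD_apply (V W : normedModType R) (f g : V -> W) x v :
  differentiable f x -> differentiable g x -> 'd (f + g) x v = 'd f x v + 'd g x v.
Proof. by move=> df dg; rewrite diffD. Qed.

Lemma diff_affine (W : normedModType R) (a b : W) (x : R) :
  differentiable (fun s : R => a + s *: b) x /\
  'd (fun s : R => a + s *: b) x (1 : R) = b.
Proof.
have lb : linear (fun s : R => s *: b).
  by move=> k u v; rewrite scalerDl scalerA.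
have [db Eb] := clin_diff x (clin_fin_dim fin_dim_R lb).
have da := differentiable_cst a x.
split; first exact: differentiableD.
apply: etrans (diffD_apply (1 : R) da db) _.
apply: etrans (congr2 +%R (congr1 (fun f => f (1 : R)) (diff_cst a x)) (Eb 1)) _.
by rewrite scale1r; exact: add0r.
Qed.

Lemma diff_row_mx (V : normedModType R) m n (f : V -> 'rV[R]_m) (g : V -> 'rV[R]_n) x v :
  differentiable f x -> differentiable g x ->
  differentiable (fun y => row_mx (f y) (g y)) x /\
  'd (fun y => row_mx (f y) (g y)) x v = row_mx ('d f x v) ('d g x v).
Proof.
move=> df dg.
have [d1 E1] := diff_linl v (clin_row_mxl m n) df.
have [d2 E2] := diff_linl v (clin_row_mxr m n) dg.
have -> : (fun y => row_mx (f y) (g y)) =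
    (fun y => row_mx (f y) 0) + (fun y => row_mx 0 (g y)).
  by apply/funext => y; rewrite row_mx_split.
split; first exact: differentiableD.
apply: etrans (diffD_apply v d1 d2) _.
by apply: etrans (congr2 +%R E1 E2) _; rewrite -row_mx_split.
Qed.

(** The transpose of the differential of [g], applied to [u]: the coordinates of
    the covector [w |-> u . dg(w)]. *)
Definition codiff n r (g : 'rV[R]_n -> 'rV[R]_r) (x : 'rV[R]_n) (u : 'rV[R]_r) : 'rV[R]_n :=
  \row_l dot u ('d g x (delta_mx 0 l)).

Lemma dot_codiff n r (g : 'rV[R]_n -> 'rV[R]_r) x u v :
  dot v (codiff g x u) = dot u ('d g x v).
Proof.
rewrite {2}(row_sum_delta v) linear_sum dotE (dotC u) /dot mulmx_suml summxE.
apply: eq_bigr => l _; rewrite linearZ -scalemxAl !mxE; congr (_ * _).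
by rewrite dotC /dot mxE.
Qed.

Lemma smoothM_codiff (X : atlas_space R) (hX : is_atlas X) (N : set X) r
    (g : X -> 'rV[R]_r) c (u : X -> 'rV[R]_r) : is_open N -> N `<=` cdom c ->
  smoothM N g -> smoothM N u ->
  smoothM N (fun p => codiff (g \o chart_inv c) (chart c p) (u p)).
Proof.
move=> oN sN sg su; apply: smoothM_rows => // l.
have -> : (fun p => codiff (g \o chart_inv c) (chart c p) (u p) 0 l : R) =
    (fun p => dot (u p) ('d (g \o chart_inv c) (chart c p) (delta_mx 0 l))).
  by apply/funext => p; rewrite mxE.
by apply: smoothM_dot => //; apply: smoothM_diff => //; exact: smoothM_cst.
Qed.

End RowCalculus.

Section Coordinates.
Context {R : realType}.

Lemma smooth_map_comp (X Y Z : atlas_space R) (hX : is_atlas X) (hY : is_atlas Y)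
    (hZ : is_atlas Z) (f : X -> Y) (g : Y -> Z) :
  smooth_map f -> smooth_map g -> smooth_map (g \o f).
Proof.
move=> sf sg; apply: (smooth_map_intro hX hZ) => p.
set j := chart_at (g (f p)).
have [oj sj] := smooth_map_elim hZ j sg.
have [oN sN] := smoothM_pullback hX hY oj sf sj.
exists j, (f @^-1` (g @^-1` cdom j)); split=> //.
exact: (atlas_at hZ).
Qed.

(** Projections, additions and scalings of bundles are linear in suitable charts,
    where their tangent maps are given by the same linear maps. *)
Lemma tmap_coord_linear (X Y : atlas_space R) (hX : is_atlas X) (hY : is_atlas Y)
    (f : X -> Y) (N : set X) p (c : cidx X) (d : cidx Y) (v : tspace p)
    (L : 'rV[R]_(mdim X) -> 'rV[R]_(mdim Y)) :
  clin L -> is_open N -> N p -> N `<=` cdom c -> N `<=` f @^-1` cdom d ->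
  (forall q, N q -> chart d (f q) = L (chart c q)) ->
  @triv R Y (tbundle Y) d (f p) (tmap f p v) = L (@triv R X (tbundle X) c p v).
Proof.
move=> cL oN Np Nc Nd E.
have sL : smoothM N (fun q => L (chart c q)).
  by apply: smoothM_clin => //; exact: smoothM_S Nc (smoothM_chart hX c).
have sf : smoothM N (chart d \o f).
  by apply: (smoothM_eq hX oN _ sL) => q Nq /=; rewrite E.
rewrite (tmap_coord hX hY v oN Np Nd sf (Nc _ Np)).
have df := smoothM_differentiable sf Np (Nc _ Np).
have [_ EL] := clin_diff (chart c p) cL.
rewrite -EL; apply: near_eq_diff df _.
apply: (near_chart (N := N)) => // [|q Nq cq /=]; first exact: Nc.
by rewrite (atlasK hX cq) E.
Qed.

Context {M : atlas_space R} {E : vbundle M} (hA : is_atlas M) (hE : is_vbundle E).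

Let hT : is_atlas (tot E) := tot_atlas hA hE.
Let hTM : is_vbundle (tbundle M) := tbundle_vbundle hA.
Let hTE : is_vbundle (tbundle (tot E)) := tbundle_vbundle hT.

(** Coordinates of a tangent vector of [M], of a covector of [M], of a tangent
    vector of [E] and of a covector of [E], in a chart [c] of [M] and a
    trivialization [t] of [E]. *)
Definition vco (c : cidx M) m (v : tspace m) : 'rV[R]_(mdim M) :=
  @triv R M (tbundle M) c m v.
Definition cco (c : cidx M) m (th : 'Hom(tspace m, R^o)) : 'rV[R]_(mdim M) :=
  @triv R M (cotbundle M) c m th.
Definition dco (t : tidx E) m (eps : 'Hom(fib E m, R^o)) : 'rV[R]_(rank E) :=
  @triv R M (dual_bundle E) t m eps.
Definition vcoE (c : cidx M) (t : tidx E) m (e : fib E m) (v : tspace (tot_pt e)) :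
    'rV[R]_(mdim M + rank E) :=
  @triv R (tot E) (tbundle (tot E)) (c, t) (tot_pt e) v.
Definition ccoE (c : cidx M) (t : tidx E) m (e : fib E m)
    (th : 'Hom(tspace (tot_pt e), R^o)) : 'rV[R]_(mdim M + rank E) :=
  @triv R (tot E) (cotbundle (tot E)) (c, t) (tot_pt e) th.

Section AtPoint.
Context (c : cidx M) (t : tidx E) (m : M) (cm : cdom c m) (tm : tdom t m).

Lemma cco_apply (th : 'Hom(tspace m, R^o)) v : (th v : R) = dot (vco c v) (cco c th).
Proof. exact: (dual_apply hTM). Qed.

Lemma dco_apply (eps : 'Hom(fib E m, R^o)) e : (eps e : R) = dot (triv t e) (dco t eps).
Proof. exact: (dual_apply hE). Qed.

Lemma ccoE_apply (e : fib E m) (th : 'Hom(tspace (tot_pt e), R^o)) v :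
  (th v : R) = dot (vcoE c t v) (ccoE c t th).
Proof. by apply: (@dual_apply _ _ _ hTE (c, t)). Qed.

Lemma vcoE_inj (e : fib E m) : injective (@vcoE c t m e).
Proof. by apply: (@triv_inj _ _ _ hTE (c, t)). Qed.

Lemma vcoE_surj (e : fib E m) y : exists v, @vcoE c t m e v = y.
Proof.
exists (@trivI _ _ (tbundle (tot E)) (c, t) (tot_pt e) y).
by apply: (@trivIK _ _ _ hTE (c, t)).
Qed.

Lemma vco_inj : injective (@vco c m).
Proof. exact: (triv_inj hTM). Qed.

Lemma vco_surj x : exists v, @vco c m v = x.
Proof. by exists (@trivI _ _ (tbundle M) c m x); exact: (trivIK hTM). Qed.

Lemma vcoP a (v w : tspace m) : vco c (a *: v + w) = a *: vco c v + vco c w.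
Proof. exact: (trivP hTM). Qed.

Lemma ccoP a (th th' : 'Hom(tspace m, R^o)) :
  cco c (a *: th + th') = a *: cco c th + cco c th'.
Proof. exact: (trivP (dual_vbundle hA hTM)). Qed.

Lemma dcoP a (eps eps' : 'Hom(fib E m, R^o)) :
  dco t (a *: eps + eps') = a *: dco t eps + dco t eps'.
Proof. exact: (trivP (dual_vbundle hA hE)). Qed.

Lemma vcoEP a (e : fib E m) (v w : tspace (tot_pt e)) :
  vcoE c t (a *: v + w) = a *: vcoE c t v + vcoE c t w.
Proof. by apply: (@trivP _ _ _ hTE (c, t)). Qed.

Lemma ccoEP a (e : fib E m) (th th' : 'Hom(tspace (tot_pt e), R^o)) :
  ccoE c t (a *: th + th') = a *: ccoE c t th + ccoE c t th'.
Proof. by apply: (@trivP _ _ _ (dual_vbundle hT hTE) (c, t)). Qed.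

Lemma vco0 : vco c (0 : tspace m) = 0.
Proof. exact: (triv0 hTM). Qed.

Lemma dco0 : dco t (0 : 'Hom(fib E m, R^o)) = 0.
Proof. exact: (triv0 (dual_vbundle hA hE)). Qed.

Lemma ccoE_ext (e : fib E m) (th th' : 'Hom(tspace (tot_pt e), R^o)) :
  ccoE c t th = ccoE c t th' -> th = th'.
Proof. by move=> Eq; apply/lfunP => v; rewrite !ccoE_apply Eq. Qed.

Lemma cco_ext (th th' : 'Hom(tspace m, R^o)) : cco c th = cco c th' -> th = th'.
Proof. by move=> Eq; apply/lfunP => v; rewrite !cco_apply Eq. Qed.

Lemma dco_ext (eps eps' : 'Hom(fib E m, R^o)) : dco t eps = dco t eps' -> eps = eps'.
Proof. by move=> Eq; apply/lfunP => v; rewrite !dco_apply Eq. Qed.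

Lemma ccoE_eq (e : fib E m) (th : 'Hom(tspace (tot_pt e), R^o)) y :
  (forall v, (th v : R) = dot (vcoE c t v) y) -> ccoE c t th = y.
Proof.
move=> H; apply: dot_ext => w; have [v <-] := vcoE_surj e w.
by rewrite -H ccoE_apply.
Qed.

Lemma cco_eq (th : 'Hom(tspace m, R^o)) y :
  (forall v, (th v : R) = dot (vco c v) y) -> cco c th = y.
Proof.
by move=> H; apply: dot_ext => w; have [v <-] := vco_surj w; rewrite -H cco_apply.
Qed.

Lemma dco_eq (eps : 'Hom(fib E m, R^o)) y :
  (forall u, (eps u : R) = dot (triv t u) y) -> dco t eps = y.
Proof.
by move=> H; apply: dot_ext => w; rewrite -(trivIK hE tm w) -H -dco_apply.
Qed.

Lemma vco_bproj (e : fib E m) (v : tspace (tot_pt e)) :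
  vco c (tmap (@bproj R M E) (tot_pt e) v) = lsubmx (vcoE c t v).
Proof.
have oN : is_open (@cdom _ (tot E) (c, t)) by exact: is_open_cdom.
apply: (tmap_coord_linear hT hA (c := (c, t)) v (clin_lsubmx _ _) oN) => //.
- by move=> z [].
- by move=> z [/= cz tz]; rewrite row_mxKl.
Qed.

(** The curve [e + a u] is affine in the chart [(c, t)]. The velocity is defined in
    the preferred chart, from which it is transported. *)
Lemma vcoE_vlift (e u : fib E m) : vcoE c t (vlift e u) = row_mx 0 (triv t u).
Proof.
have dl (d : cidx M) (s : tidx E) : tdom s m ->
    let g := @chart _ (tot E) (d, s) \o (fun a : R => tot_pt (e + a *: u)) in
    differentiable g 0 /\ 'd g 0 (1 : R) = row_mx 0 (triv s u).
  move=> sm g.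
  have gE : g = (fun a : R => row_mx (chart d m) (triv s e) + a *: row_mx 0 (triv s u)).
    apply/funext => a; rewrite /g /=.
    by rewrite (trivD hE)// (trivZ hE)// scale_row_mx add_row_mx scaler0 addr0.
  by rewrite gE; exact: diff_affine.
set c0 := chart_at m; set t0 := triv_at E m.
have c0m : cdom c0 m by exact: (atlas_at hA).
have t0m : tdom t0 m by exact: (triv_at_dom hE).
have [d0 E0] := dl c0 t0 t0m; have [d1 E1] := dl c t tm.
rewrite /vcoE /vlift /velocity /triv /= derive1E (deriveE (1 : R) d0).
have g0 : (@chart _ (tot E) (c0, t0) \o (fun a : R => tot_pt (e + a *: u))) 0 =
   @chart _ (tot E) (c0, t0) (tot_pt e).
  by rewrite /= scale0r addr0.
have dtr : differentiable (@chart _ (tot E) (c, t) \o @chart_inv _ (tot E) (c0, t0))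
    (@chart _ (tot E) (c0, t0) (tot_pt e)).
  by apply: (smoothM_differentiable (smoothM_chart hT (c, t))).
apply: etrans (esym (diff_comp_at (1 : R) g0 d0 dtr)) _.
rewrite -E1; apply/esym/near_eq_diff => //.
near=> a => /=.
by rewrite row_mxKl row_mxKr (atlasK hA c0m) (trivK hE t0m).
Unshelve. all: by end_near. Qed.

Lemma vliftP a (e u u' : fib E m) : vlift e (a *: u + u') = a *: vlift e u + vlift e u'.
Proof.
apply: (@vcoE_inj e); apply: etrans (vcoE_vlift _ _) _.
apply: etrans _ (esym (vcoEP a _ _)).
apply: etrans _ (esym (congr2 (fun x y => a *: x + y) (vcoE_vlift e u) (vcoE_vlift e u'))).
by rewrite (trivP hE _ _ _ tm) scale_row_mx add_row_mx scaler0 addr0.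
Qed.

Lemma r_map_apply (e : fib E m) th u : (r_map e th u : R) = th (vlift e u).
Proof.
have fl : linear (fun u : fib E m => th (vlift e u)).
  by move=> a v w; rewrite vliftP linearP.
pose fM := GRing.isLinear.Build _ _ _ _ _ fl.
pose fL : {linear fib E m -> R^o} := HB.pack (fun u : fib E m => th (vlift e u)) fM.
exact: (lfunE fL).
Qed.

(** [r_map] restricts a covector to vertical vectors, hence reads its fibre
    part. *)
Lemma dco_r_map (e : fib E m) th : dco t (r_map e th) = rsubmx (ccoE c t th).
Proof.
apply: dco_eq => u; rewrite r_map_apply ccoE_apply vcoE_vlift dot_split.
by rewrite row_mxKl row_mxKr dot0l add0r.
Qed.

Lemma vcoE_core_lift (tau : fib (coreB E) m) (e : fib E m) :
  @vcoE c t m e (core_lift tau e).1 = row_mx 0 (triv t tau.1).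
Proof. exact: vcoE_vlift. Qed.

Lemma ccoE_core_lift (tau : fib (coreB E) m) (e : fib E m) :
  @ccoE c t m e (core_lift tau e).2 = row_mx (@cco c m tau.2) 0.
Proof.
apply: ccoE_eq => v; rewrite /= comp_lfunE cco_apply vco_bproj dot_split.
by rewrite row_mxKl row_mxKr dot0r addr0.
Qed.

(** In the chart the section is the graph [x |-> (x, s x)]. *)
Lemma vcoE_section (s : section E) (v : tspace m) :
  vcoE c t (tmap (fun p => tot_pt (s p)) m v) =
  row_mx (vco c v) ('d ((fun q => triv t (s q)) \o chart_inv c) (chart c m) (vco c v)).
Proof.
have oN := is_open_dom hA hE c t.
have st : smoothM (cdom c `&` tdom t) (fun q => triv t (s q)).
  by apply: smoothM_S (section_smoothS hA hE s setT t) => q [].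
have sc : smoothM (cdom c `&` tdom t) (chart c).
  by apply: smoothM_S (smoothM_chart hA c) => q [].
have ct : (cdom c `&` tdom t) m by [].
rewrite /vcoE (tmap_coord hA hT v oN ct (d := (c, t)) (c := c))//; last exact: smoothM_row_mx.
have d1 := smoothM_differentiable sc ct cm.
have d2 := smoothM_differentiable st ct cm.
have [_ D] := diff_row_mx (vco c v) d1 d2.
by apply: etrans D _; rewrite (diff_chart_id hA).
Qed.

Lemma ddiff_ell (eps : section (dual_bundle E)) (e : fib E m) (v : tspace (tot_pt e)) :
  (ddiff (ell (fun p => eps p)) (tot_pt e) v : R) =
  dot (rsubmx (vcoE c t v)) (dco t (eps m)) +
  dot (triv t e) ('d ((fun q => dco t (eps q)) \o chart_inv c) (chart c m)
    (lsubmx (vcoE c t v))).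
Proof.
set W := @cdom _ (tot E) (c, t).
have oW : is_open W by exact: is_open_cdom.
have oN := is_open_dom hA hE c t.
have se : smoothM (cdom c `&` tdom t) (fun q => dco t (eps q)).
  apply: smoothM_S (section_smoothS hA (dual_vbundle hA hE) eps setT t) => q [_ tq].
  by split.
have [_ sp] := smoothM_pullback hT hA oN (bproj_smooth hA hE) se.
have sr : smoothM W (fun z => rsubmx (@chart _ (tot E) (c, t) z)).
  exact: smoothM_clin oW (clin_rsubmx _ _) (smoothM_chart hT (c, t)).
have sd : smoothM W (ell (fun p => eps p)).
  apply: (smoothM_eq hT oW _ (smoothM_dot oW sr sp)) => z [/= cz tz].
  by rewrite row_mxKr /ell (dual_apply hE _ _ tz).
have We : W (tot_pt e) by [].
rewrite (ddiff_coord hT v oW We sd We).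
have ct : (cdom c `&` tdom t) m by [].
set y0 := chart _ _; have y0E : y0 = row_mx (chart c m) (triv t e) by [].
have dr : differentiable (fun y : 'rV[R]_(mdim M + rank E) => rsubmx y) y0.
  exact: (clin_diff y0 (clin_rsubmx _ _)).1.
have [dl El] := clin_diff y0 (@clin_lsubmx R (mdim M) (rank E)).
have dg : differentiable ((fun q => dco t (eps q)) \o chart_inv c) (chart c m).
  exact: smoothM_differentiable se ct cm.
have l0 : lsubmx y0 = chart c m by rewrite y0E row_mxKl.
have dgl : differentiable (((fun q => dco t (eps q)) \o chart_inv c) \o
    (fun y : 'rV[R]_(mdim M + rank E) => lsubmx y)) y0.
  by apply: differentiable_comp => //; rewrite l0.
have [_ D] := diff_dot (vcoE c t v) dr dgl.
have D1 := (clin_diff y0 (@clin_rsubmx R (mdim M) (rank E))).2 (vcoE c t v).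
have D2 := etrans (diff_comp_at (vcoE c t v) l0 dl dg) (congr1 _ (El (vcoE c t v))).
have D3 : (((fun q => dco t (eps q)) \o chart_inv c) \o
    (fun y : 'rV[R]_(mdim M + rank E) => lsubmx y)) y0 = dco t (eps m).
  by rewrite /= l0 (atlasK hA cm).
have D4 : rsubmx y0 = triv t e by rewrite y0E row_mxKr.
apply: etrans _ (etrans D (congr2 +%R (congr2 dot D1 D3) (congr2 dot D4 D2))).
apply: near_eq_diff; first exact: (smoothM_differentiable sd We We).
apply: (near_chart oW) => // z [/= cz tz] _.
rewrite !row_mxKl !row_mxKr (atlasK hA cz) /ell /= (dual_apply hE _ _ tz).
by rewrite (trivIK hE tz).
Qed.

(** In the chart [ell eps] is [(x, w) |-> w . eps x]: its derivative along the base
    is the transposed derivative of [eps], along the fibre it is [eps]. *)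
Lemma ccoE_ell (eps : section (dual_bundle E)) (e : fib E m) :
  ccoE c t (ddiff (ell (fun p => eps p)) (tot_pt e)) =
  row_mx (codiff ((fun q => dco t (eps q)) \o chart_inv c) (chart c m) (triv t e))
    (dco t (eps m)).
Proof.
apply: ccoE_eq => v; rewrite ddiff_ell dot_split row_mxKl row_mxKr dot_codiff.
by rewrite addrC.
Qed.

End AtPoint.
End Coordinates.

(** * The Lie derivative in coordinates *)

Section Lie.
Context {R : realType}.

(** From real-valued functions to vector-valued ones, by coordinates. *)
Lemma derive_comm_fin_dim (V W : normedModType R) (f : V -> W) (U : set V) (x v w : V) :
  fin_dim W -> open U -> smooth_on U f -> U x -> 'D_w ('D_v f) x = 'D_v ('D_w f) x.
Proof.
move=> [n [b [c [cl ce]]]] oU sf Ux.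
suff H l : c l ('D_w ('D_v f) x) = c l ('D_v ('D_w f) x).
  apply: etrans (ce _) (etrans _ (esym (ce _))); apply: eq_bigr => l _.
  exact: (congr1 (fun a => a *: b l) (H l)).
pose fl y : R := c l (f y).
have sl : smooth_on U fl by exact: (smooth_on_clin oU (cl l) sf).
have Dl (u : V) (g : V -> W) y : smooth_on U g -> U y ->
    c l ('D_u g y) = 'D_u (fun z => c l (g z)) y.
  move=> sg Uy; have dg := smooth_on_differentiable sg Uy.
  have [dgl E] := diff_linl u (cl l) dg.
  by apply: etrans (congr1 (c l) (deriveE u dg)) _;
    apply: etrans (esym E) (esym (deriveE u dgl)).
have DDl u u' : c l ('D_u' ('D_u f) x) = 'D_u' ('D_u fl) x.
  apply: etrans (Dl _ _ _ (smooth_on_derive u sf) Ux) _.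
  apply: near_eq_derive; have := open_nbhs_nbhs (conj oU Ux).
  by apply: filterS => y Uy; exact: Dl.
exact: (etrans (DDl v w) (etrans (derive_comm v w oU sl Ux) (esym (DDl w v)))).
Qed.

Lemma diff_diff_comm (V W : normedModType R) (f : V -> W) U x v w : fin_dim W ->
  open U -> smooth_on U f -> U x ->
  'd (fun y => 'd f y v) x w = 'd (fun y => 'd f y w) x v.
Proof.
move=> hW oU sf Ux.
have H u u' : 'd (fun y => 'd f y u) x u' = 'D_u' ('D_u f) x.
  have nE : {near x, (fun y => 'd f y u) =1 'D_u f}.
    have := open_nbhs_nbhs (conj oU Ux); apply: filterS => y Uy.
    by rewrite (deriveE u (smooth_on_differentiable sf Uy)).
  have dD := smooth_on_differentiable (smooth_on_derive u sf) Ux.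
  have nE' : {near x, 'D_u f =1 (fun y => 'd f y u)}.
    by apply: filterS nE => y ->.
  apply: etrans (esym (near_eq_diff u' dD nE')) _.
  by rewrite (deriveE u' dD).
exact: (etrans (H v w) (etrans (derive_comm_fin_dim v w hW oU sf Ux) (esym (H w v)))).
Qed.

(** In the standard basis ['d f y (Y y)] is a sum of products, to which the Leibniz
    rule applies. *)
Lemma diff_moving (W : normedModType R) n (f : 'rV[R]_n -> W) U (Y : 'rV[R]_n -> 'rV[R]_n) x v :
  open U -> smooth_on U f -> U x -> differentiable Y x ->
  'd (fun y => 'd f y (Y y)) x v = 'd (fun y => 'd f y (Y x)) x v + 'd f x ('d Y x v).
Proof.
move=> oU sf Ux dY.
pose g l := 'D_(delta_mx 0 l) f.
have dg l : differentiable (g l) x.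
  exact: (smooth_on_differentiable (smooth_on_derive _ sf) Ux).
have dfE y u : U y -> 'd f y u = \sum_l u 0 l *: g l y.
  move=> Uy; rewrite {1}(row_sum_delta u) linear_sum; apply: eq_bigr => l _.
  by rewrite linearZ /g (deriveE _ (smooth_on_differentiable sf Uy)).
have key (Z : 'rV[R]_n -> 'rV[R]_n) : differentiable Z x ->
    'd (fun y => 'd f y (Z y)) x v =
    \sum_l (('d Z x v) 0 l *: g l x + Z x 0 l *: 'd (g l) x v).
  move=> dZ.
  have dl l := diff_linl v (clin_coord l) dZ.
  have ds l := diff_scale v (dl l).1 (dg l).
  have dS : differentiable (\sum_l (fun y => Z y 0 l *: g l y)) x.
    by apply: differentiable_sum => l; exact: (ds l).1.
  have nE : {near x, \sum_l (fun y => Z y 0 l *: g l y) =1 (fun y => 'd f y (Z y))}.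
    have := open_nbhs_nbhs (conj oU Ux); apply: filterS => y Uy.
    by rewrite dfE// fct_sumE.
  apply: etrans (esym (near_eq_diff v dS nE)) _.
  apply: etrans (esym (deriveE v dS)) _.
  apply: etrans (derive_sum (fun l => diff_derivable (ds l).1)) _.
  apply: eq_bigr => l _.
  apply: etrans (deriveE v (ds l).1) (etrans (ds l).2 _).
  by congr (_ *: _ + _); exact: (dl l).2.
have dc : differentiable (fun _ : 'rV[R]_n => Y x) x by exact: differentiable_cst.
have E0 : 'd (fun=> Y x) x v = 0 := congr1 (fun h => h v) (diff_cst (Y x) x).
apply: etrans (key Y dY) _; apply/esym.
apply: etrans (congr2 +%R (key (fun=> Y x) dc) (dfE x ('d Y x v) Ux)) _.
have alg (z u y : 'rV[R]_n) (a b : 'I_n -> W) : z = 0 ->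
    \sum_l (z 0 l *: a l + y 0 l *: b l) + \sum_l u 0 l *: a l =
    \sum_l (u 0 l *: a l + y 0 l *: b l).
  move=> ->; rewrite -big_split; apply: eq_bigr => l _ /=.
  by rewrite mxE scale0r add0r addrC.
exact: (alg _ _ _ _ _ E0).
Qed.

Context {M : atlas_space R} (hA : is_atlas M).
Let hTM : is_vbundle (tbundle M) := tbundle_vbundle hA.
Let hCM : is_vbundle (cotbundle M) := dual_vbundle hA hTM.

Lemma vco_change (c d : cidx M) m (v : tspace m) : cdom c m -> cdom d m ->
  vco d v = 'd (chart d \o chart_inv c) (chart c m) (vco c v).
Proof.
move=> cm dm.
exact: (diff_change hA v (is_open_cdom hA d) dm (smoothM_chart hA d) (atlas_at hA m) cm).
Qed.

Lemma vco_at m (v : tspace m) : @vco R M (chart_at m) m v = v.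
Proof. exact: (diff_chart_id hA v (atlas_at hA m)). Qed.

Definition vfun (X : forall m : M, tspace m) (c : cidx M) : 'rV[R]_(mdim M) -> 'rV[R]_(mdim M) :=
  (fun q => vco c (X q)) \o chart_inv c.
Definition cfun (th : forall m : M, 'Hom(tspace m, R^o)) (c : cidx M) :
  'rV[R]_(mdim M) -> 'rV[R]_(mdim M) := (fun q => cco c (th q)) \o chart_inv c.

Context (X : section (tbundle M)) (th : section (cotbundle M)).

Lemma smoothM_vco c : smoothM (cdom c) (fun q => @vco R M c q (X q)).
Proof.
by have := section_smoothS hA hTM X setT c; rewrite setTI.
Qed.

Lemma smoothM_cco c : smoothM (cdom c) (fun q => @cco R M c q (th q)).
Proof.
by have := section_smoothS hA hCM th setT c; rewrite setTI.
Qed.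

Let dvfun c m (cm : cdom c m) : differentiable (vfun X c) (chart c m) :=
  smoothM_differentiable (smoothM_vco c) cm cm.
Let dcfun c m (cm : cdom c m) : differentiable (cfun th c) (chart c m) :=
  smoothM_differentiable (smoothM_cco c) cm cm.

Lemma vfunE c m : cdom c m -> vfun X c (chart c m) = @vco R M c m (X m).
Proof. by move=> cm; rewrite /vfun /= (atlasK hA cm). Qed.

Lemma cfunE c m : cdom c m -> cfun th c (chart c m) = @cco R M c m (th m).
Proof. by move=> cm; rewrite /cfun /= (atlasK hA cm). Qed.

(** [lie_form] is a [linfun] of an explicit formula in the preferred chart; its
    linearity, which makes the formula its value, is shown here. *)
Lemma lie_form_at m (w : tspace m) : let c := chart_at m in
  (lie_form (fun p => X p) (fun p => th p) m w : R) =
  dot (vco c w) ('d (cfun th c) (chart c m) (@vco R M c m (X m))) +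
  dot (@cco R M c m (th m)) ('d (vfun X c) (chart c m) (vco c w)).
Proof.
move=> c; have cm : cdom c m by exact: (atlas_at hA).
pose F (v : 'rV[R]_(mdim M)) : R^o := dot v ('d (cfun th c) (chart c m) (X m)) +
  dot ('d (vfun X c) (chart c m) v) (@cco R M c m (th m)).
have FE : (fun v : 'rV[R]_(mdim M) =>
    ('d (fun x : 'rV[R]_(mdim M) =>
           (th (chart_inv c x) (@trivI R M (tbundle M) c (chart_inv c x) v) : R))
        (chart c m) (X m)
     + th m ('d (fun x : 'rV[R]_(mdim M) =>
               @triv R M (tbundle M) c (chart_inv c x) (X (chart_inv c x)))
            (chart c m) v)) : R^o) = F.
  apply/funext => v; rewrite /F; congr (_ + _); last first.
    by rewrite (cco_apply hA cm) vco_at.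
  have [dd D] := diff_linl (X m) (clin_dot v) (dcfun cm).
  apply: etrans _ D.
  apply/esym/near_eq_diff => //.
  apply: (near_chart (is_open_cdom hA c)) => // q cq _.
  rewrite /cfun /= (atlasK hA cq) (cco_apply hA cq).
  by congr dot; rewrite /vco (trivIK hTM cq).
have Fl : linear F.
  move=> a u v.
  have alg (p q r s : R) : (a * p + q) + (a * r + s) = a * (p + r) + (q + s) by ring.
  apply: etrans (congr2 +%R (dotPl _ _ _ _) (etrans (congr1 (fun z => dot z _)
    (diff_linear _ _ _ _ _)) (dotPl _ _ _ _))) (alg _ _ _ _).
pose fM := GRing.isLinear.Build _ _ _ _ F Fl.
pose fL : {linear 'rV[R]_(mdim M) -> R^o} := HB.pack F fM.
rewrite /lie_form -/c FE.
apply: etrans (lfunE fL w) _; rewrite /= /F !vco_at.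
by congr (_ + _); exact: dotC.
Qed.

(** Independence of the chart. Both terms produce a second derivative of the
    transition map; the two cancel because it is symmetric. *)
Lemma lie_form_coord c m (w : tspace m) : cdom c m ->
  (lie_form (fun p => X p) (fun p => th p) m w : R) =
  dot (vco c w) ('d (cfun th c) (chart c m) (@vco R M c m (X m))) +
  dot (@cco R M c m (th m)) ('d (vfun X c) (chart c m) (vco c w)).
Proof.
move=> cm; rewrite lie_form_at; set c0 := chart_at m.
have c0m : cdom c0 m by exact: (atlas_at hA).
set a := chart c0 m; set k := chart c \o chart_inv c0.
set U := chart c0 @` (cdom c0 `&` cdom c).
have oU : open U by exact: (atlas_open hA c0 c).
have sk : smooth_on U k by exact: (atlas_trans hA c0 c).
have Ua : U a by exists m.
have ka : k a = chart c m by rewrite /k /= (atlasK hA c0m).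
have dk := smooth_on_differentiable sk Ua.
have Jv (v : tspace m) : vco c v = 'd k a (vco c0 v) by exact: vco_change.
have Ith q u : cdom c0 q -> cdom c q ->
    dot u (@cco R M c0 q (th q)) = dot ('d k (chart c0 q) u) (@cco R M c q (th q)).
  move=> c0q cq; have [v <-] := vco_surj hA c0q u.
  by rewrite -(cco_apply hA c0q) (cco_apply hA cq) -(vco_change v c0q cq).
have oN : is_open (cdom c0 `&` cdom c) by apply: (is_openI hA); exact: is_open_cdom.
(* the derivative of the transformation law of [th] along [X] *)
have A1 u : dot u ('d (cfun th c0) a (@vco R M c0 m (X m))) =
    dot ('d (fun x => 'd k x u) a (@vco R M c0 m (X m))) (@cco R M c m (th m)) +
    dot ('d k a u) ('d (cfun th c) (chart c m) (@vco R M c m (X m))).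
  have [d1 D1] := diff_linl (@vco R M c0 m (X m)) (clin_dot u) (dcfun c0m).
  apply: etrans (esym D1) _.
  have dJ : differentiable (fun x => 'd k x u) a.
    apply: (@smooth_on_differentiable _ _ _ U) => //.
    exact: (smooth_on_diff (fin_dim_rV _) oU sk (smooth_on_cst U u)).
  have dck : differentiable (cfun th c) (k a) by rewrite ka; exact: dcfun.
  have [d2 D2] := diff_dot (@vco R M c0 m (X m)) dJ (differentiable_comp dk dck).
  have E1 : (cfun th c \o k) a = @cco R M c m (th m) by rewrite /= ka cfunE.
  have E2 : 'd (cfun th c \o k) a (@vco R M c0 m (X m)) =
      'd (cfun th c) (chart c m) (@vco R M c m (X m)).
    apply: etrans (diff_comp_at _ ka dk (dcfun cm)) _.
    by rewrite Jv.
  apply: etrans _ (etrans D2 (congr2 +%R (congr1 (dot _) E1) (congr1 (dot _) E2))).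
  apply: (near_eq_diff _ d1).
  apply: (near_chart (c := c0) oN (conj c0m cm) c0m) => q [c0q cq] _.
  by rewrite /cfun /k /= (atlasK hA c0q) (atlasK hA cq) Ith.
(* the derivative of the transformation law of [X] along [w] *)
have A2 u : 'd (vfun X c) (chart c m) ('d k a u) =
    'd (fun x => 'd k x (@vco R M c0 m (X m))) a u + 'd k a ('d (vfun X c0) a u).
  have X0 : vfun X c0 a = @vco R M c0 m (X m) by exact: vfunE.
  have D := diff_moving u oU sk Ua (dvfun c0m).
  rewrite -X0; apply: etrans _ D.
  apply: etrans (esym (diff_comp_at u ka dk (dvfun cm))) _.
  have dck : differentiable (vfun X c) (k a) by rewrite ka; exact: dvfun.
  apply: near_eq_diff; first exact: (differentiable_comp dk dck).
  apply: (near_chart (c := c0) oN (conj c0m cm) c0m) => q [c0q cq] _.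
  rewrite /vfun /k /= (atlasK hA c0q) (atlasK hA cq).
  exact: vco_change.
have S := diff_diff_comm (vco c0 w) (@vco R M c0 m (X m)) (fin_dim_rV _) oU sk Ua.
have RW := etrans (congr1 ('d (vfun X c) (chart c m)) (Jv w)) (A2 (vco c0 w)).
have alg (p : R) (y d1 d2 z : 'rV[R]_(mdim M)) : d1 = d2 ->
    p + (dot y d2 + dot y z) = dot d1 y + p + dot z y.
  by move=> ->; rewrite (dotC y d2) (dotC y z) addrCA addrA.
apply: etrans (congr2 +%R (A1 _) (etrans (dotC _ _) (Ith m _ c0m cm))) _.
apply: etrans (esym (alg _ _ _ _ _ S)) _.
by apply/esym; apply: etrans (congr2 +%R (congr1 (fun y => dot y _) (Jv w))
  (etrans (congr1 (dot _) RW) (dotDr _ _ _))) _.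
Qed.

(** The same value as a vector: derivative of the coefficients of [th] along [X],
    plus the transposed derivative of [X] applied to [th]. *)
Lemma cco_lie_form c m : cdom c m ->
  cco c (lie_form (fun p => X p) (fun p => th p) m) =
  'd (cfun th c) (chart c m) (@vco R M c m (X m)) + codiff (vfun X c) (chart c m) (@cco R M c m (th m)).
Proof.
move=> cm; apply: (cco_eq hA cm) => w.
apply: etrans (lie_form_coord w cm) (esym (etrans (dotDr _ _ _) _)).
by apply: (congr1 (fun y => _ + y)); exact: dot_codiff.
Qed.

End Lie.

(** * Linear splittings in coordinates *)

Section Double.
Context {R : realType} {M : atlas_space R} {E : vbundle M}.
Context (hA : is_atlas M) (hE : is_vbundle E).
Let hT : is_atlas (tot E) := tot_atlas hA hE.
Let hEE : is_vbundle (whitney E E) := whitney_vbundle hA hE hE.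
Let hTT : is_atlas (tot (whitney E E)) := tot_atlas hA hEE.
Let hTEE : is_vbundle (tbundle (tot (whitney E E))) := tbundle_vbundle hTT.

Section AtPoint.
Context (c : cidx M) (t : tidx E) (m : M) (cm : cdom c m) (tm : tdom t m).

Let wco (e e' : fib E m) (z : tspace (@tot_pt R M (whitney E E) m (e, e'))) :
    'rV[R]_(mdim M + (rank E + rank E)) :=
  @triv R _ (tbundle (tot (whitney E E))) (c, (t, t)) (@tot_pt R M (whitney E E) m (e, e')) z.

Let oW : is_open (@cdom _ (tot (whitney E E)) (c, (t, t))) := is_open_cdom hTT (c, (t, t)).

Let vcoE_fst (e e' : fib E m) (z : tspace (@tot_pt R M (whitney E E) m (e, e'))) :
  @vcoE R M E c t m e (tmap (@fst_tot R M E) _ z) =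
  row_mx (lsubmx (@wco e e' z)) (lsubmx (rsubmx (@wco e e' z))).
Proof.
pose L (y : 'rV[R]_(mdim M + (rank E + rank E))) := row_mx (lsubmx y) (lsubmx (rsubmx y)).
have cL : clin L.
  by apply: clin_rV => a u v; rewrite /L !linearP scale_row_mx add_row_mx.
apply: (tmap_coord_linear hTT hT (c := (c, (t, t))) (d := (c, t)) z cL oW) => //.
- by move=> q [/= cq [tq _]].
- by move=> q [/= cq [tq _]]; rewrite /L row_mxKl row_mxKr row_mxKl.
Qed.

Let vcoE_snd (e e' : fib E m) (z : tspace (@tot_pt R M (whitney E E) m (e, e'))) :
  @vcoE R M E c t m e' (tmap (@snd_tot R M E) _ z) =
  row_mx (lsubmx (@wco e e' z)) (rsubmx (rsubmx (@wco e e' z))).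
Proof.
pose L (y : 'rV[R]_(mdim M + (rank E + rank E))) := row_mx (lsubmx y) (rsubmx (rsubmx y)).
have cL : clin L.
  by apply: clin_rV => a u v; rewrite /L !linearP scale_row_mx add_row_mx.
apply: (tmap_coord_linear hTT hT (c := (c, (t, t))) (d := (c, t)) z cL oW) => //.
- by move=> q [/= cq [tq _]].
- by move=> q [/= cq [tq _]]; rewrite /L row_mxKl row_mxKr row_mxKr.
Qed.

Let vcoE_add (e e' : fib E m) (z : tspace (@tot_pt R M (whitney E E) m (e, e'))) :
  @vcoE R M E c t m (e + e') (tmap (@add_tot R M E) _ z) =
  row_mx (lsubmx (@wco e e' z)) (lsubmx (rsubmx (@wco e e' z)) + rsubmx (rsubmx (@wco e e' z))).
Proof.
pose L (y : 'rV[R]_(mdim M + (rank E + rank E))) :=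
  row_mx (lsubmx y) (lsubmx (rsubmx y) + rsubmx (rsubmx y)).
have cL : clin L.
  apply: clin_rV => a u v; rewrite /L !linearP scale_row_mx add_row_mx.
  by congr row_mx; rewrite scalerDr addrACA.
apply: (tmap_coord_linear hTT hT (c := (c, (t, t))) (d := (c, t)) z cL oW) => //.
- by move=> q [/= cq [tq _]].
- move=> q [/= cq [tq _]]; rewrite /L row_mxKl row_mxKr row_mxKr row_mxKl.
  by rewrite (trivD hE).
Qed.

(** A tangent vector of [E x_M E] has one base part and two vertical parts. The
    tangent map of the addition keeps the former and adds the latter. *)
Lemma tadd_coord (e e' : fib E m) (v : tspace (tot_pt e)) (w : tspace (tot_pt e'))
    (u : tspace (tot_pt (e + e'))) :
  tadd e e' v w u <->
  [/\ lsubmx (vcoE c t v) = lsubmx (vcoE c t w),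
      lsubmx (vcoE c t u) = lsubmx (vcoE c t v) &
      rsubmx (vcoE c t u) = rsubmx (vcoE c t v) + rsubmx (vcoE c t w)].
Proof.
split=> [[z [<- <- <-]]|[vw uv uvw]].
  by rewrite vcoE_fst vcoE_snd vcoE_add !row_mxKl !row_mxKr.
pose y := row_mx (lsubmx (vcoE c t v)) (row_mx (rsubmx (vcoE c t v)) (rsubmx (vcoE c t w))).
pose z := @trivI R _ (tbundle (tot (whitney E E))) (c, (t, t))
  (@tot_pt R M (whitney E E) m (e, e')) y.
have zy : @wco e e' z = y.
  have := @trivIK _ _ _ hTEE (c, (t, t)) (@tot_pt R M (whitney E E) m (e, e'))
    (conj cm (conj tm tm)) y.
  by rewrite /wco /z => ->.
exists z; split.
- apply: (vcoE_inj hA hE cm tm); apply: etrans (vcoE_fst z) _; rewrite zy /y.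
  by rewrite row_mxKl row_mxKr row_mxKl hsubmxK.
- apply: (vcoE_inj hA hE cm tm); apply: etrans (vcoE_snd z) _; rewrite zy /y.
  by rewrite row_mxKl !row_mxKr vw hsubmxK.
- apply: (vcoE_inj hA hE cm tm); apply: etrans (vcoE_add z) _; rewrite zy /y.
  by rewrite row_mxKl !row_mxKr row_mxKl -uv -uvw hsubmxK.
Qed.

Lemma vcoE_tscale a (e : fib E m) (v : tspace (tot_pt e)) :
  vcoE c t (tscale a e v) = row_mx (lsubmx (vcoE c t v)) (a *: rsubmx (vcoE c t v)).
Proof.
pose L (y : 'rV[R]_(mdim M + rank E)) := row_mx (lsubmx y) (a *: rsubmx y).
have cL : clin L.
  apply: clin_rV => b u w; rewrite /L !linearP scale_row_mx add_row_mx.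
  by rewrite scalerA mulrC -scalerA.
have oN := is_open_cdom hT ((c, t) : cidx (tot E)).
apply: (tmap_coord_linear hT hT (c := (c, t)) (d := (c, t)) v cL oN) => //.
by move=> q [/= cq tq]; rewrite /L row_mxKl row_mxKr (trivZ hE).
Qed.

Local Opaque vcoE ccoE vco cco dco.

(** The two components of an element of [TE (+) T^*E] that its projections to
    [E] and [TM (+) E^*] do not see: the vertical part of the tangent vector and
    the horizontal part of the covector. *)
Definition vert (e : fib E m) (x : fib (bigB E) (tot_pt e)) : 'rV[R]_(rank E) :=
  rsubmx (@vcoE R M E c t m e x.1).
Definition horz (e : fib E m) (x : fib (bigB E) (tot_pt e)) : 'rV[R]_(mdim M) :=
  lsubmx (@ccoE R M E c t m e x.2).

Lemma vco_Phi (e : fib E m) (x : fib (bigB E) (tot_pt e)) :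
  lsubmx (@vcoE R M E c t m e x.1) = @vco R M c m (Phi e x).1.
Proof. by rewrite -(vco_bproj hA hE cm tm). Qed.

Lemma dco_Phi (e : fib E m) (x : fib (bigB E) (tot_pt e)) :
  rsubmx (@ccoE R M E c t m e x.2) = @dco R M E t m (Phi e x).2.
Proof. by rewrite -(dco_r_map hA hE cm tm). Qed.

Lemma big_ext (e : fib E m) (x y : fib (bigB E) (tot_pt e)) :
  Phi e x = Phi e y -> vert x = vert y -> horz x = horz y -> x = y.
Proof.
move=> xy vxy hxy; have e1 : x.1 = y.1.
  apply: (vcoE_inj hA hE cm tm); rewrite -[LHS]hsubmxK -[RHS]hsubmxK.
  by congr row_mx; [rewrite !vco_Phi xy | exact: vxy].
have e2 : x.2 = y.2.
  apply: (ccoE_ext hA hE cm tm); rewrite -[LHS]hsubmxK -[RHS]hsubmxK.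
  by congr row_mx; [exact: hxy | rewrite !dco_Phi xy].
by case: x y e1 e2 {xy vxy hxy} => [x1 x2] [y1 y2] /= -> ->.
Qed.

Lemma Phi_eq (e : fib E m) (x : fib (bigB E) (tot_pt e)) (nu : fib (anchorB E) m) :
  lsubmx (@vcoE R M E c t m e x.1) = @vco R M c m nu.1 ->
  rsubmx (@ccoE R M E c t m e x.2) = @dco R M E t m nu.2 -> Phi e x = nu.
Proof.
rewrite vco_Phi dco_Phi => H1 H2.
have E1 := vco_inj hA cm H1; have E2 := dco_ext hE tm H2.
by move: E1 E2; case: (Phi e x) nu {H1 H2} => [a b] [a' b'] /= -> ->.
Qed.

Let vco_same (e e' : fib E m) (x : fib (bigB E) (tot_pt e)) (y : fib (bigB E) (tot_pt e')) :
  Phi e' y = Phi e x ->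
  lsubmx (@vcoE R M E c t m e' y.1) = lsubmx (@vcoE R M E c t m e x.1).
Proof.
move=> P; apply: etrans (vco_Phi y) (etrans _ (esym (vco_Phi x))).
exact: (congr1 (fun nu : fib (anchorB E) m => @vco R M c m nu.1) P).
Qed.

Let dco_same (e e' : fib E m) (x : fib (bigB E) (tot_pt e)) (y : fib (bigB E) (tot_pt e')) :
  Phi e' y = Phi e x ->
  rsubmx (@ccoE R M E c t m e' y.2) = rsubmx (@ccoE R M E c t m e x.2).
Proof.
move=> P; apply: etrans (dco_Phi y) (etrans _ (esym (dco_Phi x))).
exact: (congr1 (fun nu : fib (anchorB E) m => @dco R M E t m nu.2) P).
Qed.

Let apply_hor (e : fib E m) (th : 'Hom(tspace (tot_pt e), R^o)) (v : tspace (tot_pt e)) w :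
  vcoE c t v = row_mx w 0 -> (th v : R) = dot w (lsubmx (ccoE c t th)).
Proof.
move=> vE; apply: etrans (ccoE_apply hA hE cm tm th v) _; rewrite vE dot_split.
by rewrite row_mxKl row_mxKr dot0l addr0.
Qed.

(** For [x], [x'] and [y] over the same element of [TM (+) E^*] the base and fibre
    parts agree, and the sum only concerns [vert] and [horz]. The covector
    condition is tested on vectors without vertical part, which suffices because
    the fibre parts are known. *)
Lemma splitting_add_coord (e e' : fib E m) (x : fib (bigB E) (tot_pt e))
    (x' : fib (bigB E) (tot_pt e')) (y : fib (bigB E) (tot_pt (e + e'))) :
  Phi e' x' = Phi e x -> Phi (e + e') y = Phi e x ->
  (tadd e e' x.1 x'.1 y.1 /\ cotadd e e' x.2 x'.2 y.2) <->
  (vert y = vert x + vert x' /\ horz y = horz x + horz x').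
Proof.
move=> Px' Py; split.
  move=> [Ht [_ K]]; have [_ _ H] := (@tadd_coord e e' x.1 x'.1 y.1).1 Ht.
  split; first exact: H.
  apply: dot_ext => w.
  have [v vE] := vcoE_surj hA hE cm tm e (row_mx w 0).
  have [v' vE'] := vcoE_surj hA hE cm tm e' (row_mx w 0).
  have [v2 vE2] := vcoE_surj hA hE cm tm (e + e') (row_mx w 0).
  have T : tadd e e' v v' v2.
    apply: (@tadd_coord e e' v v' v2).2; rewrite vE vE' vE2 !row_mxKl !row_mxKr addr0.
    exact: (And3 erefl erefl erefl).
  apply: etrans (esym (apply_hor y.2 vE2)) (etrans (K v v' v2 T) _).
  apply: etrans (congr2 +%R (apply_hor x.2 vE) (apply_hor x'.2 vE')) _.
  exact: (esym (dotDr _ _ _)).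
move=> [Hv Hh]; split.
  apply: (@tadd_coord e e' x.1 x'.1 y.1).2.
  exact: (And3 (esym (vco_same Px')) (vco_same Py) Hv).
split.
  apply: (dco_ext hE tm); apply: etrans (dco_r_map hA hE cm tm _) _.
  exact: (etrans (esym (dco_same Px')) (esym (dco_r_map hA hE cm tm _))).
move=> v w u Ht; have [vw uv uvw] := (@tadd_coord e e' v w u).1 Ht.
have alg (V W U X X' Y : 'rV[R]_(mdim M + rank E)) :
    lsubmx V = lsubmx W -> lsubmx U = lsubmx V -> rsubmx U = rsubmx V + rsubmx W ->
    rsubmx X' = rsubmx X -> rsubmx Y = rsubmx X -> lsubmx Y = lsubmx X + lsubmx X' ->
    dot U Y = dot V X + dot W X'.
  move=> a b d f g h; rewrite !dot_split f g h d b -a dotDr dotDl; exact: addrACA.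
apply: etrans (ccoE_apply hA hE cm tm y.2 u) (esym (etrans (congr2 +%R
  (ccoE_apply hA hE cm tm x.2 v) (ccoE_apply hA hE cm tm x'.2 w)) (esym _))).
exact: (alg _ _ _ _ _ _ vw uv uvw (dco_same Px') (dco_same Py) Hh).
Qed.

(** As for the sum, horizontal test vectors determine [horz]. For [a = 0] they
    are the only information that the tangent map of the scaling retains. *)
Lemma splitting_scale_coord a (e : fib E m) (x : fib (bigB E) (tot_pt e))
    (y : fib (bigB E) (tot_pt (a *: e))) : Phi (a *: e) y = Phi e x ->
  (y.1 = tscale a e x.1 /\ cotscale a e x.2 y.2) <->
  (vert y = a *: vert x /\ horz y = a *: horz x).
Proof.
move=> Py; split.
  move=> [H [_ K]]; split.
    apply: etrans (congr1 (fun z => rsubmx (vcoE c t z)) H) _.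
    by apply: etrans (congr1 rsubmx (vcoE_tscale a x.1)) _; rewrite row_mxKr.
  apply: dot_ext => w.
  have [v vE] := vcoE_surj hA hE cm tm e (row_mx w 0).
  have vE' : vcoE c t (tscale a e v) = row_mx w 0.
    apply: etrans (vcoE_tscale a v) _.
    by rewrite vE row_mxKl row_mxKr scaler0.
  apply: etrans (esym (apply_hor y.2 vE')) (etrans (K v) _).
  by apply: etrans (congr1 (fun z => a * z) (apply_hor x.2 vE)) _; rewrite dotZr.
move=> [Hv Hh]; split.
  apply: (vcoE_inj hA hE cm tm); apply: etrans _ (esym (vcoE_tscale a x.1)).
  apply: etrans (esym (hsubmxK _)) _.
  exact: (congr2 (fun p q => row_mx p q) (vco_same Py) Hv).
split.
  apply: (dco_ext hE tm); apply: etrans (dco_r_map hA hE cm tm _) _.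
  exact: (etrans (dco_same Py) (esym (dco_r_map hA hE cm tm _))).
move=> v.
have alg (V U X Y : 'rV[R]_(mdim M + rank E)) :
    U = row_mx (lsubmx V) (a *: rsubmx V) ->
    rsubmx Y = rsubmx X -> lsubmx Y = a *: lsubmx X -> dot U Y = a * dot V X.
  move=> -> p q; rewrite !dot_split row_mxKl row_mxKr p q dotZr dotZl.
  by rewrite mulrDr.
apply: etrans (ccoE_apply hA hE cm tm y.2 _) _.
apply: etrans _ (esym (congr1 (fun z => a * z) (ccoE_apply hA hE cm tm x.2 v))).
exact: (alg _ _ _ _ (vcoE_tscale a v) (dco_same Py) Hh).
Qed.

Lemma vertP a (e : fib E m) (x y : fib (bigB E) (tot_pt e)) :
  vert (a *: x + y) = a *: vert x + vert y.
Proof.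
by rewrite /vert -linearP -(vcoEP hA hE cm tm).
Qed.

Lemma horzP a (e : fib E m) (x y : fib (bigB E) (tot_pt e)) :
  horz (a *: x + y) = a *: horz x + horz y.
Proof.
by rewrite /horz -linearP -(ccoEP hA hE cm tm).
Qed.

Lemma vert_core (tau : fib (coreB E) m) (e : fib E m) :
  vert (core_lift tau e) = triv t tau.1.
Proof. by rewrite /vert (vcoE_core_lift hA hE cm tm) row_mxKr. Qed.

Lemma horz_core (tau : fib (coreB E) m) (e : fib E m) :
  horz (core_lift tau e) = @cco R M c m tau.2.
Proof. by rewrite /horz (ccoE_core_lift hA hE cm tm) row_mxKl. Qed.

Lemma Phi_core (tau : fib (coreB E) m) (e : fib E m) : Phi e (core_lift tau e) = 0.
Proof.
apply: Phi_eq.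
- by rewrite (vcoE_core_lift hA hE cm tm) row_mxKl (vco0 hA cm).
- by rewrite (ccoE_core_lift hA hE cm tm) row_mxKr (dco0 hA hE tm).
Qed.

Lemma PhiP a (e : fib E m) (x y : fib (bigB E) (tot_pt e)) :
  Phi e (a *: x + y) = a *: Phi e x + Phi e y.
Proof.
apply: Phi_eq.
- apply: etrans (congr1 lsubmx (vcoEP hA hE cm tm a x.1 y.1)) _.
  by rewrite linearP /= !vco_Phi -(vcoP hA cm).
- apply: etrans (congr1 rsubmx (ccoEP hA hE cm tm a x.2 y.2)) _.
  by rewrite linearP /= !dco_Phi -(dcoP hA hE tm).
Qed.

End AtPoint.
End Double.

(** * From splittings to Dorfman connections *)

Section SectionCalculus.
Context {R : realType} {M : atlas_space R} (hA : is_atlas M).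
Let hTM : is_vbundle (tbundle M) := tbundle_vbundle hA.

Lemma codiffP n r (g : 'rV[R]_n -> 'rV[R]_r) x a u u' :
  codiff g x (a *: u + u') = a *: codiff g x u + codiff g x u'.
Proof.
apply: dot_ext => w; apply: etrans (dot_codiff _ _ _ _) _.
apply: etrans (dotPl _ _ _ _) (esym _).
apply: etrans (dotPr _ _ _ _) _.
exact: (congr2 (fun p q => a * p + q) (dot_codiff _ _ _ _) (dot_codiff _ _ _ _)).
Qed.

Lemma dot_ddiff (f : M -> R) c m w : smoothM setT f -> cdom c m ->
  dot w (@cco R M c m (ddiff f m)) = 'd (f \o chart_inv c) (chart c m) w.
Proof.
move=> sf cm; have [v <-] := vco_surj hA cm w.
apply: etrans (esym (cco_apply hA cm _ v)) _.
exact: (ddiff_coord hA v (is_openT hA) I sf cm).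
Qed.

Section OneBundle.
Context {F : vbundle M} (hF : is_vbundle F).

Definition secfun (s : section F) (t : tidx F) (c : cidx M) :
  'rV[R]_(mdim M) -> 'rV[R]_(rank F) := (fun q => triv t (s q)) \o chart_inv c.

Lemma smoothM_sec (s : section F) t : smoothM (tdom t) (fun q => triv t (s q)).
Proof. by have := section_smoothS hA hF s setT t; rewrite setTI. Qed.

Lemma secfun_differentiable (s : section F) t c m : cdom c m -> tdom t m ->
  differentiable (secfun s t c) (chart c m).
Proof. by move=> cm tm; exact: (smoothM_differentiable (smoothM_sec s t) tm cm). Qed.

Context (f : M -> R) (s1 s2 s : section F) (sf : smoothM setT f).
Context (sE : forall q, s q = f q *: s1 q + s2 q).
Context (t : tidx F) (c : cidx M) (m : M) (cm : cdom c m) (tm : tdom t m).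

(** One identity for additivity ([f] constant) and for the Leibniz rule; the
    following lemmas have the same form. *)
Lemma diff_secfun v :
  'd (secfun s t c) (chart c m) v =
  'd (f \o chart_inv c) (chart c m) v *: triv t (s1 m) +
  f m *: 'd (secfun s1 t c) (chart c m) v + 'd (secfun s2 t c) (chart c m) v.
Proof.
have d0 := smoothM_differentiable sf I cm.
have d1 := secfun_differentiable s1 cm tm.
have d2 := secfun_differentiable s2 cm tm.
have [d3 E3] := diff_scale v d0 d1.
have e1 : secfun s1 t c (chart c m) = triv t (s1 m) by rewrite /secfun /= (atlasK hA cm).
have e2 : (f \o chart_inv c) (chart c m) = f m by rewrite /= (atlasK hA cm).
apply: etrans (near_eq_diff (g := (fun x => (f \o chart_inv c) x *: secfun s1 t c x) +
  secfun s2 t c) v (secfun_differentiable s cm tm) _) _.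
  have oN : is_open (tdom t) by exact: tdom_open.
  apply: (near_chart (c := c) oN tm cm) => q tq cq.
  rewrite /secfun /= fctE /= (atlasK hA cq) sE.
  by rewrite (trivP hF _ _ _ tq).
apply: etrans (diffD_apply v d3 d2) _; apply: (congr1 (fun z => z + _)).
apply: etrans E3 _.
exact: (congr2 (fun p q => _ *: p + q *: _) e1 e2).
Qed.

Lemma codiff_secfun u :
  codiff (secfun s t c) (chart c m) u =
  dot u (triv t (s1 m)) *: @cco R M c m (ddiff f m) +
  f m *: codiff (secfun s1 t c) (chart c m) u + codiff (secfun s2 t c) (chart c m) u.
Proof.
apply: dot_ext => w; apply: etrans (dot_codiff _ _ _ _) _.
apply: etrans (congr1 (dot u) (diff_secfun w)) _.
apply: etrans (dotDr _ _ _) (esym (etrans (dotDr _ _ _) _)).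
apply: congr2 (dot_codiff _ _ _ _).
apply: etrans (dotDr _ _ _) (esym (etrans (dotDr _ _ _) _)).
apply: (congr2 +%R).
  apply: etrans (dotZr _ _ _) (esym (etrans (dotZr _ _ _) _)).
  by rewrite mulrC; apply: (congr1 (fun z => z * _)); exact: (dot_ddiff w sf cm).
apply: etrans (dotZr _ _ _) (esym (etrans (dotZr _ _ _) _)).
by apply: (congr1 (fun z => _ * z)); exact: dot_codiff.
Qed.

End OneBundle.
End SectionCalculus.

Section Base.
Context {R : realType} {M : atlas_space R} {E : vbundle M}.
Context (hA : is_atlas M) (hE : is_vbundle E).
Let hT : is_atlas (tot E) := tot_atlas hA hE.
Let hTM : is_vbundle (tbundle M) := tbundle_vbundle hA.
Let hCM : is_vbundle (cotbundle M) := dual_vbundle hA hTM.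
Let hD : is_vbundle (dual_bundle E) := dual_vbundle hA hE.

Lemma anchor_vbundle : is_vbundle (anchorB E).
Proof. exact: whitney_vbundle. Qed.

Lemma core_vbundle : is_vbundle (coreB E).
Proof. exact: whitney_vbundle. Qed.

Lemma big_vbundle : is_vbundle (bigB E).
Proof.
apply: (whitney_vbundle hT); first exact: tbundle_vbundle.
exact: (dual_vbundle hT (tbundle_vbundle hT)).
Qed.

Lemma smoothS_anchor1 (nu : section (anchorB E)) :
  smoothS setT (fun m => (nu m).1 : fib (tbundle M) m).
Proof.
apply: (smoothS_fst hA hTM hD (is_openT hA)).
exact: (section_smoothS hA anchor_vbundle nu).
Qed.

Lemma smoothS_anchor2 (nu : section (anchorB E)) :
  smoothS setT (fun m => (nu m).2 : fib (dual_bundle E) m).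
Proof.
apply: (smoothS_snd hA hTM hD (is_openT hA)).
exact: (section_smoothS hA anchor_vbundle nu).
Qed.

Lemma smoothS_core1 (tau : section (coreB E)) :
  smoothS setT (fun m => (tau m).1 : fib E m).
Proof.
apply: (smoothS_fst hA hE hCM (is_openT hA)).
exact: (section_smoothS hA core_vbundle tau).
Qed.

Lemma smoothS_core2 (tau : section (coreB E)) :
  smoothS setT (fun m => (tau m).2 : fib (cotbundle M) m).
Proof.
apply: (smoothS_snd hA hE hCM (is_openT hA)).
exact: (section_smoothS hA core_vbundle tau).
Qed.

Definition anchor1 nu : section (tbundle M) := mk_section hA hTM (smoothS_anchor1 nu).
Definition anchor2 nu : section (dual_bundle E) := mk_section hA hD (smoothS_anchor2 nu).
Definition core1 tau : section E := mk_section hA hE (smoothS_core1 tau).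
Definition core2 tau : section (cotbundle M) := mk_section hA hCM (smoothS_core2 tau).

Definition core_pair (e : section E) (th : section (cotbundle M)) : section (coreB E) :=
  mk_section hA core_vbundle (smoothS_whitney hA hE hCM (is_openT hA)
    (section_smoothS hA hE e setT) (section_smoothS hA hCM th setT)).

Definition zero_section (F : vbundle M) (hF : is_vbundle F) : section F :=
  mk_section hA hF (smoothS_0 hA hF (is_openT hA)).

(** The lift of [nu] along [e] that the two sections define by themselves; the
    connection measures its difference with a splitting. *)
Definition base (nu : section (anchorB E)) (e : section E) (m : M) :
    fib (bigB E) (tot_pt (e m)) :=
  (tmap (fun p => tot_pt (e p)) m (nu m).1,
   ddiff (ell (fun p => (nu p).2)) (tot_pt (e m))).

Section AtPoint.
Context (c : cidx M) (t : tidx E) (m : M) (cm : cdom c m) (tm : tdom t m).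
Context (nu : section (anchorB E)) (e : section E).

Let vcoE_base : @vcoE R M E c t m (e m) (base nu e m).1 =
  row_mx (@vco R M c m (nu m).1)
    ('d (secfun e t c) (chart c m) (@vco R M c m (nu m).1)).
Proof. exact: (vcoE_section hA hE cm tm e (nu m).1). Qed.

Let ccoE_base : @ccoE R M E c t m (e m) (base nu e m).2 =
  row_mx (codiff (secfun (anchor2 nu) t c) (chart c m) (triv t (e m)))
    (@dco R M E t m (nu m).2).
Proof. exact: (ccoE_ell hA hE cm tm (anchor2 nu) (e m)). Qed.

Lemma vert_base : vert c t (base nu e m) =
  'd (secfun e t c) (chart c m) (@vco R M c m (nu m).1).
Proof. by apply: etrans (congr1 rsubmx vcoE_base) _; rewrite row_mxKr. Qed.

Lemma horz_base : horz c t (base nu e m) =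
  codiff (secfun (anchor2 nu) t c) (chart c m) (triv t (e m)).
Proof. by apply: etrans (congr1 lsubmx ccoE_base) _; rewrite row_mxKl. Qed.

Lemma Phi_base : Phi (e m) (base nu e m) = nu m.
Proof.
apply: (Phi_eq hA hE cm tm).
- by apply: etrans (congr1 lsubmx vcoE_base) _; rewrite row_mxKl.
- by apply: etrans (congr1 rsubmx ccoE_base) _; rewrite row_mxKr.
Qed.

End AtPoint.

(** The inverse of [core_lift] on the kernel of [Phi], written down in the
    preferred chart and trivialization. *)
Definition core_of (m : M) (e : fib E m) (x : fib (bigB E) (tot_pt e)) : fib (coreB E) m :=
  let c := chart_at m in let t := triv_at E m in
  (trivI t m (vert c t x), @trivI _ _ (cotbundle M) c m (horz c t x)).

Lemma core_ofK (m : M) (e : fib E m) (x : fib (bigB E) (tot_pt e)) :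
  Phi e x = 0 -> core_lift (core_of x) e = x.
Proof.
move=> x0; have cm : cdom (chart_at m) m := atlas_at hA m.
have tm : tdom (triv_at E m) m := triv_at_dom hE m.
apply: (big_ext hA hE cm tm).
- by rewrite (Phi_core hA hE cm tm) x0.
- rewrite (vert_core hA hE cm tm); exact: (trivIK hE tm).
- rewrite (horz_core hA hE cm tm); exact: (trivIK hCM cm).
Qed.

Lemma core_ext (c : cidx M) (t : tidx E) (m : M) (tau tau' : fib (coreB E) m) :
  cdom c m -> tdom t m -> triv t tau.1 = triv t tau'.1 ->
  @cco R M c m tau.2 = @cco R M c m tau'.2 -> tau = tau'.
Proof.
move=> cm tm h1 h2; have E1 := triv_inj hE tm h1; have E2 := cco_ext hA cm h2.
by move: tau tau' E1 E2 {h1 h2} => [a b] [a' b'] /= -> ->.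
Qed.

Lemma core_lift_inj (m : M) (e : fib E m) (tau tau' : fib (coreB E) m) :
  core_lift tau e = core_lift tau' e -> tau = tau'.
Proof.
move=> H; have cm : cdom (chart_at m) m := atlas_at hA m.
have tm : tdom (triv_at E m) m := triv_at_dom hE m.
apply: (core_ext cm tm).
- by rewrite -!(vert_core hA hE cm tm _ e) H.
- by rewrite -!(horz_core hA hE cm tm _ e) H.
Qed.

Lemma smoothS_core (N : set M) (s : forall m, fib (coreB E) m) c t : is_open N ->
  N `<=` cdom c `&` tdom t -> smoothM N (fun m => triv t (s m).1) ->
  smoothM N (fun m => @cco R M c m (s m).2) -> smoothS N s.
Proof.
move=> oN sN s1 s2; apply: (@smoothS_triv R M (coreB E) hA core_vbundle N (t, c)) => //.
  by move=> q /sN [cq tq]; split.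
exact: (smoothM_row_mx oN s1 s2).
Qed.

End Base.

Section Delta.
Context {R : realType} {M : atlas_space R} {E : vbundle M}.
Context (hA : is_atlas M) (hE : is_vbundle E).
Let hT : is_atlas (tot E) := tot_atlas hA hE.
Let hTM : is_vbundle (tbundle M) := tbundle_vbundle hA.
Let hCM : is_vbundle (cotbundle M) := dual_vbundle hA hTM.
Let hD : is_vbundle (dual_bundle E) := dual_vbundle hA hE.

Context (Sg : linear_splitting E).
Local Notation S m nu e := (@splitting_map R M E Sg m nu e).

Section AtPoint.
Context (c : cidx M) (t : tidx E) (m : M) (cm : cdom c m) (tm : tdom t m).
Implicit Types (nu : fib (anchorB E) m) (e : fib E m).

Lemma vert_linl a nu nu' e : vert c t (S m (a *: nu + nu') e) =
  a *: vert c t (S m nu e) + vert c t (S m nu' e).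
Proof. by rewrite splitting_linear_E (vertP hA hE cm tm). Qed.

Lemma horz_linl a nu nu' e : horz c t (S m (a *: nu + nu') e) =
  a *: horz c t (S m nu e) + horz c t (S m nu' e).
Proof. by rewrite splitting_linear_E (horzP hA hE cm tm). Qed.

Let add nu e e' :
  vert c t (S m nu (e + e')) = vert c t (S m nu e) + vert c t (S m nu e') /\
  horz c t (S m nu (e + e')) = horz c t (S m nu e) + horz c t (S m nu e').
Proof.
apply: (splitting_add_coord hA hE cm tm (x := S m nu e) (x' := S m nu e') _ _).1.
- by rewrite !splitting_Phi.
- by rewrite !splitting_Phi.
- exact: splitting_addTM.
Qed.

Let scale a nu e :
  vert c t (S m nu (a *: e)) = a *: vert c t (S m nu e) /\
  horz c t (S m nu (a *: e)) = a *: horz c t (S m nu e).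
Proof.
apply: (splitting_scale_coord hA hE cm tm (a := a) (x := S m nu e) _).1.
- by rewrite !splitting_Phi.
- exact: splitting_scaleTM.
Qed.

Lemma vert_linr a nu e e' : vert c t (S m nu (a *: e + e')) =
  a *: vert c t (S m nu e) + vert c t (S m nu e').
Proof. by rewrite (add nu (a *: e) e').1 (scale a nu e).1. Qed.

Lemma horz_linr a nu e e' : horz c t (S m nu (a *: e + e')) =
  a *: horz c t (S m nu e) + horz c t (S m nu e').
Proof. by rewrite (add nu (a *: e) e').2 (scale a nu e).2. Qed.

Lemma vert_S0 nu : vert c t (S m nu 0) = 0.
Proof. by have [+ _] := scale 0 nu 0; rewrite scaler0 scale0r. Qed.

Lemma horz_S0 nu : horz c t (S m nu 0) = 0.
Proof. by have [_ +] := scale 0 nu 0; rewrite scaler0 scale0r. Qed.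

End AtPoint.

(** Composition of the splitting with the section [(nu, e)], seen through its
    smooth coordinates. *)
Lemma smooth_splitting_along (nu : section (anchorB E)) (e : section E) c t :
  let N := cdom c `&` tdom t in
  smoothM N (fun m => vert c t (S m (nu m) (e m))) /\
  smoothM N (fun m => horz c t (S m (nu m) (e m))).
Proof.
move=> N; have oN := is_open_dom hA hE c t.
have hW : is_vbundle (whitney (anchorB E) E) := whitney_vbundle hA (anchor_vbundle hA hE) hE.
have hTW := tot_atlas hA hW.
have hB := big_vbundle hA hE.
have s1 : @smoothS R M (whitney (anchorB E) E) setT (fun m => (nu m, e m)).
  apply: (smoothS_whitney hA (anchor_vbundle hA hE) hE (is_openT hA)).
    exact: (section_smoothS hA (anchor_vbundle hA hE)).
  exact: (section_smoothS hA hE).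
have s2 := (smoothS_smooth_map hA hW _).1 s1.
have s3 := smooth_map_comp hA hTW (tot_atlas hT hB) s2 (splitting_smooth Sg).
have [oN' _ s4] := @smooth_from_tot _ _ _ hT hB _ hA _ ((c, t) : cidx (tot E))
  (((c, t), (c, t)) : tidx (bigB E)) s3.
set N' := _ @^-1` _ in oN' s4.
have NN' : N `<=` N' by move=> q [cq tq].
have {}s4 := smoothM_S NN' s4.
split.
- have s5 := smoothM_clin oN (clin_lsubmx _ _) s4.
  apply: (smoothM_eq hA oN _ (smoothM_clin oN (clin_rsubmx (mdim M) (rank E)) s5)).
  by move=> q Nq /=; rewrite row_mxKl.
- have s5 := smoothM_clin oN (clin_rsubmx _ _) s4.
  apply: (smoothM_eq hA oN _ (smoothM_clin oN (clin_lsubmx (mdim M) (rank E)) s5)).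
  by move=> q Nq /=; rewrite row_mxKr.
Qed.

Local Opaque vert horz vcoE ccoE.

(** The splitting formula solved for the connection, plus the Lie derivative of
    the form part of [tau]. *)
Definition delta_pt (nu : section (anchorB E)) (tau : section (coreB E)) (m : M) :
    fib (coreB E) m :=
  core_of (base nu (core1 hA hE tau) m - S m (nu m) (tau m).1) +
  (0, lie_form (fun p => (nu p).1) (fun p => (tau p).2) m).

Lemma Phi_base_sub nu (e : section E) m :
  Phi (e m) (base nu e m - S m (nu m) (e m)) = 0.
Proof.
have cm : cdom (chart_at m) m := atlas_at hA m.
have tm : tdom (triv_at E m) m := triv_at_dom hE m.
rewrite -scaleN1r addrC (PhiP hA hE cm tm) (Phi_base hA hE cm tm) splitting_Phi.
by rewrite scaleN1r addNr.
Qed.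

Section DeltaCoord.
Context (c : cidx M) (t : tidx E) (m : M) (cm : cdom c m) (tm : tdom t m).

Lemma vert_sub (e : fib E m) (x y : fib (bigB E) (tot_pt e)) :
  @vert R M E c t m e (x - y) = @vert R M E c t m e x - @vert R M E c t m e y.
Proof.
by rewrite addrC -scaleN1r (vertP hA hE cm tm) scaleN1r addrC.
Qed.

Lemma horz_sub (e : fib E m) (x y : fib (bigB E) (tot_pt e)) :
  @horz R M E c t m e (x - y) = @horz R M E c t m e x - @horz R M E c t m e y.
Proof.
by rewrite addrC -scaleN1r (horzP hA hE cm tm) scaleN1r addrC.
Qed.

Lemma core_of_vert (e : fib E m) (x : fib (bigB E) (tot_pt e)) : Phi e x = 0 ->
  triv t (core_of x).1 = @vert R M E c t m e x.
Proof.
by move=> x0; rewrite -(vert_core hA hE cm tm _ e) (core_ofK hA hE x0).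
Qed.

Lemma core_of_horz (e : fib E m) (x : fib (bigB E) (tot_pt e)) : Phi e x = 0 ->
  @cco R M c m (core_of x).2 = @horz R M E c t m e x.
Proof.
by move=> x0; rewrite -(horz_core hA hE cm tm _ e) (core_ofK hA hE x0).
Qed.

Lemma delta_vert nu tau : triv t (delta_pt nu tau m).1 =
  'd (secfun (core1 hA hE tau) t c) (chart c m) (@vco R M c m (nu m).1) -
  vert c t (S m (nu m) (tau m).1).
Proof.
have P := Phi_base_sub nu (core1 hA hE tau) m.
have E1 : (delta_pt nu tau m).1 =
  (core_of (base nu (core1 hA hE tau) m - S m (nu m) (tau m).1)).1 := addr0 _.
apply: etrans (congr1 (@triv R M E t m) E1) _.
apply: etrans (core_of_vert P) _.
apply: etrans (vert_sub _ _) _.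
exact: (congr1 (fun z => z - _) (vert_base hA hE cm tm nu (core1 hA hE tau))).
Qed.

Lemma delta_horz nu tau : @cco R M c m (delta_pt nu tau m).2 =
  (codiff (secfun (anchor2 hA hE nu) t c) (chart c m) (triv t (tau m).1) -
   horz c t (S m (nu m) (tau m).1)) +
  ('d (secfun (core2 hA hE tau) c c) (chart c m) (@vco R M c m (nu m).1) +
   codiff (secfun (anchor1 hA hE nu) c c) (chart c m) (@cco R M c m (tau m).2)).
Proof.
have P := Phi_base_sub nu (core1 hA hE tau) m.
have ccoD (a b : 'Hom(tspace m, R^o)) : cco c (a + b) = cco c a + cco c b.
  by rewrite -[a in LHS]scale1r (ccoP hA cm) scale1r.
have E2 : (delta_pt nu tau m).2 =
  (core_of (base nu (core1 hA hE tau) m - S m (nu m) (tau m).1)).2 +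
  lie_form (fun p => (nu p).1) (fun p => (tau p).2) m := erefl.
apply: etrans (congr1 (fun th => @cco R M c m th) E2) _.
apply: etrans (ccoD _ _) _; apply: congr2.
  apply: etrans (core_of_horz P) _; apply: etrans (horz_sub _ _) _.
  exact: (congr1 (fun z => z - _) (horz_base hA hE cm tm nu (core1 hA hE tau))).
exact: (cco_lie_form hA (anchor1 hA hE nu) (core2 hA hE tau) cm).
Qed.

End DeltaCoord.

Lemma delta_smooth nu tau : smoothS setT (delta_pt nu tau).
Proof.
apply: (smoothS_local) => m _.
set c := chart_at m; set t := triv_at E m; pose N := cdom c `&` tdom t.
have oN := is_open_dom hA hE c t.
have Nm : N m by split; [exact: (atlas_at hA) | exact: (triv_at_dom hE)].
exists N; split; first exact: Nm.
have Nc : N `<=` cdom c by move=> q [].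
have Nt : N `<=` tdom t by move=> q [].
have se := smoothM_S Nt (smoothM_sec hA hE (core1 hA hE tau) t).
have seps := smoothM_S Nt (smoothM_sec hA hD (anchor2 hA hE nu) t).
have sX := smoothM_S Nc (smoothM_sec hA hTM (anchor1 hA hE nu) c).
have sth := smoothM_S Nc (smoothM_sec hA hCM (core2 hA hE tau) c).
have [sv sh] := smooth_splitting_along nu (core1 hA hE tau) c t.
apply: (smoothS_core hA hE (c := c) (t := t) oN).
- by move=> q.
- apply: (smoothM_eq hA oN _ (smoothM_D oN (smoothM_diff hA oN Nc se sX) (smoothM_N oN sv))).
  by move=> q [cq tq]; rewrite (delta_vert cq tq).
- have s1 := smoothM_D oN (smoothM_codiff hA oN Nc seps se) (smoothM_N oN sh).
  have s2 := smoothM_D oN (smoothM_diff hA oN Nc sth sX) (smoothM_codiff hA oN Nc sX sth).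
  apply: (smoothM_eq hA oN _ (smoothM_D oN s1 s2)).
  by move=> q [cq tq]; rewrite (delta_horz cq tq).
Qed.

Definition delta : preconnection E :=
  fun nu tau => mk_section hA (core_vbundle hA hE) (delta_smooth nu tau).

(** ** The axioms of a Dorfman connection *)

(** The defects [eps(e) df] of the horizontal part of [base] and [theta(X) df] of the Lie
    derivative add up to the pairing of [nu] with [tau]. *)
Lemma delta_left (f : M -> R) (nu1 nu2 nu : section (anchorB E)) tau m :
  smoothM setT f -> (forall q, nu q = f q *: nu1 q + nu2 q) ->
  delta nu tau m = f m *: delta nu1 tau m + delta nu2 tau m +
    pairing (nu1 m) (tau m) *: (0, ddiff f m).
Proof.
move=> sf nuE; set c := chart_at m; set t := triv_at E m.
have cm : cdom c m := atlas_at hA m.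
have tm : tdom t m := triv_at_dom hE m.
have n1E q : anchor1 hA hE nu q = f q *: anchor1 hA hE nu1 q + anchor1 hA hE nu2 q.
  by rewrite /= nuE.
have n2E q : anchor2 hA hE nu q = f q *: anchor2 hA hE nu1 q + anchor2 hA hE nu2 q.
  by rewrite /= nuE.
have vE : @vco R M c m (nu m).1 = f m *: @vco R M c m (nu1 m).1 + @vco R M c m (nu2 m).1.
  by rewrite -(vcoP hA cm) nuE.
apply: (core_ext hA hE cm tm).
- apply: etrans (delta_vert cm tm nu tau) _.
  apply: etrans _ (esym (congr1 (@triv R M E t m) (congr1 (fun z => _ + z) (scaler0 _ _)))).
  apply: etrans _ (esym (etrans (congr1 (@triv R M E t m) (addr0 _)) (trivP hE _ _ _ tm))).
  apply: etrans _ (esym (congr2 (fun p q => f m *: p + q)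
    (delta_vert cm tm nu1 tau) (delta_vert cm tm nu2 tau))).
  have H1 := etrans (congr1 ('d (secfun (core1 hA hE tau) t c) (chart c m)) vE)
    (diff_linear _ _ _ _ _).
  have H2 := etrans (congr1 (fun z => vert c t (S m z (tau m).1)) (nuE m))
    (vert_linl cm tm _ _ _ _).
  apply: etrans (congr2 (fun p q => p - q) H1 H2) _.
  by rewrite scalerBr opprD addrACA.
- apply: etrans (delta_horz cm tm nu tau) _.
  have -> : (f m *: delta nu1 tau m + delta nu2 tau m +
    pairing (nu1 m) (tau m) *: ((0, ddiff f m) : fib (coreB E) m)).2 =
    pairing (nu1 m) (tau m) *: ddiff f m +
      (f m *: (delta nu1 tau m).2 + (delta nu2 tau m).2) by rewrite addrC.
  apply: etrans _ (esym (etrans (ccoP hA cm _ _ _)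
    (congr1 (fun z => _ + z) (ccoP hA cm _ _ _)))).
  apply: etrans _ (esym (congr2 (fun p q => _ + (f m *: p + q))
    (delta_horz cm tm nu1 tau) (delta_horz cm tm nu2 tau))).
  have H1 := codiff_secfun hA hD sf n2E cm tm (triv t (tau m).1).
  have H2 := codiff_secfun hA hTM sf n1E cm cm (@cco R M c m (tau m).2).
  have H3 := etrans (congr1 ('d (secfun (core2 hA hE tau) c c) (chart c m)) vE)
    (diff_linear _ _ _ _ _).
  have H4 := etrans (congr1 (fun z => horz c t (S m z (tau m).1)) (nuE m))
    (horz_linl cm tm _ _ _ _).
  apply: etrans (congr2 +%R (congr2 (fun p q => p - q) H1 H4) (congr2 +%R H3 H2)) _.
  have P : pairing (nu1 m) (tau m) = dot (triv t (tau m).1) (@dco R M E t m (nu1 m).2) +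
      dot (@cco R M c m (tau m).2) (@vco R M c m (nu1 m).1).
    by rewrite /pairing (dco_apply hE tm) (cco_apply hA cm) [in X in _ + X]dotC.
  have alg n (k p q : R) (d a a' b b' x x' y y' : 'rV[R]_n) :
      (p *: d + k *: a + a' - (k *: b + b')) + ((k *: x + x') + (q *: d + k *: y + y')) =
      (p + q) *: d + (k *: ((a - b) + (x + y)) + ((a' - b') + (x' + y'))).
    by apply/rowP => i; rewrite !mxE; ring.
  apply: etrans (alg _ _ _ _ _ _ _ _ _ _ _ _ _) _.
  exact: (congr1 (fun z => z *: _ + _) (esym P)).
Qed.

(** The vertical part of [base] produces [X(f) e], the Lie derivative produces
    [X(f) theta]. *)
Lemma delta_right (f : M -> R) nu (tau1 tau2 tau : section (coreB E)) m :
  smoothM setT f -> (forall q, tau q = f q *: tau1 q + tau2 q) ->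
  delta nu tau m = (ddiff f m (nu m).1 : R) *: tau1 m +
    (f m *: delta nu tau1 m + delta nu tau2 m).
Proof.
move=> sf tauE; set c := chart_at m; set t := triv_at E m.
have cm : cdom c m := atlas_at hA m.
have tm : tdom t m := triv_at_dom hE m.
have c1E q : core1 hA hE tau q = f q *: core1 hA hE tau1 q + core1 hA hE tau2 q.
  by rewrite /= tauE.
have c2E q : core2 hA hE tau q = f q *: core2 hA hE tau1 q + core2 hA hE tau2 q.
  by rewrite /= tauE.
have t1E : (tau m).1 = f m *: (tau1 m).1 + (tau2 m).1 by rewrite tauE.
have t2E : (tau m).2 = f m *: (tau1 m).2 + (tau2 m).2 by rewrite tauE.
have dfE : 'd (f \o chart_inv c) (chart c m) (@vco R M c m (nu m).1) =
    ddiff f m (nu m).1.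
  apply: etrans (esym (dot_ddiff hA _ sf cm)) _.
  exact: (esym (cco_apply hA cm _ _)).
apply: (core_ext hA hE cm tm).
- apply: etrans (delta_vert cm tm nu tau) _.
  apply: etrans _ (esym (etrans (trivP hE _ _ _ tm)
    (congr1 (fun z => _ + z) (trivP hE _ _ _ tm)))).
  apply: etrans _ (esym (congr2 (fun p q => _ + (f m *: p + q))
    (delta_vert cm tm nu tau1) (delta_vert cm tm nu tau2))).
  have H1 := diff_secfun hA hE sf c1E cm tm (@vco R M c m (nu m).1).
  have H2 := etrans (congr1 (fun z => vert c t (S m (nu m) z)) t1E)
    (vert_linr cm tm _ _ _ _).
  apply: etrans (congr2 (fun p q => p - q) H1 H2) _.
  have alg n (k p : R) (d a a' b b' : 'rV[R]_n) :
      p *: d + k *: a + a' - (k *: b + b') = p *: d + (k *: (a - b) + (a' - b')).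
    by apply/rowP => i; rewrite !mxE; ring.
  apply: etrans (alg _ _ _ _ _ _ _ _) _.
  exact: (congr1 (fun z => z *: _ + _) dfE).
- apply: etrans (delta_horz cm tm nu tau) _.
  apply: etrans _ (esym (etrans (ccoP hA cm _ _ _)
    (congr1 (fun z => _ + z) (ccoP hA cm _ _ _)))).
  apply: etrans _ (esym (congr2 (fun p q => _ + (f m *: p + q))
    (delta_horz cm tm nu tau1) (delta_horz cm tm nu tau2))).
  have H1 := etrans (congr1 (codiff (secfun (anchor2 hA hE nu) t c) (chart c m))
    (etrans (congr1 (@triv R M E t m) t1E) (trivP hE _ _ _ tm))) (codiffP _ _ _ _ _).
  have H2 := etrans (congr1 (codiff (secfun (anchor1 hA hE nu) c c) (chart c m))
    (etrans (congr1 (@cco R M c m) t2E) (ccoP hA cm _ _ _))) (codiffP _ _ _ _ _).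
  have H3 := diff_secfun hA hCM sf c2E cm cm (@vco R M c m (nu m).1).
  have H4 := etrans (congr1 (fun z => horz c t (S m (nu m) z)) t1E)
    (horz_linr cm tm _ _ _ _).
  apply: etrans (congr2 +%R (congr2 (fun p q => p - q) H1 H4) (congr2 +%R H3 H2)) _.
  have alg n (k p : R) (d a a' b b' x x' y y' : 'rV[R]_n) :
      (k *: a + a' - (k *: b + b')) + ((p *: d + k *: x + x') + (k *: y + y')) =
      p *: d + (k *: ((a - b) + (x + y)) + ((a' - b') + (x' + y'))).
    by apply/rowP => i; rewrite !mxE; ring.
  apply: etrans (alg _ _ _ _ _ _ _ _ _ _ _ _) _.
  exact: (congr1 (fun z => z *: _ + _) dfE).
Qed.

(** The value of the splitting on a zero vector of [E] has no vertical and no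
    horizontal part, and neither has [base] along the zero section; only the Lie
    derivative remains. *)
Lemma delta_form nu (th : section (cotbundle M)) (tau : section (coreB E)) m :
  (forall q, tau q = (0, th q)) ->
  delta nu tau m = (0, lie_form (fun p => (nu p).1) th m).
Proof.
move=> tauE; set c := chart_at m; set t := triv_at E m.
have cm : cdom c m := atlas_at hA m.
have tm : tdom t m := triv_at_dom hE m.
have t10 : (tau m).1 = 0 by rewrite tauE.
have D0 v : 'd (secfun (core1 hA hE tau) t c) (chart c m) v = 0.
  have n0 : {near chart c m, (fun=> 0) =1 secfun (core1 hA hE tau) t c}.
    apply: (near_chart (c := c) (tdom_open hE t) tm cm) => q tq cq.
    by rewrite /secfun /= (atlasK hA cq) tauE /= (triv0 hE).
  have d0 : differentiable (fun=> 0 : 'rV[R]_(rank E)) (chart c m).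
    exact: differentiable_cst.
  apply: etrans (esym (near_eq_diff v d0 n0)) _.
  exact: (congr1 (fun h => h v) (diff_cst 0 (chart c m))).
have c2 : core2 hA hE tau = th by apply: section_eq => q; rewrite /= tauE.
apply: (core_ext hA hE cm tm).
- apply: etrans (delta_vert cm tm nu tau) _.
  apply: etrans (congr2 (fun p q => p - q) (D0 _) (etrans (congr1 (fun z => vert c t (S m (nu m) z)) t10)
    (vert_S0 cm tm _))) _.
  by rewrite subr0 (triv0 hE tm).
- apply: etrans (delta_horz cm tm nu tau) _.
  have H1 : codiff (secfun (anchor2 hA hE nu) t c) (chart c m) (triv t (tau m).1) = 0.
    apply: etrans (congr1 (codiff _ _) (etrans (congr1 (@triv R M E t m) t10) (triv0 hE tm))) _.
    by apply: dot_ext => w; apply: etrans (dot_codiff _ _ _ _) _; rewrite dot0l dot0r.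
  have H2 := etrans (congr1 (fun z => horz c t (S m (nu m) z)) t10)
    (horz_S0 cm tm (nu m)).
  apply: etrans (congr1 (fun z => z + _) (congr2 (fun p q => p - q) H1 H2)) _.
  apply: etrans (congr1 (fun z => z + _) (subr0 0)) (etrans (add0r _) _).
  apply: etrans _ (esym (cco_lie_form hA (anchor1 hA hE nu) th cm)).
  have t2E : (tau m).2 = th m by rewrite tauE.
  by rewrite c2 t2E; exact: erefl.
Qed.

End Delta.

Section LieExact.
Context {R : realType} {M : atlas_space R} (hA : is_atlas M).
Let hTM : is_vbundle (tbundle M) := tbundle_vbundle hA.

Lemma ddiff_fun_smooth (f : M -> R) (X : section (tbundle M)) :
  smoothM setT f -> smoothM setT (fun p => ddiff f p (X p) : R).
Proof.
move=> sf; apply: smoothM_local => m _; set c := chart_at m.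
have cm : cdom c m := atlas_at hA m.
have oN := is_open_cdom hA c.
exists (cdom c); split=> //.
have sc : smoothM (cdom c) f by exact: smoothM_S sf.
apply: (smoothM_eq hA oN _ (smoothM_diff hA oN (@subset_refl _ _) sc (smoothM_vco hA X c))).
by move=> q cq; rewrite (ddiff_coord hA (X q) (is_openT hA) I sf cq).
Qed.

(** In a chart the right-hand side is, by the Leibniz rule, a second derivative of
    [f] plus [df] applied to a derivative of [X]. The left-hand side has the same
    terms, with the two directions of the second derivative exchanged. *)
Lemma lie_form_exact (f : M -> R) (X : section (tbundle M)) (th : section (cotbundle M)) m :
  smoothM setT f -> (forall q, th q = ddiff f q) ->
  lie_form (fun p => X p) (fun p => th p) m = ddiff (fun p => ddiff f p (X p)) m.
Proof.
move=> sf thE; set c := chart_at m.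
have cm : cdom c m := atlas_at hA m.
have oc := is_open_cdom hA c.
set x := chart c m; pose F := f \o chart_inv c; pose U := chart c @` (cdom c `&` setT).
have oU : open U by exact: is_openT.
have Ux : U x by exists m.
have sF : smooth_on U F by exact: sf.
have dX : differentiable (vfun (fun p => X p) c) x.
  exact: (smoothM_differentiable (smoothM_vco hA X c) cm cm).
have dth : differentiable (cfun (fun p => th p) c) x.
  exact: (smoothM_differentiable (smoothM_cco hA th c) cm cm).
apply: (cco_ext hA cm); apply: dot_ext => w.
apply: etrans (congr1 (dot w) (cco_lie_form hA X th cm)) _.
apply: etrans (dotDr _ _ _) _.
apply: etrans _ (esym (dot_ddiff hA w (ddiff_fun_smooth X sf) cm)).
have X0 : vfun (fun p => X p) c x = @vco R M c m (X m) by exact: (vfunE hA).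
(* the right-hand side, by the Leibniz rule in the chart *)
have A1 : 'd ((fun p => ddiff f p (X p) : R) \o chart_inv c) x w =
    'd (fun y => 'd F y (vfun (fun p => X p) c x)) x w +
    'd F x ('d (vfun (fun p => X p) c) x w).
  apply: etrans _ (diff_moving w oU sF Ux dX).
  apply: near_eq_diff.
    exact: (smoothM_differentiable (ddiff_fun_smooth X sf) I cm).
  apply: (near_chart (c := c) oc cm cm) => q cq _.
  rewrite /vfun /= (atlasK hA cq) (ddiff_coord hA (X q) (is_openT hA) I sf cq).
  by [].
apply: etrans _ (esym A1); apply: (congr2 +%R).
- have [d1 D1] := diff_linl (@vco R M c m (X m)) (clin_dot w) dth.
  apply: etrans (esym D1) _.
  apply: etrans _ (diff_diff_comm _ _ (fin_dim_R (R := R)) oU sF Ux).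
  apply: etrans _ (congr1 (fun z => 'd (fun y => 'd F y w) x z) (esym X0)).
  apply: (near_eq_diff _ d1).
  apply: (near_chart (c := c) oc cm cm) => q cq _.
  rewrite /cfun /= (atlasK hA cq) thE.
  exact: (dot_ddiff hA w sf cq).
- apply: etrans (dot_codiff _ _ _ _) _; apply: etrans (dotC _ _) _.
  apply: etrans (congr1 (fun z => dot _ (@cco R M c m z)) (thE m)) _.
  exact: (dot_ddiff hA _ sf cm).
Qed.

End LieExact.

Section DorfmanOf.
Context {R : realType} {M : atlas_space R} {E : vbundle M}.
Context (hA : is_atlas M) (hE : is_vbundle E).
Let hTM : is_vbundle (tbundle M) := tbundle_vbundle hA.
Let hCM : is_vbundle (cotbundle M) := dual_vbundle hA hTM.
Let hN : is_vbundle (anchorB E) := anchor_vbundle hA hE.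
Let hC : is_vbundle (coreB E) := core_vbundle hA hE.

Local Opaque vert horz vcoE ccoE.

Lemma ddiff_cst (a : R) (m : M) : ddiff (fun=> a) m = 0.
Proof.
apply/lfunP => v; rewrite /ddiff lfunE zero_lfunE.
exact: (congr1 (fun h => h v) (diff_cst a _)).
Qed.

Context (Sg : linear_splitting E).
Local Notation delta := (delta hA hE Sg).

Lemma delta_bilinear : connection_bilinear delta.
Proof.
split=> [a nu1 nu2 nu tau nuE m|a nu tau1 tau2 tau tauE m].
- rewrite (delta_left hA hE Sg tau m (smoothM_cst setT a) nuE) ddiff_cst.
  by apply: etrans (congr1 (fun z => _ + z) (scaler0 _ _)) (addr0 _).
- rewrite (delta_right hA hE Sg nu m (smoothM_cst setT a) tauE) ddiff_cst.
  by rewrite zero_lfunE scale0r add0r.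
Qed.

Lemma bilinear0l (D : preconnection E) (nu : section (anchorB E)) tau m :
  connection_bilinear D -> (forall q, nu q = 0) -> D nu tau m = 0.
Proof.
move=> [Dl _] nu0.
apply: (@linear_sections0 _ _ _ _ (fun nu => D nu tau m) nu _ nu0).
by move=> a s1 s2 s sE; exact: Dl sE m.
Qed.

Lemma bilinear0r (D : preconnection E) nu (tau : section (coreB E)) m :
  connection_bilinear D -> (forall q, tau q = 0) -> D nu tau m = 0.
Proof.
move=> [_ Dr] tau0.
apply: (@linear_sections0 _ _ _ _ (fun tau => D nu tau m) tau _ tau0).
by move=> a s1 s2 s sE; exact: Dr sE m.
Qed.

(** The zero form is the differential of a constant function. *)
Lemma lie_form0 (X : section (tbundle M)) (th : section (cotbundle M)) m :
  (forall q, th q = 0) -> lie_form (fun p => X p) (fun p => th p) m = 0.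
Proof.
move=> th0.
have thE q : th q = ddiff (fun=> 0) q by rewrite th0 ddiff_cst.
rewrite (lie_form_exact hA X m (smoothM_cst setT 0) thE).
have -> : (fun p => ddiff (fun=> 0) p (X p) : R) = (fun=> 0).
  by apply/funext => p; rewrite ddiff_cst zero_lfunE.
exact: ddiff_cst.
Qed.

Lemma delta_dorfman_left (f : M -> R) (nu nu' : section (anchorB E))
    (tau : section (coreB E)) : smooth_fun f -> (forall m, nu' m = f m *: nu m) ->
  forall m, delta nu' tau m =
    f m *: delta nu tau m + pairing (nu m) (tau m) *: (0, ddiff f m).
Proof.
move=> /smooth_funP sf nuE m.
pose z := zero_section hA hN.
have E1 q : nu' q = f q *: nu q + z q by rewrite nuE /= addr0.
rewrite (delta_left hA hE Sg tau m sf E1).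
by rewrite (@bilinear0l delta z tau m delta_bilinear)// addr0.
Qed.

Lemma delta_dorfman_right (f : M -> R) (nu : section (anchorB E))
    (tau tau' : section (coreB E)) : smooth_fun f -> (forall m, tau' m = f m *: tau m) ->
  forall m, delta nu tau' m =
    f m *: delta nu tau m + (ddiff f m (nu m).1 : R) *: tau m.
Proof.
move=> /smooth_funP sf tauE m.
pose z := zero_section hA hC.
have E1 q : tau' q = f q *: tau q + z q by rewrite tauE /= addr0.
rewrite (delta_right hA hE Sg nu m sf E1).
by rewrite (@bilinear0r delta nu z m delta_bilinear)// addr0 addrC.
Qed.

Lemma delta_dorfman_exact (f : M -> R) (nu : section (anchorB E))
    (tau : section (coreB E)) : smooth_fun f -> (forall m, tau m = (0, ddiff f m)) ->
  forall m, delta nu tau m = (0, ddiff (fun p => ddiff f p (nu p).1) m).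
Proof.
move=> /smooth_funP sf tauE m.
have thE q : core2 hA hE tau q = ddiff f q by rewrite /= tauE.
have tauE' q : tau q = (0, core2 hA hE tau q) by rewrite thE.
rewrite (delta_form hA hE Sg nu m tauE'); congr pair.
exact: (lie_form_exact hA (anchor1 hA hE nu) m sf thE).
Qed.

Definition dorfman_of : dorfman E :=
  Dorfman delta_bilinear delta_dorfman_left delta_dorfman_right delta_dorfman_exact.

Lemma delta_splitting_formula : splitting_formula Sg delta.
Proof.
move=> nu e tau tauE m.
have eE : e = core1 hA hE tau by apply: section_eq => q; rewrite /= tauE.
rewrite eE.
have L0 : lie_form (fun p => (nu p).1) (fun p => (tau p).2) m = 0.
  apply: (lie_form0 (anchor1 hA hE nu) (th := core2 hA hE tau)) => q.
  by rewrite /= tauE.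
have D : delta nu tau m = core_of (base nu (core1 hA hE tau) m -
    @splitting_map R M E Sg m (nu m) (core1 hA hE tau m)).
  by rewrite /= /delta_pt L0; exact: addr0.
rewrite D (core_ofK hA hE (Phi_base_sub hA hE Sg nu (core1 hA hE tau) m)).
by rewrite -/(base nu (core1 hA hE tau) m) opprB addrC subrK.
Qed.

Lemma delta_lie_formula : lie_formula delta.
Proof. by move=> nu th tau tauE m; exact: (delta_form hA hE Sg nu m tauE). Qed.

(** A section of [E (+) T^*M] is the sum of a section of [E] and a 1-form: the
    two formulas determine a bilinear connection. *)
Lemma connection_unique (S : presplitting E) (D D' : preconnection E) :
  connection_bilinear D -> splitting_formula S D -> lie_formula D ->
  connection_bilinear D' -> splitting_formula S D' -> lie_formula D' -> D = D'.
Proof.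
move=> [_ Dr] Ds Dl [_ D'r] D's D'l; apply/funext => nu; apply/funext => tau.
apply: section_eq => m.
pose t1 := core_pair hA hE (core1 hA hE tau) (zero_section hA hCM).
pose t2 := core_pair hA hE (zero_section hA hE) (core2 hA hE tau).
have tE q : tau q = 1 *: t1 q + t2 q.
  rewrite scale1r /=; case: (tau q) => a b /=.
  by congr pair; [rewrite addr0 | rewrite add0r].
rewrite (Dr 1 nu t1 t2 tau tE m) (D'r 1 nu t1 t2 tau tE m); congr (_ *: _ + _).
- apply: (core_lift_inj hA hE (e := core1 hA hE tau m)).
  have E1 := Ds nu (core1 hA hE tau) t1 (fun q => erefl) m.
  have E2 := D's nu (core1 hA hE tau) t1 (fun q => erefl) m.
  exact: (oppr_inj (addrI _ (etrans (esym E1) E2))).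
- by rewrite (Dl nu (core2 hA hE tau) t2 (fun q => erefl) m)
    (D'l nu (core2 hA hE tau) t2 (fun q => erefl) m).
Qed.

Lemma dorfman_eq (D D' : dorfman E) : dorfman_map D = dorfman_map D' -> D = D'.
Proof.
case: D D' => [D a b c d] [D' a' b' c' d'] /= DD; subst D'.
by congr Dorfman; exact: Prop_irrelevance.
Qed.

Lemma splitting_eq (S S' : linear_splitting E) :
  splitting_map S = splitting_map S' -> S = S'.
Proof.
case: S S' => [S a b c d e] [S' a' b' c' d' e'] /= SS; subst S'.
by congr LinearSplitting; exact: Prop_irrelevance.
Qed.

End DorfmanOf.

(** * From Dorfman connections to splittings *)

Section SplittingOf.
Context {R : realType} {M : atlas_space R} {E : vbundle M}.
Context (hM : is_manifold M) (hE : is_vbundle E).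
Let hA : is_atlas M := manifold_atlas hM.
Let hT : is_atlas (tot E) := tot_atlas hA hE.
Let hTM : is_vbundle (tbundle M) := tbundle_vbundle hA.
Let hCM : is_vbundle (cotbundle M) := dual_vbundle hA hTM.
Let hD : is_vbundle (dual_bundle E) := dual_vbundle hA hE.
Let hN : is_vbundle (anchorB E) := anchor_vbundle hA hE.
Let hC : is_vbundle (coreB E) := core_vbundle hA hE.
Let hTE : is_vbundle (tbundle (tot E)) := tbundle_vbundle hT.
Let hCE : is_vbundle (cotbundle (tot E)) := dual_vbundle hT hTE.

Context (Df : dorfman E).
Local Notation D := (@dorfman_map R M E Df).

Let scaled (F : vbundle M) (hF : is_vbundle F) (f : M -> R) (sf : smoothM setT f)
    (s : section F) : section F :=
  mk_section hA hF (smoothS_Z hA hF (is_openT hA) sf (section_smoothS hA hF s setT)).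

(** The Leibniz axiom combined with additivity, which makes the case of constant
    [f] the bilinearity and avoids treating it apart. *)
Lemma dorfman_left_comb (f : M -> R) (nu1 nu2 nu : section (anchorB E)) tau m :
  smoothM setT f -> (forall q, nu q = f q *: nu1 q + nu2 q) ->
  D nu tau m = f m *: D nu1 tau m + pairing (nu1 m) (tau m) *: (0, ddiff f m) +
    D nu2 tau m.
Proof.
move=> sf nuE; have [Dl _] := dorfman_bilinear Df.
have E1 q : nu q = 1 *: scaled hN sf nu1 q + nu2 q by rewrite scale1r nuE.
rewrite (Dl 1 _ _ _ tau E1 m) scale1r; congr (_ + _).
by apply: (@dorfman_left R M E Df f nu1 (scaled hN sf nu1) tau ((smooth_funP f).2 sf)).
Qed.

Lemma dorfman_right_comb (f : M -> R) (nu : section (anchorB E))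
    (tau1 tau2 tau : section (coreB E)) m :
  smoothM setT f -> (forall q, tau q = f q *: tau1 q + tau2 q) ->
  D nu tau m = f m *: D nu tau1 m + (ddiff f m (nu m).1 : R) *: tau1 m + D nu tau2 m.
Proof.
move=> sf tauE; have [_ Dr] := dorfman_bilinear Df.
have E1 q : tau q = 1 *: scaled hC sf tau1 q + tau2 q by rewrite scale1r tauE.
rewrite (Dr 1 nu _ _ _ E1 m) scale1r; congr (_ + _).
by apply: (@dorfman_right R M E Df f nu tau1 (scaled hC sf tau1) ((smooth_funP f).2 sf)).
Qed.

Local Opaque vert horz vcoE ccoE.

Definition core_inl (e : section E) : section (coreB E) :=
  core_pair hA hE e (zero_section hA hCM).

Definition rhs (nu : section (anchorB E)) (e : section E) m : fib (bigB E) (tot_pt (e m)) :=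
  base nu e m - core_lift (D nu (core_inl e) m) (e m).

Section RhsCoord.
Context (c : cidx M) (t : tidx E) (m : M) (cm : cdom c m) (tm : tdom t m).

Lemma vert_rhs nu e : vert c t (rhs nu e m) =
  'd (secfun e t c) (chart c m) (@vco R M c m (nu m).1) - triv t (D nu (core_inl e) m).1.
Proof.
apply: etrans (vert_sub hA hE cm tm _ _) _.
exact: (congr2 (fun p q => p - q) (vert_base hA hE cm tm nu e) (vert_core hA hE cm tm _ _)).
Qed.

Lemma horz_rhs nu e : horz c t (rhs nu e m) =
  codiff (secfun (anchor2 hA hE nu) t c) (chart c m) (triv t (e m)) -
  @cco R M c m (D nu (core_inl e) m).2.
Proof.
apply: etrans (horz_sub hA hE cm tm _ _) _.
exact: (congr2 (fun p q => p - q) (horz_base hA hE cm tm nu e) (horz_core hA hE cm tm _ _)).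
Qed.

Lemma Phi_rhs nu (e : section E) : Phi (e m) (rhs nu e m) = nu m.
Proof.
rewrite /rhs addrC -scaleN1r (PhiP hA hE cm tm) (Phi_base hA hE cm tm).
by rewrite (Phi_core hA hE cm tm) scaler0 add0r.
Qed.

Let cancel_defect n (k p : R) (d a a' b b' : 'rV[R]_n) :
  p *: d + k *: a + a' - (p *: d + (k *: b + b')) = k *: (a - b) + (a' - b').
Proof. by apply/rowP => i; rewrite !mxE; ring. Qed.

(** Both first-order terms of the Leibniz rules cancel between [base] and the
    connection. *)
Lemma rhs_left (f : M -> R) (nu1 nu2 nu : section (anchorB E)) e :
  smoothM setT f -> (forall q, nu q = f q *: nu1 q + nu2 q) ->
  vert c t (rhs nu e m) = f m *: vert c t (rhs nu1 e m) + vert c t (rhs nu2 e m) /\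
  horz c t (rhs nu e m) = f m *: horz c t (rhs nu1 e m) + horz c t (rhs nu2 e m).
Proof.
move=> sf nuE.
have n2E q : anchor2 hA hE nu q = f q *: anchor2 hA hE nu1 q + anchor2 hA hE nu2 q.
  by rewrite /= nuE.
have vE : @vco R M c m (nu m).1 = f m *: @vco R M c m (nu1 m).1 + @vco R M c m (nu2 m).1.
  by rewrite -(vcoP hA cm) nuE.
have DE := dorfman_left_comb (core_inl e) m sf nuE.
have D1 : (D nu (core_inl e) m).1 = f m *: (D nu1 (core_inl e) m).1 + (D nu2 (core_inl e) m).1.
  apply: etrans (congr1 fst DE) (congr1 (fun z => z + _) _).
  exact: etrans (congr1 (fun z => _ + z) (scaler0 _ _)) (addr0 _).
have D2 : (D nu (core_inl e) m).2 = pairing (nu1 m) (core_inl e m) *: ddiff f m +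
    (f m *: (D nu1 (core_inl e) m).2 + (D nu2 (core_inl e) m).2).
  apply: etrans (congr1 snd DE) _.
  exact: etrans (congr1 (fun z => z + _) (addrC _ _)) (esym (addrA _ _ _)).
split.
- apply: etrans (vert_rhs nu e) _.
  apply: etrans _ (esym (congr2 (fun p q => f m *: p + q) (vert_rhs nu1 e) (vert_rhs nu2 e))).
  have H1 := etrans (congr1 ('d (secfun e t c) (chart c m)) vE) (diff_linear _ _ _ _ _).
  have H2 := etrans (congr1 (@triv R M E t m) D1) (trivP hE _ _ _ tm).
  apply: etrans (congr2 (fun p q => p - q) H1 H2) _.
  by rewrite scalerBr opprD addrACA.
- apply: etrans (horz_rhs nu e) _.
  apply: etrans _ (esym (congr2 (fun p q => f m *: p + q) (horz_rhs nu1 e) (horz_rhs nu2 e))).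
  have H1 := codiff_secfun hA hD sf n2E cm tm (triv t (e m)).
  have H2 := etrans (congr1 (@cco R M c m) D2) (etrans (ccoP hA cm _ _ _)
    (congr1 (fun z => _ + z) (ccoP hA cm _ _ _))).
  apply: etrans (congr2 (fun p q => p - q) H1 H2) _.
  have P : pairing (nu1 m) (core_inl e m) = dot (triv t (e m)) (@dco R M E t m (nu1 m).2).
    by rewrite /pairing /= zero_lfunE addr0 (dco_apply hE tm).
  apply: etrans _ (cancel_defect _ _ _ _ _ _ _).
  exact: (congr1 (fun z => _ - (z *: _ + _)) P).
Qed.

Lemma rhs_right (f : M -> R) nu (e1 e2 e : section E) :
  smoothM setT f -> (forall q, e q = f q *: e1 q + e2 q) ->
  vert c t (rhs nu e m) = f m *: vert c t (rhs nu e1 m) + vert c t (rhs nu e2 m) /\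
  horz c t (rhs nu e m) = f m *: horz c t (rhs nu e1 m) + horz c t (rhs nu e2 m).
Proof.
move=> sf eE.
have tE q : core_inl e q = f q *: core_inl e1 q + core_inl e2 q.
  rewrite /= eE; congr pair.
  exact: (esym (etrans (congr1 (fun z => z + 0) (scaler0 _ _)) (addr0 _))).
have DE := dorfman_right_comb nu m sf tE.
have dfE : 'd (f \o chart_inv c) (chart c m) (@vco R M c m (nu m).1) =
    ddiff f m (nu m).1.
  apply: etrans (esym (dot_ddiff hA _ sf cm)) _.
  exact: (esym (cco_apply hA cm _ _)).
have D1 : (D nu (core_inl e) m).1 = (ddiff f m (nu m).1 : R) *: e1 m +
    (f m *: (D nu (core_inl e1) m).1 + (D nu (core_inl e2) m).1).
  apply: etrans (congr1 fst DE) _.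
  exact: etrans (congr1 (fun z => z + _) (addrC _ _)) (esym (addrA _ _ _)).
have D2 : (D nu (core_inl e) m).2 = f m *: (D nu (core_inl e1) m).2 + (D nu (core_inl e2) m).2.
  apply: etrans (congr1 snd DE) (congr1 (fun z => z + _) _).
  exact: etrans (congr1 (fun z => _ + z) (scaler0 _ _)) (addr0 _).
split.
- apply: etrans (vert_rhs nu e) _.
  apply: etrans _ (esym (congr2 (fun p q => f m *: p + q) (vert_rhs nu e1) (vert_rhs nu e2))).
  have H1 := diff_secfun hA hE sf eE cm tm (@vco R M c m (nu m).1).
  have H2 := etrans (congr1 (@triv R M E t m) D1) (etrans (trivP hE _ _ _ tm)
    (congr1 (fun z => _ + z) (trivP hE _ _ _ tm))).
  apply: etrans (congr2 (fun p q => p - q) H1 H2) _.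
  apply: etrans _ (cancel_defect _ _ _ _ _ _ _).
  exact: (congr1 (fun z => z *: _ + _ + _ - _) dfE).
- apply: etrans (horz_rhs nu e) _.
  apply: etrans _ (esym (congr2 (fun p q => f m *: p + q) (horz_rhs nu e1) (horz_rhs nu e2))).
  have H1 := etrans (congr1 (codiff (secfun (anchor2 hA hE nu) t c) (chart c m))
    (etrans (congr1 (@triv R M E t m) (eE m)) (trivP hE _ _ _ tm))) (codiffP _ _ _ _ _).
  have H2 := etrans (congr1 (@cco R M c m) D2) (ccoP hA cm _ _ _).
  apply: etrans (congr2 (fun p q => p - q) H1 H2) _.
  by rewrite scalerBr opprD addrACA.
Qed.

Let rhs_value_left (nu nu' : section (anchorB E)) e : nu m = nu' m ->
  vert c t (rhs nu e m) = vert c t (rhs nu' e m) /\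
  horz c t (rhs nu e m) = horz c t (rhs nu' e m).
Proof.
move=> nn; split.
- apply: (tensorial hM hN (T := fun nu => vert c t (rhs nu e m)) _ nn).
  by move=> f s1 s2 s sf sE; exact: (rhs_left e sf sE).1.
- apply: (tensorial hM hN (T := fun nu => horz c t (rhs nu e m)) _ nn).
  by move=> f s1 s2 s sf sE; exact: (rhs_left e sf sE).2.
Qed.

Let rhs_value_right nu (e e' : section E) : e m = e' m ->
  vert c t (rhs nu e m) = vert c t (rhs nu e' m) /\
  horz c t (rhs nu e m) = horz c t (rhs nu e' m).
Proof.
move=> ee; split.
- apply: (tensorial hM hE (T := fun e => vert c t (rhs nu e m)) _ ee).
  by move=> f s1 s2 s sf sE; exact: (rhs_right nu sf sE).1.
- apply: (tensorial hM hE (T := fun e => horz c t (rhs nu e m)) _ ee).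
  by move=> f s1 s2 s sf sE; exact: (rhs_right nu sf sE).2.
Qed.

(** Both arguments may be changed away from [m], one after the other. *)
Lemma rhs_value (nu nu' : section (anchorB E)) (e e' : section E) : nu m = nu' m -> e m = e' m ->
  vert c t (rhs nu e m) = vert c t (rhs nu' e' m) /\
  horz c t (rhs nu e m) = horz c t (rhs nu' e' m).
Proof.
move=> nn ee; have [a b] := rhs_value_left e nn; have [a' b'] := rhs_value_right nu' ee.
exact: (conj (etrans a a') (etrans b b')).
Qed.

End RhsCoord.

Let at_nu m (nu : fib (anchorB E) m) : section (anchorB E) :=
  sval (cid (section_through hM hN nu)).
Let at_nuE m (nu : fib (anchorB E) m) : at_nu nu m = nu := svalP (cid (section_through hM hN nu)).
Let at_e m (e : fib E m) : section E := sval (cid (section_through hM hE e)).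
Let at_eE m (e : fib E m) : at_e e m = e := svalP (cid (section_through hM hE e)).

(** The value is written down by its coordinates rather than as [rhs] itself,
    which lives over the value at [m] of a section through [e], a point that is
    only propositionally equal to [e]. *)
Definition sigma : presplitting E := fun m nu e =>
  let c := chart_at m in let t := triv_at E m in
  let x := rhs (at_nu nu) (at_e e) m in
  (@trivI _ _ (tbundle (tot E)) (c, t) (tot_pt e) (row_mx (@vco R M c m nu.1) (vert c t x)),
   @trivI _ _ (cotbundle (tot E)) (c, t) (tot_pt e) (row_mx (horz c t x) (@dco R M E t m nu.2))).

Section AtPreferred.
Context (m : M).
Let c := chart_at m.
Let t := triv_at E m.
Let cm : cdom c m := atlas_at hA m.
Let tm : tdom t m := triv_at_dom hE m.

Let vcoE_sigma nu e : @vcoE R M E c t m e (sigma nu e).1 =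
  row_mx (@vco R M c m nu.1) (vert c t (rhs (at_nu nu) (at_e e) m)).
Proof. exact: (@trivIK _ _ _ hTE (c, t) (tot_pt e) (conj cm tm)). Qed.

Let ccoE_sigma nu e : @ccoE R M E c t m e (sigma nu e).2 =
  row_mx (horz c t (rhs (at_nu nu) (at_e e) m)) (@dco R M E t m nu.2).
Proof. exact: (@trivIK _ _ _ hCE (c, t) (tot_pt e) (conj cm tm)). Qed.

Lemma sigma_Phi nu e : Phi e (@sigma m nu e) = nu.
Proof.
apply: (Phi_eq hA hE cm tm).
- by apply: etrans (congr1 lsubmx (vcoE_sigma nu e)) _; rewrite row_mxKl.
- by apply: etrans (congr1 rsubmx (ccoE_sigma nu e)) _; rewrite row_mxKr.
Qed.

Lemma sigma_rhs (nu : section (anchorB E)) (e : section E) :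
  @sigma m (nu m) (e m) = rhs nu e m.
Proof.
have [h1 h2] := rhs_value cm tm (at_nuE (nu m)) (at_eE (e m)).
apply: (big_ext hA hE cm tm).
- exact: etrans (sigma_Phi _ _) (esym (Phi_rhs cm tm nu e)).
- apply: etrans _ h1; apply: etrans (congr1 rsubmx (vcoE_sigma _ _)) _.
  by rewrite row_mxKr.
- apply: etrans _ h2; apply: etrans (congr1 lsubmx (ccoE_sigma _ _)) _.
  by rewrite row_mxKl.
Qed.

End AtPreferred.

Section Linear.
Context (c : cidx M) (t : tidx E) (m : M) (cm : cdom c m) (tm : tdom t m).

Lemma sigma_linl a (nu nu' : fib (anchorB E) m) e :
  vert c t (sigma (a *: nu + nu') e) =
    a *: vert c t (sigma nu e) + vert c t (sigma nu' e) /\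
  horz c t (sigma (a *: nu + nu') e) =
    a *: horz c t (sigma nu e) + horz c t (sigma nu' e).
Proof.
have [s1 <-] := section_through hM hN nu.
have [s2 <-] := section_through hM hN nu'.
have [se <-] := section_through hM hE e.
pose s := mk_section hA hN (smoothS_D hA hN (is_openT hA)
  (section_smoothS hA hN (scaled hN (smoothM_cst setT a) s1) setT)
  (section_smoothS hA hN s2 setT)).
rewrite -[a *: s1 m + s2 m]/(s m) !sigma_rhs.
by apply: (@rhs_left c t m cm tm (fun=> a) s1 s2 s se (smoothM_cst setT a)).
Qed.

Let sigma_sections a nu (e1 e2 e : section E) :
  (forall q, e q = a *: e1 q + e2 q) ->
  vert c t (@sigma m nu (e m)) =
    a *: vert c t (@sigma m nu (e1 m)) + vert c t (@sigma m nu (e2 m)) /\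
  horz c t (@sigma m nu (e m)) =
    a *: horz c t (@sigma m nu (e1 m)) + horz c t (@sigma m nu (e2 m)).
Proof.
have [s <-] := section_through hM hN nu => eE.
rewrite !sigma_rhs; exact: (rhs_right cm tm s (smoothM_cst setT a) eE).
Qed.

Lemma sigma_add nu (e e' : fib E m) :
  vert c t (sigma nu (e + e')) = vert c t (sigma nu e) + vert c t (sigma nu e') /\
  horz c t (sigma nu (e + e')) = horz c t (sigma nu e) + horz c t (sigma nu e').
Proof.
have [e1 <-] := section_through hM hE e.
have [e2 <-] := section_through hM hE e'.
pose s := mk_section hA hE (smoothS_D hA hE (is_openT hA)
  (section_smoothS hA hE e1 setT) (section_smoothS hA hE e2 setT)).
rewrite -[e1 m + e2 m]/(s m).
have sE q : s q = 1 *: e1 q + e2 q by rewrite scale1r.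
by have [-> ->] := sigma_sections nu sE; rewrite !scale1r.
Qed.

Lemma sigma_scale a nu (e : fib E m) :
  vert c t (sigma nu (a *: e)) = a *: vert c t (sigma nu e) /\
  horz c t (sigma nu (a *: e)) = a *: horz c t (sigma nu e).
Proof.
have [e1 <-] := section_through hM hE e.
pose z := zero_section hA hE.
pose s := scaled hE (smoothM_cst setT a) e1.
rewrite -[a *: e1 m]/(s m).
(* additivity on [0 = - 0 + 0] shows that the value on [z] vanishes *)
have zE q : z q = (-1) *: z q + z q by rewrite /= scaler0 addr0.
have [z1 z2] := sigma_sections nu zE.
rewrite scaleN1r addNr in z1; rewrite scaleN1r addNr in z2.
have sE q : s q = a *: e1 q + z q by rewrite /= addr0.
have [-> ->] := sigma_sections nu sE.
exact: (conj (etrans (congr1 (fun x => _ + x) z1) (addr0 _))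
  (etrans (congr1 (fun x => _ + x) z2) (addr0 _))).
Qed.

(** Bilinearity on finite sums, in the form needed to expand in two frames. *)
Lemma sigma_expand (nu : fib (anchorB E) m) (e : fib E m) n k
    (x : 'I_n -> R) (f : 'I_n -> fib (anchorB E) m) (y : 'I_k -> R) (g : 'I_k -> fib E m) :
  nu = \sum_i x i *: f i -> e = \sum_j y j *: g j ->
  vert c t (sigma nu e) = \sum_i x i *: \sum_j y j *: vert c t (sigma (f i) (g j)) /\
  horz c t (sigma nu e) = \sum_i x i *: \sum_j y j *: horz c t (sigma (f i) (g j)).
Proof.
move=> -> ->.
have lz nu' : vert c t (sigma nu' (0 : fib E m)) = 0 /\ horz c t (sigma nu' (0 : fib E m)) = 0.
  by have := sigma_scale 0 nu' 0; rewrite !scaler0 !scale0r.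
have zl e' : vert c t (sigma (0 : fib (anchorB E) m) e') = 0 /\
    horz c t (sigma (0 : fib (anchorB E) m) e') = 0.
  have := sigma_linl (-1) 0 0 e'; rewrite scaler0 addr0 => -[h1 h2].
  by split; [rewrite h1 | rewrite h2]; rewrite scaleN1r addNr.
have He nu' (r : seq 'I_k) :
    vert c t (sigma nu' (\sum_(j <- r) y j *: g j)) =
      \sum_(j <- r) y j *: vert c t (sigma nu' (g j)) /\
    horz c t (sigma nu' (\sum_(j <- r) y j *: g j)) =
      \sum_(j <- r) y j *: horz c t (sigma nu' (g j)).
  elim: r => [|j r [IH1 IH2]]; first by rewrite !big_nil.
  rewrite !big_cons; have [-> ->] := sigma_add nu' (y j *: g j) (\sum_(j <- r) y j *: g j).
  by have [-> ->] := sigma_scale (y j) nu' (g j); rewrite IH1 IH2.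
elim: (index_enum 'I_n) => [|i r [IH1 IH2]]; first by rewrite !big_nil.
rewrite big_cons [in X in _ = X /\ _]big_cons [in X in _ /\ _ = X]big_cons.
have [-> ->] := sigma_linl (x i) (f i) (\sum_(i <- r) x i *: f i)
  (\sum_j y j *: g j).
by have [-> ->] := He (f i) (index_enum 'I_k); rewrite IH1 IH2.
Qed.

End Linear.

Lemma sigma_linear_E m a (nu nu' : fib (anchorB E) m) e :
  sigma (a *: nu + nu') e = a *: sigma nu e + sigma nu' e.
Proof.
have cm : cdom (chart_at m) m := atlas_at hA m.
have tm : tdom (triv_at E m) m := triv_at_dom hE m.
have [v h] := sigma_linl cm tm a nu nu' e.
apply: (big_ext hA hE cm tm).
- by rewrite (PhiP hA hE cm tm) !sigma_Phi.
- by rewrite v (vertP hA hE cm tm).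
- by rewrite h (horzP hA hE cm tm).
Qed.

Lemma sigma_addTM m (nu : fib (anchorB E) m) (e e' : fib E m) :
  tadd e e' (sigma nu e).1 (sigma nu e').1 (sigma nu (e + e')).1 /\
  cotadd e e' (sigma nu e).2 (sigma nu e').2 (sigma nu (e + e')).2.
Proof.
have cm : cdom (chart_at m) m := atlas_at hA m.
have tm : tdom (triv_at E m) m := triv_at_dom hE m.
apply: (splitting_add_coord hA hE cm tm (x := sigma nu e) (x' := sigma nu e')
  (y := sigma nu (e + e')) _ _).2.
- exact: etrans (sigma_Phi _ _) (esym (sigma_Phi _ _)).
- exact: etrans (sigma_Phi _ _) (esym (sigma_Phi _ _)).
- exact: (sigma_add cm tm).
Qed.

Lemma sigma_scaleTM m a (nu : fib (anchorB E) m) (e : fib E m) :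
  (sigma nu (a *: e)).1 = tscale a e (sigma nu e).1 /\
  cotscale a e (sigma nu e).2 (sigma nu (a *: e)).2.
Proof.
have cm : cdom (chart_at m) m := atlas_at hA m.
have tm : tdom (triv_at E m) m := triv_at_dom hE m.
apply: (splitting_scale_coord hA hE cm tm (x := sigma nu e) (y := sigma nu (a *: e)) _).2.
- exact: etrans (sigma_Phi _ _) (esym (sigma_Phi _ _)).
- exact: (sigma_scale cm tm).
Qed.

Lemma smoothM_rhs (nu : section (anchorB E)) (e : section E) c t :
  smoothM (cdom c `&` tdom t) (fun m => vert c t (rhs nu e m)) /\
  smoothM (cdom c `&` tdom t) (fun m => horz c t (rhs nu e m)).
Proof.
set N := cdom c `&` tdom t.
have oN := is_open_dom hA hE c t.
have Nc : N `<=` cdom c by move=> q [].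
have Nt : N `<=` tdom t by move=> q [].
have se := smoothM_S Nt (smoothM_sec hA hE e t).
have seps := smoothM_S Nt (smoothM_sec hA hD (anchor2 hA hE nu) t).
have sX := smoothM_S Nc (smoothM_sec hA hTM (anchor1 hA hE nu) c).
have sD1 := smoothM_S Nt (smoothM_sec hA hE (core1 hA hE (D nu (core_inl e))) t).
have sD2 := smoothM_S Nc (smoothM_sec hA hCM (core2 hA hE (D nu (core_inl e))) c).
split.
- apply: (smoothM_eq hA oN _ (smoothM_D oN (smoothM_diff hA oN Nc se sX) (smoothM_N oN sD1))).
  by move=> q [cq tq]; rewrite (vert_rhs cq tq).
- apply: (smoothM_eq hA oN _ (smoothM_D oN (smoothM_codiff hA oN Nc seps se) (smoothM_N oN sD2))).
  by move=> q [cq tq]; rewrite (horz_rhs cq tq).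
Qed.

(** Near a point, [sigma] is bilinear with coefficients its values on frames,
    and these are smooth since frames extend to global sections. *)
Lemma sigma_smooth :
  smooth_map (fun z : tot (whitney (anchorB E) E) =>
                tot_pt (sigma (projT2 z).1 (projT2 z).2)).
Proof.
have hW : is_vbundle (whitney (anchorB E) E) := whitney_vbundle hA hN hE.
have hTW := tot_atlas hA hW.
have hB := big_vbundle hA hE.
apply: (smooth_to_tot hT hB hTW) => z0.
set m0 := projT1 z0; set c := chart_at m0; set t := triv_at E m0.
have cm0 : cdom c m0 := atlas_at hA m0.
have tm0 : tdom t m0 := triv_at_dom hE m0.
pose ct : tidx (anchorB E) := (c, t).
have ctm0 : tdom ct m0 by [].
have [nus [N1 [oN1 N1m E1]]] := extend_frame hM hN ctm0.
have [es [N2 [oN2 N2m E2]]] := extend_frame hM hE tm0.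
set Nct := cdom c `&` tdom t.
have oNct := is_open_dom hA hE c t.
pose N0 := N1 `&` N2 `&` Nct.
have oN0 : is_open N0.
  by apply: (is_openI hA) => //; exact: (is_openI hA).
pose W := @bproj R M (whitney (anchorB E) E) @^-1` N0.
have oW : is_open W by apply: (bproj_smooth hA hW).1.
pose wt : tidx (whitney (anchorB E) E) := (ct, t).
have Wd : W `<=` @cdom _ (tot (whitney (anchorB E) E)) (c, wt).
  by move=> z [_ [cz tz]].
have sch := smoothM_S Wd (smoothM_chart hTW ((c, wt) : cidx (tot (whitney (anchorB E) E)))).
have sr := smoothM_clin oW (clin_rsubmx (mdim M) ((mdim M + rank E) + rank E)) sch.
have sbase : smoothM W (fun z => chart c (projT1 z)).
  apply: (smoothM_eq hTW oW _ (smoothM_clin oW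
    (clin_lsubmx (mdim M) ((mdim M + rank E) + rank E)) sch)) => z Wz /=.
  by rewrite row_mxKl.
have snu : smoothM W (fun z => @triv R M (anchorB E) ct (projT1 z) (projT2 z).1).
  apply: (smoothM_eq hTW oW _ (smoothM_clin oW (clin_lsubmx (mdim M + rank E) (rank E)) sr)).
  by move=> z Wz /=; rewrite row_mxKr row_mxKl.
have se : smoothM W (fun z => @triv R M E t (projT1 z) (projT2 z).2).
  apply: (smoothM_eq hTW oW _ (smoothM_clin oW (clin_rsubmx (mdim M + rank E) (rank E)) sr)).
  by move=> z Wz /=; rewrite !row_mxKr.
have sX : smoothM W (fun z => @vco R M c (projT1 z) (projT2 z).1.1).
  apply: (smoothM_eq hTW oW _ (smoothM_clin oW (clin_lsubmx (mdim M) (rank E)) snu)).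
  by move=> z Wz /=; rewrite row_mxKl.
have seps : smoothM W (fun z => @dco R M E t (projT1 z) (projT2 z).1.2).
  apply: (smoothM_eq hTW oW _ (smoothM_clin oW (clin_rsubmx (mdim M) (rank E)) snu)).
  by move=> z Wz /=; rewrite row_mxKr.
have expand z : W z ->
    vert c t (sigma (projT2 z).1 (projT2 z).2) =
      \sum_i @triv R M (anchorB E) ct (projT1 z) (projT2 z).1 0 i *:
      \sum_j @triv R M E t (projT1 z) (projT2 z).2 0 j *:
        vert c t (rhs (nus i) (es j) (projT1 z)) /\
    horz c t (sigma (projT2 z).1 (projT2 z).2) =
      \sum_i @triv R M (anchorB E) ct (projT1 z) (projT2 z).1 0 i *:
      \sum_j @triv R M E t (projT1 z) (projT2 z).2 0 j *:
        horz c t (rhs (nus i) (es j) (projT1 z)).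
  move=> [[N1z N2z] [cz tz]].
  have F1 := frame_expand hN (projT2 z).1 (conj cz tz : tdom ct (projT1 z)).
  have F2 := frame_expand hE (projT2 z).2 tz.
  have [-> ->] := sigma_expand cz tz F1 F2.
  split; apply: eq_bigr => i _; apply: (congr1 (fun x => _ *: x));
    apply: eq_bigr => j _; apply: (congr1 (fun x => _ *: x));
    by rewrite -(E1 i _ N1z) -(E2 j _ N2z) sigma_rhs.
have pull (V : normedModType R) (f : M -> V) : smoothM Nct f ->
    smoothM W (fun z => f (projT1 z)).
  move=> sf; have [_ sp] := smoothM_pullback hTW hA oNct (bproj_smooth hA hW) sf.
  by apply: smoothM_S sp => z [_].
have sv : smoothM W (fun z => vert c t (sigma (projT2 z).1 (projT2 z).2)).
  have s1 := smoothM_sum oW (fun i => smoothM_scale oW (smoothM_coord i oW snu)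
    (smoothM_sum oW (fun j => smoothM_scale oW (smoothM_coord j oW se)
      (pull _ _ (smoothM_rhs (nus i) (es j) c t).1)))).
  by apply: (smoothM_eq hTW oW _ s1) => z /expand [-> _].
have sh : smoothM W (fun z => horz c t (sigma (projT2 z).1 (projT2 z).2)).
  have s1 := smoothM_sum oW (fun i => smoothM_scale oW (smoothM_coord i oW snu)
    (smoothM_sum oW (fun j => smoothM_scale oW (smoothM_coord j oW se)
      (pull _ _ (smoothM_rhs (nus i) (es j) c t).2)))).
  by apply: (smoothM_eq hTW oW _ s1) => z /expand [_ ->].
exists ((c, t) : cidx (tot E)), (((c, t), (c, t)) : tidx (bigB E)), W; split.
- exact: oW.
- exact: (conj (conj N1m N2m) (conj cm0 tm0)).
- by move=> z [_ [cz tz]]; split.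
- exact: (smoothM_row_mx oW sbase se).
- have s1 := smoothM_row_mx oW (smoothM_row_mx oW sX sv) (smoothM_row_mx oW sh seps).
  apply: (smoothM_eq hTW oW _ s1) => z [_ [cz tz]].
  have P := sigma_Phi (projT2 z).1 (projT2 z).2.
  have V1 := vco_Phi hA hE cz tz (sigma (projT2 z).1 (projT2 z).2).
  have V2 := dco_Phi hA hE cz tz (sigma (projT2 z).1 (projT2 z).2).
  rewrite P in V1; rewrite P in V2; rewrite -V1 -V2.
  exact: (congr2 (fun x y => row_mx x y) (hsubmxK _) (hsubmxK _)).
Qed.

Definition splitting_of : linear_splitting E :=
  @LinearSplitting R M E sigma sigma_smooth (@sigma_Phi) sigma_linear_E sigma_addTM
    sigma_scaleTM.

Lemma splitting_of_formula : splitting_formula splitting_of D.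
Proof.
move=> nu e tau tauE m.
have -> : tau = core_inl e by apply: section_eq => q; rewrite tauE.
exact: sigma_rhs.
Qed.

(** The formula prescribes the value at [(nu m, e m)] for all sections, and these
    values are arbitrary. *)
Lemma splitting_formula_unique (S S' : presplitting E) :
  splitting_formula S D -> splitting_formula S' D -> S = S'.
Proof.
move=> HS HS'; apply: functional_extensionality_dep => m.
apply/funext => nu; apply: functional_extensionality_dep => e.
have [s <-] := section_through hM hN nu; have [se <-] := section_through hM hE e.
by rewrite (HS s se (core_inl se) (fun q => erefl) m) (HS' s se (core_inl se) (fun q => erefl) m).
Qed.

End SplittingOf.

(** * Values on 1-forms *)

Section Forms.
Context {R : realType} {M : atlas_space R} {E : vbundle M}.
Context (hM : is_manifold M) (hE : is_vbundle E).
Let hA : is_atlas M := manifold_atlas hM.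
Let hTM : is_vbundle (tbundle M) := tbundle_vbundle hA.
Let hCM : is_vbundle (cotbundle M) := dual_vbundle hA hTM.

Lemma smoothS_ddiff (f : M -> R) : smoothM setT f ->
  @smoothS R M (cotbundle M) setT (fun q => ddiff f q).
Proof.
move=> sf c; rewrite setTI; have oc := is_open_cdom hA c.
apply: (smoothM_rows oc) => l.
have sc : smoothM (cdom c) f by exact: smoothM_S sf.
have := smoothM_diff hA oc (@subset_refl _ _) sc (smoothM_cst _ (delta_mx 0 l)).
apply: (smoothM_eq hA oc) => q cq.
exact: etrans (esym (dot_ddiff hA _ sf cq)) (dot_delta _ _).
Qed.

(** A linear function in a chart, extended by a cutoff. *)
Lemma function_with_differential m (th : 'Hom(tspace m, R^o)) :
  exists2 f : M -> R, smoothM setT f & ddiff f m = th.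
Proof.
set c := chart_at m; have cm : cdom c m := atlas_at hA m.
have oc := is_open_cdom hA c.
pose y := cco c th.
have ly : clin (fun x : 'rV[R]_(mdim M) => dot x y).
  by apply: clin_rV => a u v; exact: dotPl.
have sl : smoothM (cdom c) (fun q => dot (chart c q) y).
  exact: (smoothM_clin oc ly (smoothM_chart hA c)).
have [f [N [sf oN Nm fE]]] := extend_fun hM oc cm sl.
exists f => //; apply: (cco_ext hA cm); apply: dot_ext => w.
apply: etrans (dot_ddiff hA w sf cm) _.
have [dl El] := clin_diff (chart c m) ly.
apply: etrans _ (El w).
apply: near_eq_diff; first exact: (smoothM_differentiable sf I cm).
apply: (near_chart (c := c) oN Nm cm) => q Nq cq /=.
by rewrite (atlasK hA cq) fE.
Qed.

(** The difference of two Dorfman connections is tensorial in its second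
    argument and vanishes on exact 1-forms; every covector is the value of an
    exact 1-form. *)
Lemma dorfman_forms_eq (D D' : dorfman E) nu (tau : section (coreB E)) m :
  (forall q, (tau q).1 = 0) -> dorfman_map D nu tau m = dorfman_map D' nu tau m.
Proof.
move=> tau0.
pose form (th : section (cotbundle M)) := core_pair hA hE (zero_section hA hE) th.
pose T th := dorfman_map D nu (form th) m - dorfman_map D' nu (form th) m.
have comb (f : M -> R) (th1 th2 th : section (cotbundle M)) : smoothM setT f ->
    (forall q, th q = f q *: th1 q + th2 q) -> T th = f m *: T th1 + T th2.
  move=> sf thE.
  have fE q : form th q = f q *: form th1 q + form th2 q.
    rewrite /= thE; congr pair.
    exact: (esym (etrans (congr1 (fun z => z + 0) (scaler0 _ _)) (addr0 _))).
  rewrite /T (dorfman_right_comb hM hE D nu m sf fE).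
  rewrite (dorfman_right_comb hM hE D' nu m sf fE).
  have alg (V : lmodType R) (k : R) (a b x a' b' : V) :
      k *: a + x + b - (k *: a' + x + b') = k *: (a - a') + (b - b').
    by rewrite scalerBr opprD opprD addrACA; congr (_ + _); rewrite addrACA subrr addr0.
  exact: alg.
have [f sf fm] := @function_with_differential m (tau m).2.
pose df := mk_section hA hCM (smoothS_ddiff sf).
have tE : tau = form (core2 hA hE tau).
  apply: section_eq => q; rewrite /=; move: (tau0 q).
  by case: (tau q) => a b /= ->.
have Tdf : T df = 0.
  have sf' : smooth_fun f by apply/smooth_funP.
  by rewrite /T !(dorfman_exact _ nu sf' (tau := form df))// subrr.
have := tensorial hM hCM comb (s := core2 hA hE tau) (s' := df) (esym fm).
by rewrite Tdf /T -tE => /subr0_eq.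
Qed.

(** The splitting defined by [D] induces a Dorfman connection whose values on
    1-forms are Lie derivatives, hence so are those of [D]. *)
Lemma dorfman_lie_formula (D : dorfman E) : lie_formula D.
Proof.
move=> nu th tau tauE m.
have tau0 q : (tau q).1 = 0 by rewrite tauE.
rewrite (dorfman_forms_eq D (dorfman_of hA hE (splitting_of hM hE D)) nu m tau0).
exact: (@delta_lie_formula R M E hA hE (splitting_of hM hE D) nu th tau tauE m).
Qed.

End Forms.

Theorem theorem4p1 (R : realType) (M : atlas_space R) (E : vbundle M)
    (hM : is_manifold M) (hE : is_vbundle E) :
  exists (DeltaOf : linear_splitting E -> dorfman E)
         (SigmaOf : dorfman E -> linear_splitting E),
    (forall (Sigma : linear_splitting E) (Delta : preconnection E),
       connection_bilinear Delta ->
       ((splitting_formula Sigma Delta /\ lie_formula Delta) <->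
        Delta = dorfman_map (DeltaOf Sigma))) /\
    (forall (Delta : dorfman E) (Sigma : presplitting E),
       splitting_formula Sigma Delta <-> Sigma = splitting_map (SigmaOf Delta)) /\
    (forall Sigma : linear_splitting E, SigmaOf (DeltaOf Sigma) = Sigma) /\
    (forall Delta : dorfman E, DeltaOf (SigmaOf Delta) = Delta).
Proof.
have hA := manifold_atlas hM.
have bil (Sg : linear_splitting E) : connection_bilinear (delta hA hE Sg) :=
  @delta_bilinear R M E hA hE Sg.
have spl (Sg : linear_splitting E) : splitting_formula Sg (delta hA hE Sg) :=
  @delta_splitting_formula R M E hA hE Sg.
have lie (Sg : linear_splitting E) : lie_formula (delta hA hE Sg) :=
  @delta_lie_formula R M E hA hE Sg.
exists (dorfman_of hA hE), (splitting_of hM hE); split; [|split; [|split]].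
- move=> Sg D Dbil; split=> [[Ds Dl]|->]; last by split; [exact: spl | exact: lie].
  exact: (connection_unique hA hE Dbil Ds Dl (bil Sg) (spl Sg) (lie Sg)).
- move=> D S; split=> [DS|->]; last exact: splitting_of_formula.
  exact: (splitting_formula_unique hM hE DS (splitting_of_formula hM hE D)).
- move=> Sg; apply: splitting_eq.
  exact: (splitting_formula_unique (Df := dorfman_of hA hE Sg) hM hE
    (splitting_of_formula hM hE _) (spl Sg)).
- move=> D; apply: dorfman_eq; set Sg := splitting_of hM hE D.
  exact: (connection_unique hA hE (bil Sg) (spl Sg) (lie Sg) (dorfman_bilinear D)
    (splitting_of_formula hM hE D) (dorfman_lie_formula hM hE D)).
Qed.
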